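(* Let $Q = (\mathcal{I}, E)$ be a quiver, $\mathbf{v} \in \mathbb{Z}^{\mathcal{I}}_{\geq 0}$ a dimension vector, $\alpha$ a central parameter, and $\mathbf{v}^*$ a Harder-Narasimhan type. Then there exists an open neighbourhood $U_{\mathbf{v}^*}$ of the Harder-Narasimhan stratum $\mathrm{Rep}(Q, \mathbf{v})_{\mathbf{v}^*}$ in $\mathrm{Rep}(Q, \mathbf{v})$ that is homeomorphic to a disk bundle of (complex) rank $d(Q, \mathbf{v}, \mathbf{v}^* )$ over $\mathrm{Rep}(Q, \mathbf{v})_{\mathbf{v}^*}$.
   Context: A quiver $Q=(\mathcal{I},E)$ is a finite oriented graph; $\mathrm{out}(a),\mathrm{in}(a)$ are the tail and head of $a\in E$. $V_\ell$ are hermitian vector spaces with $\dim_{\mathbb{C}}V_\ell=v_\ell$; $\mathrm{Rep}(Q,\mathbf{v})=\bigoplus_{a\in E}\mathrm{Hom}(V_{\mathrm{out}(a)},V_{\mathrm{in}(a)})$; $\mathrm{Vect}(Q,\mathbf{v})=\bigoplus_\ell V_\ell$; $\mathfrak{g}_{\mathbb{C}}=\prod_\ell\mathfrak{gl}(V_\ell)$. The central parameter is $\alpha=(\alpha_\ell)\in(i\mathbb{R})^{\mathcal{I}}$ with $\sum_\ell\alpha_\ell v_\ell=0$. The slope of a nonzero dimension vector $\mathbf{w}$ is $\mu_\alpha(Q,\mathbf{w})=\left(\sum_\ell i\alpha_\ell w_\ell\right)/\left(\sum_\ell w_\ell\right)$. A subrepresentation is a collection of subspaces preserved by all $A_a$,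 with restricted maps. The Harder-Narasimhan filtration of $A$ is $0=A_0\subsetneq A_1\subsetneq\cdots\subsetneq A_L=A$ where each $A_j/A_{j-1}$ is the nonzero subrepresentation of $A/A_{j-1}$ of maximal slope and, among those, maximal rank; its type is $\mathbf{v}^*=(\mathbf{v}_1,\dots,\mathbf{v}_L)$, $\mathbf{v}_j$ being the dimension vector of $A_j/A_{j-1}$. $\mathrm{Rep}(Q,\mathbf{v})_{\mathbf{v}^*}$ is the set of representations of type $\mathbf{v}^*$. Fix a filtration $*$ of $\mathrm{Vect}(Q,\mathbf{v})$ of type $\mathbf{v}^*$, with associated orthogonal splitting $V_\ell=\bigoplus_{j=1}^LV_{\ell,j}$, $\dim V_{\ell,j}=(\mathbf{v}_j)_\ell$, the $p$-th step of the filtration being $\bigoplus_\ell\bigoplus_{j\le p}V_{\ell,j}$. Then $\mathrm{Rep}(Q,\mathbf{v})_*^{LT}=\bigoplus_a\bigoplus_{j<k}\mathrm{Hom}(V_{\mathrm{out}(a),j},V_{\mathrm{in}(a),k})$ and $(\mathfrak{g}_{\mathbb{C}})_*^{LT}=\bigoplus_\ell\bigoplus_{j<k}\mathrm{Hom}(V_{\ell,j},V_{\ell,k})$ (strictly block lower-triangular parts), and $d(Q,\mathbf{v},\mathbf{v}^* )=\dim_{\mathbb{C}}\mathrm{Rep}(Q,\mathbf{v})_*^{LT}-\dim_{\mathbb{C}}(\mathfrak{g}_{\mathbb{C}})_*^{LT}$, which depends only on $\mathbf{v}^*$. *)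

(* Defs.v *)
From HB Require Import structures.
From mathcomp Require Import all_boot all_order all_algebra all_character.
From mathcomp Require Import complex.
From mathcomp Require Import all_classical all_reals all_analysis.

Set Implicit Arguments.
Unset Strict Implicit.
Unset Printing Implicit Defensive.

Import Order.TTheory GRing.Theory Num.Theory numFieldNormedType.Exports.

Local Open Scope classical_set_scope.
Local Open Scope ring_scope.

(* [R[i]] only gets its topology when it is seen as an abstract numFieldType. *)
Notation CC R := (R[i] : numClosedFieldType).

(******************************************************************************)
(*  Quiver representations.                                                   *)
(*  V_l is C^(v_l), realised by row vectors: a linear map V_l -> V_m is a     *)
(*  matrix acting on the right, and a subspace of V_l is the row space of a   *)
(*  square matrix of order v_l.                                               *)
(******************************************************************************)

Record quiver := Quiver {
  vertex :> finType;
  edge : finType;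
  out : edge -> vertex;
  inn : edge -> vertex
}.

Definition dim_vector (Q : quiver) := Q -> nat.

(* With its product topology, which is the usual topology of this
   finite-dimensional complex vector space. *)
Definition Rep (R : realType) (Q : quiver) (v : dim_vector Q) : topologicalType :=
  prod_topology (fun a : edge Q => 'M[CC R]_(v (out a), v (inn a))).

Section Representations.
Context (R : realType) (Q : quiver).
Implicit Types v w : dim_vector Q.

Definition central_parameter v (alpha : Q -> CC R) : Prop :=
  (forall l, 'Re (alpha l) = 0) /\ \sum_l alpha l * (v l)%:R = 0.

Definition rank_of w : nat := (\sum_l w l)%N.

(* A real complex number when [alpha] is imaginary; on such numbers the partial
   order of C is the order of the reals. *)
Definition slope (alpha : Q -> CC R) w : CC R :=
  (\sum_l 'i * alpha l * (w l)%:R) / (rank_of w)%:R.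

Definition subspaces v := forall l : Q, 'M[CC R]_(v l).

Definition dimv v (W : subspaces v) : dim_vector Q := fun l => \rank (W l).

Definition subrep v (A : Rep R v) (W : subspaces v) : Prop :=
  forall a : edge Q, (W (out a) *m A a <= W (inn a))%MS.

(* [in_factmod U] and [val_factmod U] are the projection of C^n onto the model
   C^(\rank (cokermx U)) of C^n / U, and a linear section of it. *)
Definition quot_dim v (W : subspaces v) : dim_vector Q :=
  fun l => \rank (cokermx (W l)).

Definition quot_rep v (A : Rep R v) (W : subspaces v) : Rep R (quot_dim W) :=
  fun a => in_factmod (W (inn a)) (val_factmod (U := W (out a)) 1%:M *m A a).

Definition quot_sub v (W W' : subspaces v) : subspaces (quot_dim W) :=
  fun l => <<in_factmod (W l) (W' l)>>%MS.

Definition nonzero_subrep v (A : Rep R v) (W : subspaces v) : Prop :=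
  subrep A W /\ exists l, W l != 0.

Definition max_destabilizing (alpha : Q -> CC R) v (A : Rep R v)
    (W : subspaces v) : Prop :=
  [/\ nonzero_subrep A W,
      forall W', nonzero_subrep A W' ->
        slope alpha (dimv W') <= slope alpha (dimv W)
    & forall W', nonzero_subrep A W' ->
        slope alpha (dimv W') = slope alpha (dimv W) ->
        (rank_of (dimv W') <= rank_of (dimv W))%N].

(* Only the steps F 0, ..., F L are meaningful. *)
Definition HN_filtration (alpha : Q -> CC R) v (A : Rep R v) (L : nat)
    (F : nat -> subspaces v) : Prop :=
  [/\ forall l, F 0 l = 0,
      forall l, row_full (F L l),
      forall j, (j <= L)%N -> subrep A (F j),
      forall j, (j < L)%N -> (forall l, F j l <= F j.+1 l)%MS /\
                             (exists l, F j l < F j.+1 l)%MS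
    & forall j, (j < L)%N ->
        max_destabilizing alpha (quot_rep A (F j)) (quot_sub (F j) (F j.+1))].

(* [vs j] is the dimension vector v_(j+1), since indices in 'I_L start at 0. *)
Definition HN_stratum (alpha : Q -> CC R) v (L : nat)
    (vs : 'I_L -> dim_vector Q) : set (Rep R v) :=
  [set A | exists2 F : nat -> subspaces v, HN_filtration alpha A L F &
     forall j : 'I_L, dimv (quot_sub (F j) (F j.+1)) =1 vs j].

Definition HN_type (alpha : Q -> CC R) v (L : nat)
    (vs : 'I_L -> dim_vector Q) : Prop :=
  HN_stratum alpha (v := v) vs !=set0.

(* dim Rep_*^LT and dim (g_C)_*^LT, where V_(l,j) is C^(vs j l) and the
   dimension of a direct sum of Hom spaces is the sum of their dimensions. *)
Definition dim_Rep_LT (L : nat) (vs : 'I_L -> dim_vector Q) : nat :=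
  (\sum_(a : edge Q) \sum_(j < L) \sum_(k < L | j < k)
     \dim {: 'M[CC R]_(vs j (out a), vs k (inn a))})%N.

Definition dim_g_LT (L : nat) (vs : 'I_L -> dim_vector Q) : nat :=
  (\sum_(l : Q) \sum_(j < L) \sum_(k < L | j < k)
     \dim {: 'M[CC R]_(vs j l, vs k l)})%N.

Definition HN_codim (L : nat) (vs : 'I_L -> dim_vector Q) : int :=
  (dim_Rep_LT vs)%:Z - (dim_g_LT vs)%:Z.

End Representations.

(******************************************************************************)
(*  Complex vector bundles, hermitian metrics and open unit disk bundles.     *)
(******************************************************************************)

(* The total space is the disjoint union of the fibres, with a topology of its
   own: the sigma type itself cannot be used as [total], since the library
   equips it with the disjoint union topology. Over a trivialising open set V,
   [phi] is the fibre coordinate and [psi] the inverse of the trivialisation. *)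
Record vector_bundle (R : realType) (B : topologicalType) (n : nat) :=
  VectorBundle {
  fibre : B -> lmodType (CC R);
  total : topologicalType;
  to_total : {x : B & fibre x} -> total;
  of_total : total -> {x : B & fibre x};
  to_totalK : cancel to_total of_total;
  of_totalK : cancel of_total to_total;
  proj_continuous : continuous (fun e => tag (of_total e));
  locally_trivial : forall x : B,
    exists (V : set B) (phi : forall y, {linear fibre y -> 'rV[CC R]_n})
           (psi : B * 'rV[CC R]_n -> total),
      [/\ open V /\ V x,
          forall y, V y -> bijective (phi y),
          forall y, V y -> forall u : fibre y,
            psi (y, phi y u) = to_total (existT _ y u),
          {within [set e | V (tag (of_total e))],
            continuous (fun e => phi _ (tagged (of_total e)))}
        & {within V `*` setT, continuous psi}]
}.

(* By polarisation, continuity of the squared norm on the total space amounts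
   to continuity of the inner product on pairs of vectors over the same point. *)
Record hermitian_metric (R : realType) (B : topologicalType) (n : nat)
    (X : vector_bundle R B n) := HermitianMetric {
  dotp : forall x : B, {dot (fibre X x) for (@Num.conj (CC R))};
  sqnorm : total X -> CC R :=
    fun e => dotp _ (tagged (of_total e)) (tagged (of_total e));
  sqnorm_continuous : continuous sqnorm
}.

Definition disk_bundle (R : realType) (B : topologicalType) (n : nat)
    (X : vector_bundle R B n) (h : hermitian_metric X) : set (total X) :=
  [set e | sqnorm h e < 1].

Definition zero_section (R : realType) (B : topologicalType) (n : nat)
    (X : vector_bundle R B n) (x : B) : total X :=
  to_total (existT _ x (0 : fibre X x)).

Definition homeomorphism (X Y : topologicalType) (f : X -> Y) : Prop :=
  continuous f /\ exists g : Y -> X, [/\ cancel f g, cancel g f & continuous g].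

(* Main.v *)
Require Import Defs.
From HB Require Import structures.
From mathcomp Require Import all_boot all_order all_algebra all_character.
From mathcomp Require Import complex.
From mathcomp Require Import all_classical all_reals all_analysis.
From mathcomp Require Import ring lra.

(** The stratum S is a locally closed submanifold of the finite-dimensional
    complex vector space Rep, and the neighbourhood is a tubular one for the
    standard hermitian product: the points whose distance to S is small,
    fibred by the nearest point projection. The bundle is the normal bundle of
    S, with the hermitian product rescaled at each point so that the fibres of
    the tube are unit disks.

    S comes without charts, and none are constructed. The theorem
    [tubular_neighbourhood] holds for a subset S of a vector space under five
    conditions that can be checked directly: S is relatively open in a closed
    set T; each point of S has a complex normal space of constant dimension,
    given by an orthogonal projector; this projector depends continuously on
    the point; two nearby points of S differ by a vector orthogonal to the
    normal space up to the square of their distance; and the vector from a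
    nearest point of S is normal. The fourth condition stands in for
    smoothness: it makes normal disks of small radius disjoint, and compactness
    together with the fifth one makes them cover a neighbourhood.

    For the Harder-Narasimhan stratum, T is the set of representations that
    preserve some flag of subspaces with the right dimensions. It is closed
    because flags form a compact space, and S is relatively open in it because
    the existence of a subrepresentation violating the slope conditions, one
    closed condition for each of finitely many dimension vectors, persists in
    the limit ([near_flagged_stratum]). The flag preserved by A in S is unique
    ([HN_flag_unique]), so by compactness it varies continuously with A
    ([flag_of_cont]).

    Let P be the flag of A. The tangent space at A is spanned by the
    representations preserving P and by the infinitesimal gauge orbit, the
    families A X - X A. Hence B is normal when it is strictly lower
    triangular for P and orthogonal to the orbit. Its dimension is computed
    from one fact, [HN_hom_preserves]: if A X - X A preserves P, so does X. This
    is the vanishing of the homomorphisms from a piece of the flag to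
    a quotient of smaller slopes. It makes the lower triangular part of the
    gauge algebra act injectively on lower triangular representations, whence
    the dimension dim Rep^LT - dim g^LT.

    The same fact, now in the stable form of an invertible matrix, gives the
    second order contact ([quadratic_contact]). For nearby A and A' in S there
    is a gauge transformation 1 + X carrying the flag P to the flag of A'. Then
    A' is, up to products of small terms, A plus a representation preserving P
    plus A X - X A, and X is bounded by a multiple of A' - A
    ([displacement_bound]). *)

Set Implicit Arguments.
Unset Strict Implicit.
Unset Printing Implicit Defensive.

Import Order.TTheory GRing.Theory Num.Theory numFieldNormedType.Exports.

Local Open Scope classical_set_scope.
Local Open Scope ring_scope.
Import Normc.
(* The library of vector spaces has another [dimv]. *)
Local Notation dimv := Defs.dimv.

(** * Entrywise norm and limits of complex matrices *)

Section Norm.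
Context {R : realType}.
Local Notation C := (CC R).

(** The sum of the moduli: submultiplicative and real valued, whereas the norm
    of the normed module structure is a maximum with values in C. *)
Definition nrm m n (M : 'M[C]_(m, n)) : R := \sum_i \sum_j normc (M i j).

Lemma normc_ge0 (z : C) : 0 <= normc z.
Proof. by case: z => a b; exact: sqrtr_ge0. Qed.

Lemma normcE (z : C) : `|z| = (normc z)%:C%C.
Proof. by []. Qed.

Lemma normc_sum I (s : seq I) (P : pred I) (f : I -> C) :
  normc (\sum_(i <- s | P i) f i) <= \sum_(i <- s | P i) normc (f i).
Proof.
elim/big_rec2: _ => [|i x y _ le]; first by rewrite normc0.
by apply: le_trans (le_normcD _ _) _; rewrite lerD2l.
Qed.

Lemma normc_conj (z : C) : normc z^* = normc z.
Proof. by apply: (@complexI R); have := norm_conjC z; rewrite !normcE. Qed.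

Lemma normc_real (x : R) : normc (x%:C%C : C) = `|x|.
Proof. by rewrite /= expr0n /= addr0 sqrtr_sqr. Qed.

Lemma nrm_ge0 m n (M : 'M[C]_(m, n)) : 0 <= nrm M.
Proof. by do 2!apply: sumr_ge0 => ? _; exact: normc_ge0. Qed.
Hint Resolve nrm_ge0 normc_ge0 : core.

Lemma nrm_entry m n (M : 'M[C]_(m, n)) i j : normc (M i j) <= nrm M.
Proof.
rewrite /nrm (bigD1 i) //= (bigD1 j) //= -addrA lerDl addr_ge0 //.
  by apply: sumr_ge0.
by do 2!apply: sumr_ge0 => ? _; exact: normc_ge0.
Qed.

Lemma nrm0 m n : nrm (0 : 'M[C]_(m, n)) = 0.
Proof. by rewrite /nrm big1 // => i _; rewrite big1 // => j _; rewrite mxE normc0. Qed.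

Lemma nrm_eq0 m n (M : 'M[C]_(m, n)) : nrm M <= 0 -> M = 0.
Proof.
move=> h; apply/matrixP => i j; rewrite mxE; apply: eq0_normc; apply/le_anti.
by rewrite normc_ge0 (le_trans (nrm_entry _ _ _) h).
Qed.

Lemma nrmN m n (M : 'M[C]_(m, n)) : nrm (- M) = nrm M.
Proof. by apply: eq_bigr => i _; apply: eq_bigr => j _; rewrite mxE normcN. Qed.

Lemma nrmD m n (M N : 'M[C]_(m, n)) : nrm (M + N) <= nrm M + nrm N.
Proof.
rewrite /nrm -big_split ler_sum //= => i _; rewrite -big_split ler_sum //= => j _.
by rewrite mxE le_normcD.
Qed.

Lemma nrmB m n (M N : 'M[C]_(m, n)) : nrm (M - N) <= nrm M + nrm N.
Proof. by rewrite -(nrmN N) nrmD. Qed.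

Lemma nrmM m n p (M : 'M[C]_(m, n)) (N : 'M[C]_(n, p)) :
  nrm (M *m N) <= nrm M * nrm N.
Proof.
rewrite /nrm mulr_suml ler_sum // => i _.
apply: (@le_trans _ _ (\sum_k \sum_j normc (M i j) * normc (N j k))).
  rewrite ler_sum // => k _; rewrite mxE; apply: le_trans (normc_sum _ _ _) _.
  by rewrite ler_sum // => j _; rewrite normcM.
rewrite exchange_big mulr_suml ler_sum //= => j _; rewrite -mulr_sumr ler_wpM2l //.
by rewrite [leRHS](bigD1 j) //= lerDl; do 2!apply: sumr_ge0 => ? _.
Qed.

Lemma nrm_mx_norm m n (M : 'M[C]_(m, n)) : `|M| <= (nrm M)%:C%C.
Proof.
rewrite {1}/Num.norm /=.
have [->|/mx_norm_neq0[i ->]] := eqVneq (mx_norm M) 0; first by rewrite lecR.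
by rewrite normcE lecR nrm_entry.
Qed.

Lemma mx_norm_nrm m n (M : 'M[C]_(m, n)) : (nrm M)%:C%C <= `|M| * (m * n)%:R.
Proof.
have h i j : `|M i j| <= `|M|.
  rewrite [leRHS]mx_normE /=.
  exact: (@le_bigmax _ _ _ _ (fun k => `|M k.1 k.2|%:nng) (i, j)).
rewrite /nrm rmorph_sum /=.
apply: (@le_trans _ _ (\sum_(i < m) \sum_(j < n) `|M|)).
  apply: ler_sum => i _; rewrite rmorph_sum; apply: ler_sum => j _; exact: h.
by rewrite sumr_const card_ord sumr_const card_ord -mulrnA mulnC mulr_natr.
Qed.

Lemma cvg_nrmP T (F : set_system T) (FF : Filter F) m n (f : T -> 'M[C]_(m, n))
    (l : 'M[C]_(m, n)) :
  f t @[t --> F] --> l <->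
  forall e : R, 0 < e -> \forall t \near F, nrm (f t - l) < e.
Proof.
split=> [/cvgrPdist_lt h e e0|h].
  have k0 : 0 < ((m * n).+1%:R : R) by rewrite ltr0n.
  have := h (e / (m * n).+1%:R)%:C%C; rewrite ltcR divr_gt0 // => /(_ isT).
  apply: filterS => t; rewrite distrC => ht.
  rewrite -ltcR; apply: le_lt_trans (mx_norm_nrm _) _.
  apply: (@le_lt_trans _ _ (`|f t - l| * (m * n).+1%:R)).
    by rewrite ler_wpM2l // ler_nat.
  have -> : e%:C%C = (e / (m * n).+1%:R)%:C%C * (m * n).+1%:R :> C.
    by rewrite -[X in _ * X](rmorph_nat (real_complex R)) -rmorphM /= divfK ?gt_eqF.
  by rewrite ltr_pM2r // ltr0n.
apply/cvgrPdist_lt => e e0.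
have [d de] : exists d, e = d%:C%C by apply/complex_realP; exact: gtr0_real.
move: e0; rewrite de ltcR => d0; apply: filterS (h _ d0) => t ht.
by rewrite distrC; apply: le_lt_trans (nrm_mx_norm _) _; rewrite ltcR.
Qed.

Lemma cvg_normcP T (F : set_system T) (FF : Filter F) (f : T -> C) (l : C) :
  f t @[t --> F] --> l <->
  forall e : R, 0 < e -> \forall t \near F, normc (f t - l) < e.
Proof.
split=> [/cvgrPdist_lt h e e0|h].
  have := h e%:C%C; rewrite ltcR => /(_ e0); apply: filterS => t.
  by rewrite distrC normcE ltcR.
apply/cvgrPdist_lt => e e0.
have [d de] : exists d, e = d%:C%C by apply/complex_realP; exact: gtr0_real.
move: e0; rewrite de ltcR => d0; apply: filterS (h _ d0) => t ht.
by rewrite distrC normcE ltcR.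
Qed.

Section MatrixLimits.
Context {T : Type} {F : set_system T} {FF : Filter F}.

Lemma cvg_entry m n (f : T -> 'M[C]_(m, n)) (l : 'M[C]_(m, n)) i j :
  f t @[t --> F] --> l -> f t i j @[t --> F] --> l i j.
Proof. by move=> h; exact: (cvg_comp f (fun M => M i j) h (@coord_continuous _ _ _ i j l)). Qed.

Lemma cvg_mx m n (f : T -> 'M[C]_(m, n)) (l : 'M[C]_(m, n)) :
  (forall i j, f t i j @[t --> F] --> l i j) -> f t @[t --> F] --> l.
Proof.
move=> h; apply/cvg_nrmP => e e0.
have k0 : 0 < ((m * n).+1%:R : R) by rewrite ltr0n.
have : \forall t \near F, forall i j, normc (f t i j - l i j) < e / (m * n).+1%:R.
  apply: filter_forall => i; apply: filter_forall => j.
  by move/cvg_normcP: (h i j); apply; rewrite divr_gt0.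
apply: filterS => t ht.
apply: (@le_lt_trans _ _ (\sum_(i < m) \sum_(j < n) (e / (m * n).+1%:R))).
  by rewrite /nrm; apply: ler_sum => i _; apply: ler_sum => j _; rewrite !mxE; exact/ltW/ht.
rewrite !sumr_const !card_ord -mulrnA [(n * m)%N]mulnC -[_ *+ (m * n)]mulr_natr.
by rewrite mulrAC ltr_pdivrMr // ltr_pM2l // ltr_nat.
Qed.

Lemma cvg_sumC I (s : seq I) (P : pred I) (f : I -> T -> C) (l : I -> C) :
  (forall i, P i -> f i t @[t --> F] --> l i) ->
  \sum_(i <- s | P i) f i t @[t --> F] --> \sum_(i <- s | P i) l i.
Proof. by move=> h; apply: cvg_big => //; exact: add_continuous. Qed.

Lemma cvg_sum_mx m n I (s : seq I) (P : pred I) (f : I -> T -> 'M[C]_(m, n))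
    (l : I -> 'M[C]_(m, n)) :
  (forall i, P i -> f i t @[t --> F] --> l i) ->
  \sum_(i <- s | P i) f i t @[t --> F] --> \sum_(i <- s | P i) l i.
Proof. by move=> h; apply: cvg_big => //; exact: add_continuous. Qed.

Lemma cvg_prodC I (s : seq I) (P : pred I) (f : I -> T -> C) (l : I -> C) :
  (forall i, P i -> f i t @[t --> F] --> l i) ->
  \prod_(i <- s | P i) f i t @[t --> F] --> \prod_(i <- s | P i) l i.
Proof. by move=> h; apply: cvg_big => //; exact: mul_continuous. Qed.

Lemma cvg_mulmx m n p (f : T -> 'M[C]_(m, n)) (g : T -> 'M[C]_(n, p))
    (l : 'M[C]_(m, n)) (k : 'M[C]_(n, p)) :
  f t @[t --> F] --> l -> g t @[t --> F] --> k ->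
  (f t *m g t) @[t --> F] --> l *m k.
Proof.
move=> hf hg; apply: cvg_mx => i j; rewrite mxE; under eq_cvg do rewrite mxE.
by apply: cvg_sumC => r _; apply: cvgM; apply: cvg_entry.
Qed.

Lemma cvg_det n (f : T -> 'M[C]_n) (l : 'M[C]_n) :
  f t @[t --> F] --> l -> \det (f t) @[t --> F] --> \det l.
Proof.
move=> h; apply: cvg_sumC => s _; apply: cvgM; first exact: cvg_cst.
by apply: cvg_prodC => i _; exact: cvg_entry.
Qed.

Lemma cvg_adj n (f : T -> 'M[C]_n) (l : 'M[C]_n) :
  f t @[t --> F] --> l -> \adj (f t) @[t --> F] --> \adj l.
Proof.
move=> h; apply: cvg_mx => i j; rewrite mxE; under eq_cvg do rewrite mxE.
apply: cvgM; first exact: cvg_cst.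
apply: cvg_det; apply: cvg_mx => p q; rewrite !mxE; under eq_cvg do rewrite !mxE.
exact: cvg_entry.
Qed.

Lemma near_unitmx n (f : T -> 'M[C]_n) (l : 'M[C]_n) :
  f t @[t --> F] --> l -> l \in unitmx -> \forall t \near F, f t \in unitmx.
Proof.
move=> /cvg_det h; rewrite unitmxE unitfE => l0.
have h0 : \forall t \near F, \det (f t) != 0 by exact: (cvgr_neq0 _ h l0).
by apply: filterS h0 => t; rewrite unitmxE unitfE.
Qed.

Lemma cvg_invmx n (f : T -> 'M[C]_n) (l : 'M[C]_n) :
  f t @[t --> F] --> l -> l \in unitmx -> invmx (f t) @[t --> F] --> invmx l.
Proof.
move=> h lu; rewrite {2}/invmx lu.
have /= fu := near_unitmx h lu.
have : (\det (f t))^-1 *: \adj (f t) @[t --> F] --> (\det l)^-1 *: \adj l.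
  apply: cvgZ; last exact: cvg_adj.
  by apply: cvgV; [move: lu; rewrite unitmxE unitfE | exact: cvg_det].
apply: cvg_trans; apply: near_eq_cvg; apply: filterS fu => t ft.
by rewrite /invmx ft.
Qed.

Lemma cvg_conj (f : T -> C) (l : C) :
  f t @[t --> F] --> l -> (f t)^* @[t --> F] --> l^*.
Proof.
move=> /cvg_normcP h; apply/cvg_normcP => e /h; apply: filterS => t.
by rewrite -rmorphB normc_conj.
Qed.

Lemma cvg_real (f : T -> R) (l : R) :
  f t @[t --> F] --> l -> ((f t)%:C%C : C) @[t --> F] --> (l%:C%C : C).
Proof.
move=> /cvgrPdist_lt h; apply/cvg_normcP => e /h; apply: filterS => t.
by rewrite distrC -rmorphB normc_real.
Qed.

End MatrixLimits.
End Norm.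
#[export] Hint Extern 0 (is_true (0 <= nrm _)) => exact: nrm_ge0 : core.
#[export] Hint Extern 0 (is_true (0 <= normc _)) => exact: normc_ge0 : core.

(** * Compactness and orthogonal projectors *)

Section Compactness.
Context {R : realType}.
Local Notation C := (CC R).

Lemma compact_box : compact [set z : C | `|complex.Re z| <= 1 /\ `|complex.Im z| <= 1].
Proof.
have cI := @segment_compact R (-1) 1.
have cII := compact_setX cI cI.
pose f (p : R * R) : C := p.1%:C%C + 'i%C * p.2%:C%C.
have -> : [set z : C | `|complex.Re z| <= 1 /\ `|complex.Im z| <= 1] =
   f @` (`[-1, 1]%classic `*` `[-1, 1]%classic).
  apply/seteqP; split=> [[a b] /= [ha hb]|_ [[a b] /= [ha hb] <-]].
    exists (a, b) => /=; first by split; rewrite /= in_itv /= -ler_norml.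
    by rewrite /f /= [RHS]complexE; congr (_ + _).
  move: ha hb; rewrite !in_itv /= -!ler_norml /f /= => ha hb.
  by rewrite !(mul0r, mul1r, addr0, add0r, subr0, mulr0).
apply: continuous_compact => //; apply: continuous_subspaceT => p.
rewrite /continuous_at /f; apply: cvgD; first exact/cvg_real/cvg_fst.
apply: cvgM; first exact: cvg_cst.
exact/cvg_real/cvg_snd.
Qed.

Lemma continuous_vec_mx m n : continuous (@vec_mx C m n).
Proof.
move=> u; rewrite /continuous_at; apply: (cvg_mx (F := nbhs u)) => i j; rewrite mxE; under eq_cvg do rewrite mxE.
by apply: cvg_entry; exact: cvg_id.
Qed.

(** Heine-Borel over C, which is obtained from the real one by writing the unit
    square as a continuous image of a product of two segments. *)
Lemma compact_mx_ball m n (A : set 'M[C]_(m, n)) : closed A ->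
  (forall M, A M -> forall i j, normc (M i j) <= 1) -> compact A.
Proof.
move=> cA hA; pose B := [set z : C | `|complex.Re z| <= 1 /\ `|complex.Im z| <= 1].
have cB := rV_compact (fun _ : 'I_(m * n) => compact_box).
have cB' := continuous_compact (continuous_subspaceT (@continuous_vec_mx m n)) cB.
apply: (subclosed_compact cA cB') => M AM; exists (mxvec M); last by rewrite mxvecK.
move=> k /=; case/mxvec_indexP: k => i j; rewrite mxvecE.
have := hA M AM i j; case: (M i j) => a b /= h.
have h2 : a ^+ 2 + b ^+ 2 <= 1.
  by rewrite -(@ler_sqrt _ _ 1) ?addr_ge0 ?sqr_ge0 // sqrtr1.
by split; rewrite -(@ler_pXn2r _ 2) ?nnegrE // real_normK ?num_real // expr1n;
  have := sqr_ge0 a; have := sqr_ge0 b; lra.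
Qed.

Lemma closed_eq_mx (T : topologicalType) m n (f g : T -> 'M[C]_(m, n)) :
  continuous f -> continuous g -> closed [set x | f x = g x].
Proof.
move=> cf cg; rewrite -openC openE => x /= /eqP; rewrite -subr_eq0 => fgx.
have h : f y - g y @[y --> x] --> f x - g x by apply: cvgB; [exact: cf|exact: cg].
have h0 : \forall y \near x, f y - g y != 0 by exact: (cvgr_neq0 _ h fgx).
by apply: filterS h0 => y; rewrite subr_eq0 => /eqP.
Qed.

End Compactness.

(** Orthogonal projectors. *)
Section Projectors.
Context {R : realType}.
Local Notation C := (CC R).

Definition hadj m n (M : 'M[C]_(m, n)) : 'M[C]_(n, m) := (map_mx Num.conj M)^T.

Lemma hadjE m n (M : 'M[C]_(m, n)) i j : hadj M i j = (M j i)^*.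
Proof. by rewrite !mxE. Qed.

Lemma hadjK m n (M : 'M[C]_(m, n)) : hadj (hadj M) = M.
Proof. by apply/matrixP => i j; rewrite !hadjE conjCK. Qed.

Lemma hadjD m n (M N : 'M[C]_(m, n)) : hadj (M + N) = hadj M + hadj N.
Proof. by rewrite /hadj map_mxD linearD. Qed.

Lemma hadjB m n (M N : 'M[C]_(m, n)) : hadj (M - N) = hadj M - hadj N.
Proof. by rewrite /hadj map_mxB linearB. Qed.

Lemma hadj0 m n : hadj (0 : 'M[C]_(m, n)) = 0.
Proof. by rewrite /hadj map_mx0 trmx0. Qed.

Lemma hadj1 n : hadj (1%:M : 'M[C]_n) = 1%:M.
Proof. by rewrite /hadj map_mx1 trmx1. Qed.

Lemma hadjM m n p (M : 'M[C]_(m, n)) (N : 'M[C]_(n, p)) :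
  hadj (M *m N) = hadj N *m hadj M.
Proof. by rewrite /hadj map_mxM trmx_mul. Qed.

Lemma hadj_sum m n I (s : seq I) (P : pred I) (f : I -> 'M[C]_(m, n)) :
  hadj (\sum_(i <- s | P i) f i) = \sum_(i <- s | P i) hadj (f i).
Proof. by elim/big_rec2: _ => [|i x y _ <-]; rewrite ?hadj0 ?hadjD. Qed.

Lemma mul_hadj_eq0 m n (M : 'M[C]_(m, n)) : M *m hadj M = 0 -> M = 0.
Proof.
move=> h; apply/matrixP => i j; have := congr1 (fun N : 'M[C]_m => N i i) h.
rewrite !mxE => /eqP; rewrite psumr_eq0 => [/allP/(_ j)|k _].
  by rewrite mem_index_enum hadjE mul_conjC_eq0 => /(_ isT)/eqP.
by rewrite hadjE mul_conjC_ge0.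
Qed.

Lemma cvg_hadj T (F : set_system T) (FF : Filter F) m n (f : T -> 'M[C]_(m, n))
    (l : 'M[C]_(m, n)) :
  f t @[t --> F] --> l -> hadj (f t) @[t --> F] --> hadj l.
Proof.
move=> h; apply: cvg_mx => i j; rewrite hadjE; under eq_cvg do rewrite hadjE.
exact/cvg_conj/cvg_entry.
Qed.

(** Orthogonal projectors stand for subspaces: being canonical representatives,
    they turn the Grassmannian into a closed bounded set of matrices. *)
Definition oproj n (P : 'M[C]_n) := P *m P = P /\ hadj P = P.

Lemma oproj_exists m n (W : 'M[C]_(m, n)) : exists P, oproj P /\ (P :=: W)%MS.
Proof.
pose B := row_base W; pose G := B *m hadj B.
have Gu : G \in unitmx.
  rewrite -row_free_unit -kermx_eq0; apply/eqP/mul_hadj_eq0.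
  set K := kermx G; have KG : K *m G = 0 by exact: mulmx_ker.
  have KB : K *m B = 0.
    by apply: mul_hadj_eq0; rewrite hadjM mulmxA -[_ *m B *m _]mulmxA KG mul0mx.
  have /row_freeP[Z BZ] : row_free B by exact: row_base_free.
  by rewrite -[K]mulmx1 -BZ mulmxA KB !mul0mx.
have hG : hadj G = G by rewrite /G hadjM hadjK.
have hGi : hadj (invmx G) = invmx G.
  apply: (can_inj (mulKmx Gu)); rewrite mulmxV //.
  by rewrite -{1}hG -hadjM mulVmx // hadj1.
have GK : G *m invmx G = 1%:M by exact: mulmxV.
have eB : (B :=: W)%MS by exact: eq_row_base.
move: (invmx G) GK hGi; rewrite /G => {Gu hG G} K GK hK; move: B eB GK => B eB GK.
(* For a basis B of the row space, the projector is B^* (B B^* )^-1 B. *)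
exists (hadj B *m K *m B); split; first split.
- by rewrite -!mulmxA [B *m (hadj B *m _)]mulmxA [B *m hadj B *m _]mulmxA GK mul1mx.
- by rewrite !hadjM hadjK hK mulmxA.
apply: (eqmx_trans _ eB); apply/eqmxP/andP; split; first exact: submxMl.
by apply/submxP; exists B; rewrite !mulmxA GK mul1mx.
Qed.

Lemma oproj_sub m n (P : 'M[C]_n) (W : 'M[C]_(m, n)) : oproj P ->
  (W <= P)%MS -> W *m P = W.
Proof. by move=> [PP _] /submxP[Z ->]; rewrite -mulmxA PP. Qed.

Lemma oproj_subP m n (P : 'M[C]_n) (W : 'M[C]_(m, n)) : oproj P ->
  W *m P = W <-> (W <= P)%MS.
Proof. by move=> oP; split=> [<-|]; [exact: submxMl | exact: oproj_sub]. Qed.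

Lemma oproj_subr n (P P' : 'M[C]_n) : oproj P -> oproj P' ->
  (P <= P')%MS -> P' *m P = P.
Proof.
move=> [_ hP] oP' /(oproj_sub oP') h.
by rewrite -{1}hP -{1}(proj2 oP') -hadjM h hP.
Qed.

Lemma oproj_inj n (P P' : 'M[C]_n) : oproj P -> oproj P' ->
  (P :=: P')%MS -> P = P'.
Proof.
move=> oP oP' e; rewrite -(oproj_subr oP oP'); last by rewrite e.
by rewrite (oproj_sub oP) // e.
Qed.

Lemma oproj_rank_inj n (P P' : 'M[C]_n) : oproj P -> oproj P' ->
  (P <= P')%MS -> \rank P = \rank P' -> P = P'.
Proof.
move=> oP oP' h r; apply: oproj_inj => //; apply/eqmxP.
by rewrite -mxrank_leqif_eq // r.
Qed.

(** In a factorisation P = V U of full rank, P P = P cancels to U V = 1; the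
    trace of V U is that of U V. This makes the rank of an idempotent
    a continuous function. *)
Lemma tr_idem n (P : 'M[C]_n) : P *m P = P -> \tr P = (\rank P)%:R.
Proof.
have := row_base_free P; have := col_base_full P; have := mulmx_base P.
move: (row_base P) (col_base P) => U V; set r := \rank P in U V *.
move=> <- /row_fullP[Y YV] /row_freeP[Z UZ] PP.
rewrite mxtrace_mulC; suff -> : U *m V = 1%:M by rewrite mxtrace1.
have /= := congr1 (fun M => Y *m M *m Z) PP.
by rewrite -!mulmxA UZ !mulmx1 !mulmxA YV !mul1mx.
Qed.

(** P P^* = P gives P i i = sum_k |P i k|^2, so P i i is at most 1, and with it
    every entry of the row. *)
Lemma oproj_entry n (P : 'M[C]_n) i j : oproj P -> normc (P i j) <= 1.
Proof.
move=> [PP hP].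
have h : P i i = ((\sum_k normc (P i k) ^+ 2)%:C%C : C).
  rewrite -[in LHS]PP -[in X in _ *m X]hP mxE rmorph_sum; apply: eq_bigr => k _.
  by rewrite hadjE -normCK normcE -rmorphXn.
have ge k : normc (P i k) ^+ 2 <= \sum_k normc (P i k) ^+ 2.
  by rewrite [leRHS](bigD1 k) //= lerDl sumr_ge0 // => ? _; rewrite sqr_ge0.
have s0 : 0 <= \sum_k normc (P i k) ^+ 2 by exact: le_trans (sqr_ge0 _) (ge i).
have s1 : \sum_k normc (P i k) ^+ 2 <= 1.
  have := ge i; rewrite {1}h normc_real ger0_norm //.
  set s := \sum_k _ in s0 *; move=> ss; nra.
by rewrite -(@ler_pXn2r _ 2) ?nnegrE // expr1n (le_trans (ge j)).
Qed.

Lemma closed_oproj n r : closed [set P : 'M[C]_n | oproj P /\ \rank P = r].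
Proof.
(* The rank is replaced by the trace, put in a 1 x 1 matrix. *)
have -> : [set P : 'M[C]_n | oproj P /\ \rank P = r] =
  [set P | P *m P = P] `&` [set P | hadj P = P] `&`
  [set P | (\tr P)%:M = (r%:R)%:M :> 'M[C]_1].
  apply/seteqP; split=> P /=.
    by move=> [[PP hP] <-]; rewrite tr_idem.
  move=> [[PP hP] /(congr1 (fun M : 'M[C]_1 => M 0 0))].
  by rewrite !mxE eqxx !mulr1n tr_idem // => /eqP; rewrite eqr_nat => /eqP.
apply: closedI; first apply: closedI; apply: closed_eq_mx => P;
  rewrite /continuous_at.
- by apply: (cvg_mulmx (F := nbhs P)); exact: cvg_id.
- exact: cvg_id.
- by apply: (cvg_hadj (F := nbhs P)); exact: cvg_id.
- exact: cvg_id.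
- apply: (cvg_mx (F := nbhs P)) => i j; rewrite mxE; under eq_cvg do rewrite mxE.
  apply: cvgMn; apply: cvg_sumC => k _; apply: cvg_entry; exact: cvg_id.
- exact: cst_continuous.
Qed.

(** The Grassmannian of r-dimensional subspaces is compact. *)
Lemma compact_oproj n r : compact [set P : 'M[C]_n | oproj P /\ \rank P = r].
Proof.
apply: compact_mx_ball; first exact: closed_oproj.
by move=> P [oP _] i j; exact: oproj_entry.
Qed.

End Projectors.

(** * The real inner product on complex row vectors *)

Section RealDot.
Context {R : realType} {N : nat}.
Local Notation C := (CC R).
Implicit Types u w : 'rV[C]_N.

(** The real part of the hermitian product, for which C^N is a Euclidean
    space of dimension 2N; nearest points are governed by this product. *)
Definition rdot u w : R := complex.Re ((u *m hadj w) 0 0).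
Definition enorm u : R := Num.sqrt (rdot u u).

Lemma ReD (x y : C) : complex.Re (x + y) = complex.Re x + complex.Re y.
Proof. by case: x y => [a b] [c d]. Qed.

Lemma ReN (x : C) : complex.Re (- x) = - complex.Re x.
Proof. by case: x. Qed.

Lemma ReZ (t : R) (x : C) : complex.Re (t%:C%C * x) = t * complex.Re x.
Proof. by case: x => a b /=; rewrite mul0r subr0. Qed.

Lemma rdotDl u1 u2 w : rdot (u1 + u2) w = rdot u1 w + rdot u2 w.
Proof. by rewrite /rdot mulmxDl mxE ReD. Qed.

Lemma rdotNl u w : rdot (- u) w = - rdot u w.
Proof. by rewrite /rdot mulNmx mxE ReN. Qed.

Lemma rdotZl t u w : rdot (t%:C%C *: u) w = t * rdot u w.
Proof. by rewrite /rdot -scalemxAl mxE ReZ. Qed.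

Lemma rdotC u w : rdot u w = rdot w u.
Proof.
have e : u *m hadj w = hadj (w *m hadj u) by rewrite hadjM hadjK.
by rewrite /rdot e hadjE; case: (_ 0 0) => a b.
Qed.

Lemma rdotDr u w1 w2 : rdot u (w1 + w2) = rdot u w1 + rdot u w2.
Proof. by rewrite rdotC rdotDl !(rdotC u). Qed.

Lemma rdotNr u w : rdot u (- w) = - rdot u w.
Proof. by rewrite rdotC rdotNl (rdotC u). Qed.

Lemma rdotZr t u w : rdot u (t%:C%C *: w) = t * rdot u w.
Proof. by rewrite rdotC rdotZl (rdotC u). Qed.

Lemma dot_self u : (u *m hadj u) 0 0 = (\sum_i normc (u 0 i) ^+ 2)%:C%C :> C.
Proof.
rewrite mxE rmorph_sum; apply: eq_bigr => k _.
by rewrite hadjE -normCK normcE -rmorphXn.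
Qed.

Lemma rdot_self u : rdot u u = \sum_i normc (u 0 i) ^+ 2.
Proof. by rewrite /rdot dot_self. Qed.

Lemma rdot_ge0 u : 0 <= rdot u u.
Proof. by rewrite rdot_self sumr_ge0 // => i _; exact: sqr_ge0. Qed.
Hint Resolve rdot_ge0 : core.

Lemma enorm_sqr u : enorm u ^+ 2 = rdot u u.
Proof. by rewrite sqr_sqrtr. Qed.

Lemma enorm_ge0 u : 0 <= enorm u.
Proof. exact: sqrtr_ge0. Qed.
Hint Resolve enorm_ge0 : core.

Lemma enorm_entry u i : normc (u 0 i) <= enorm u.
Proof.
rewrite -(@ler_pXn2r _ 2) ?nnegrE // enorm_sqr rdot_self (bigD1 i) //= lerDl.
by rewrite sumr_ge0 // => j _; exact: sqr_ge0.
Qed.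

Lemma nrm_rV u : nrm u = \sum_i normc (u 0 i).
Proof. by rewrite /nrm big_ord1. Qed.

Lemma nrm_enorm u : nrm u <= N%:R * enorm u.
Proof.
rewrite nrm_rV mulr_natl -[N in X in _ <= X]card_ord -sumr_const.
by apply: ler_sum => i _; exact: enorm_entry.
Qed.

Lemma enorm_nrm u : enorm u <= nrm u.
Proof.
rewrite -(@ler_pXn2r _ 2) ?nnegrE ?nrm_ge0 // enorm_sqr rdot_self expr2 {1}nrm_rV mulr_suml.
apply: ler_sum => i _; rewrite expr2 ler_wpM2l //; exact: nrm_entry.
Qed.

Lemma enorm_eq0 u : enorm u <= 0 -> u = 0.
Proof.
move=> h; apply: nrm_eq0; apply: le_trans (nrm_enorm _) _.
by rewrite mulr_ge0_le0.
Qed.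

Lemma rdot_eq0 u : rdot u u = 0 -> u = 0.
Proof. by move=> h; apply: enorm_eq0; rewrite /enorm h sqrtr0. Qed.

Lemma enorm0 : enorm 0 = 0.
Proof. by apply/le_anti; rewrite enorm_ge0 andbT (le_trans (enorm_nrm _)) // nrm0. Qed.

Lemma enormN u : enorm (- u) = enorm u.
Proof. by rewrite /enorm rdotNl rdotNr opprK. Qed.

Lemma enormC u w : enorm (u - w) = enorm (w - u).
Proof. by rewrite -enormN opprB. Qed.

Lemma complete_square (F : fieldType) (a b c : F) : b != 0 ->
  c - a / b * a - (a / b * a - a / b * (a / b * b)) = c - a ^+ 2 / b.
Proof. by move=> b0; field. Qed.

Lemma cauchy_schwarz u w : rdot u w <= enorm u * enorm w.
Proof.
have [w0|w0] := eqVneq (rdot w w) 0.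
  have -> : w = 0 by apply: enorm_eq0; rewrite /enorm w0 sqrtr0.
  by rewrite /rdot hadj0 mulmx0 mxE mulr_ge0.
have wp : 0 < rdot w w by rewrite lt_def w0 rdot_ge0.
apply: le_trans (ler_norm _) _.
rewrite -(@ler_pXn2r _ 2) ?nnegrE ?mulr_ge0 // exprMn !enorm_sqr real_normK ?num_real //.
have := rdot_ge0 (u - (rdot u w / rdot w w)%:C%C *: w).
rewrite rdotDl rdotNl !rdotDr !rdotNr !(rdotZl, rdotZr) (rdotC w u).
set a := rdot u w; set b := rdot w w in wp *; set c := rdot u u.
have -> : c - a / b * a - (a / b * a - a / b * (a / b * b)) = c - a ^+ 2 / b.
  by apply: complete_square; rewrite gt_eqF.
by rewrite subr_ge0 ler_pdivrMr.
Qed.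

Lemma rdot_row0 u w : u *m hadj w = 0 -> rdot u w = 0.
Proof. by rewrite /rdot => ->; rewrite mxE. Qed.

Lemma enormD u w : enorm (u + w) <= enorm u + enorm w.
Proof.
rewrite -(@ler_pXn2r _ 2) ?nnegrE ?addr_ge0 // sqrrD !enorm_sqr.
rewrite rdotDl !rdotDr (rdotC w u).
have := cauchy_schwarz u w; move: (rdot u w) (enorm u * enorm w) => a b ab.
by move: (rdot u u) (rdot w w) => c d; rewrite mulr2n; clear - ab; lra.
Qed.

Lemma enorm_trans u w z : enorm (u - z) <= enorm (u - w) + enorm (w - z).
Proof. by apply: le_trans (enormD _ _); rewrite addrA subrK. Qed.

Lemma cvg_enorm T (F : set_system T) (FF : Filter F) (f : T -> 'rV[C]_N) (l : 'rV[C]_N) :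
  f t @[t --> F] --> l -> enorm (f t) @[t --> F] --> enorm l.
Proof.
move=> /cvg_nrmP h; apply/cvgrPdist_lt => e /h; apply: filterS => t ht.
apply: le_lt_trans ht; apply: le_trans (enorm_nrm _).
have h1 := enorm_trans l (f t) 0; have h2 := enorm_trans (f t) l 0.
rewrite !subr0 in h1 h2; move: h1 h2; rewrite (enormC l) ler_norml.
by move: (enorm (f t - l)) (enorm l) (enorm (f t)) => a b c h1 h2; lra.
Qed.

End RealDot.

Lemma rdot_adj (R : realType) m n (u : 'rV[CC R]_m) (w : 'rV[CC R]_n) (M : 'M[CC R]_(n, m)) :
  rdot u (w *m M) = rdot (u *m hadj M) w.
Proof. by rewrite /rdot hadjM mulmxA. Qed.

#[export] Hint Extern 0 (is_true (0 <= enorm _)) => exact: enorm_ge0 : core.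
(* Keeps unification from unfolding norms into sums of square roots. *)
#[global] Opaque nrm rdot enorm.

(** * The hermitian product carried by a frame *)

Section FrameDot.
Context {R : realType} {d N : nat}.
Local Notation C := (CC R).
Variables (fr : 'M[C]_(d, N)) (c : R).

(** The product of C^d induced by the embedding u |-> u fr into C^N, divided by
    c. The two hypotheses are arguments so that the instances below can be
    attached to the constant. *)
Definition frame_dot (_ : row_free fr) (_ : 0 < c) (u w : 'rV[C]_d) : C :=
  (u *m fr *m hadj (w *m fr)) 0 0 * (c^-1)%:C%C.

Hypotheses (fr_free : row_free fr) (c_gt0 : 0 < c).
Local Notation dot := (frame_dot fr_free c_gt0).

Lemma frame_dot_zmodl w : zmod_morphism (dot^~ w).
Proof. by move=> u1 u2; rewrite /frame_dot -mulrBl !mulmxBl mxE [X in _ + X]mxE. Qed.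

Lemma frame_dot_zmodr u : zmod_morphism (dot u).
Proof. by move=> w1 w2; rewrite /frame_dot -mulrBl mulmxBl hadjB mulmxBr mxE [X in _ + X]mxE. Qed.

Lemma frame_dot_scalel w : scalable_for *%R (dot^~ w).
Proof. by move=> a u; rewrite /frame_dot -!scalemxAl mxE mulrA. Qed.

Lemma frame_dot_herm u w : dot u w = (-1) ^+ false * (dot w u)^*.
Proof.
rewrite expr0 mul1r /frame_dot rmorphM; congr (_ * _).
  by rewrite -[RHS](hadjE (w *m fr *m hadj (u *m fr)) 0 0) [in RHS]hadjM hadjK.
by apply/esym/(@conj_Creal C)/complex_realP; exists c^-1.
Qed.

Lemma frame_dot_scaler u : scalable_for (Num.conj \; *%R) (dot u).
Proof.
move=> a w; rewrite frame_dot_herm frame_dot_scalel [dot u w]frame_dot_herm.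
by rewrite !expr0 !mul1r rmorphM.
Qed.

Lemma frame_dot_self u : dot u u = (rdot (u *m fr) (u *m fr) / c)%:C%C.
Proof. by rewrite /frame_dot dot_self -rdot_self -rmorphM. Qed.

Lemma frame_dot_gt0 u : u != 0 -> 0 < dot u u.
Proof.
move=> u0; rewrite frame_dot_self ltcR divr_gt0 // lt_def rdot_ge0 andbT.
apply: contra u0 => /eqP /rdot_eq0.
have /row_freeP[Z fZ] := fr_free => /(congr1 (mulmxr Z)) /=.
by rewrite -mulmxA fZ mulmx1 mul0mx => ->.
Qed.

HB.instance Definition _ := isBilinear.Build C 'rV[C]_d 'rV[C]_d C *%R
  (Num.conj \; *%R) dot frame_dot_zmodl frame_dot_zmodr frame_dot_scalel
  frame_dot_scaler.
HB.instance Definition _ := isHermitianSesquilinear.Build C 'rV[C]_d false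
  Num.conj dot frame_dot_herm.
HB.instance Definition _ := isDotProduct.Build C 'rV[C]_d dot frame_dot_gt0.

Definition frame_metric : {dot 'rV[C]_d for (@Num.conj C)} := dot.
End FrameDot.

(** * Tubular neighbourhoods *)

Lemma cvg_cont (T : Type) (F : set_system T) (FF : Filter F)
    (Y Z : topologicalType) (f : T -> Y) (g : Y -> Z) (l : Y) :
  continuous g -> f t @[t --> F] --> l -> g (f t) @[t --> F] --> g l.
Proof. by move=> cg coframe; exact: cvg_comp coframe (cg l). Qed.

Lemma cvg_pair_pt (T : Type) (F : set_system T) (FF : Filter F)
    (Y Z : topologicalType) (f : T -> Y) (g : T -> Z) (a : Y) (b : Z) :
  f t @[t --> F] --> a -> g t @[t --> F] --> b -> (f t, g t) @[t --> F] --> (a, b).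
Proof. by move=> fa gb; exact: cvg_pair fa gb. Qed.

Lemma cvg_set_type (T : Type) (F : set_system T) (FF : Filter F)
    (Y : topologicalType) (A : set Y) (f : T -> A) (l : A) :
  val (f t) @[t --> F] --> val l -> f t @[t --> F] --> l.
Proof.
move=> h W; rewrite {1}nbhsE => -[G [[V oV VO] Gx] GW].
have : nbhs (val l) V by apply: open_nbhs_nbhs; split=> //; move: Gx; rewrite -VO.
move=> /h hV; have {}hV : \forall t \near F, V (val (f t)) by exact: hV.
by apply: filterS hV => y Vy; apply: GW; rewrite -VO.
Qed.

Lemma continuous_set_type (X Y : topologicalType) (A : set Y) (f : X -> A) :
  continuous (fun x => val (f x)) -> continuous f.
Proof.
by move=> h x; apply: cvg_set_type; exact: h.
Qed.

Lemma val_continuous (Y : topologicalType) (A : set Y) :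
  continuous (fun a : A => val a).
Proof. exact: initial_continuous. Qed.

Lemma quarters (R : realType) (x : R) : 0 < x ->
  [/\ 0 < x / 2, x / 2 < x & x / 4 < x / 2].
Proof. by move=> x0; split; lra. Qed.

Lemma three_quarters (R : realType) (x : R) : 0 < x ->
  0 < x * (3 / 4) /\ x * (3 / 4) < x.
Proof. by move=> x0; split; lra. Qed.

(** Linear estimates between radii and distances, isolated so that arithmetic
    decision procedures meet variables only. *)
Section RealEstimates.
Context {R : realFieldType}.
Implicit Types x y z t : R.

Lemma quarters_lt_half x y z : y < x / 4 -> z < x / 4 -> z + y < x / 2.
Proof. lra. Qed.

Lemma double_le1 e r : e < r / 2 -> r <= 1 -> 2 * e <= 1 :> R.
Proof. lra. Qed.

Lemma double_lt e r : e < r / 2 -> 2 * e < r :> R.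
Proof. lra. Qed.

Lemma triangle_gap x y z : 2 * x < y -> y <= z + x -> x <= z.
Proof. lra. Qed.

Lemma lt_quarter_perturb x y z t : y <= z + t -> z < (x / 4 - t) / 3 -> t < x / 4 ->
  0 <= z -> 0 <= t -> y < x / 4.
Proof. lra. Qed.

Lemma quarter_le_half_three_quarters x : 0 < x * (3 / 4) -> x / 4 <= x * (3 / 4) / 2.
Proof. lra. Qed.

Lemma lt_three_quarters x y z t : x <= t + z -> t <= z -> z < y / 4 -> 0 < y * (3 / 4) ->
  x < y * (3 / 4) /\ y / 4 < y * (3 / 4).
Proof. by move=> *; split; lra. Qed.

Lemma lt_quarter_lipschitz a r0 r e0 e t0 q : a <= 2 * q -> e0 <= q + t0 -> e <= e0 ->
  q < (r0 / 4 - t0) / 3 -> r0 <= r + a -> 0 <= q -> e < r / 4 :> R.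
Proof. lra. Qed.

Lemma absorb_quarters e q x y z : e * e = x + y - z -> x <= e * q ->
  y <= 4^-1 * (e * e) -> - (4^-1 * (e * e)) <= z -> e * e <= e * (2 * q) :> R.
Proof. move: (e * e) => f h1 h2 h3 h4; lra. Qed.

Lemma abs_sub_le x y z : x <= y + z -> y <= x + z -> `|x - y| <= z.
Proof. by move=> h1 h2; rewrite ler_norml; lra. Qed.

(** The contact estimate bounds a product by K nrm(e)^2 nrm(b); in Euclidean
    norms this costs n^3, and a small b leaves a small multiple of e^2. *)
Lemma cubic_bound K (n : nat) r x x' y y' c : 0 <= x -> 0 <= y -> 0 <= K ->
  x <= n%:R * x' -> y <= n%:R * y' -> y' <= r -> K * n%:R ^+ 3 * r <= c ->
  K * x ^+ 2 * y <= c * x' ^+ 2.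
Proof.
move=> x0 y0 K0 hx hy yr hc.
have hy' : y <= n%:R * r by apply: le_trans hy _; apply: ler_wpM2l.
have hx2 : x ^+ 2 <= (n%:R * x') ^+ 2 by apply: lerXn2r; rewrite ?nnegrE // (le_trans x0).
apply: (@le_trans _ _ (K * (n%:R * x') ^+ 2 * (n%:R * r))).
  by apply: ler_pM => //; [rewrite mulr_ge0 ?sqr_ge0|apply: ler_wpM2l].
have -> : K * (n%:R * x') ^+ 2 * (n%:R * r) = K * n%:R ^+ 3 * r * x' ^+ 2 by ring.
by apply: ler_wpM2r; rewrite ?sqr_ge0.
Qed.
End RealEstimates.

(** [vec] and [unvec] identify M with C^N; keeping M separate lets its topology
    be the one of the application. [Pi A] is the projector onto the normal space
    at A. The set T compensates for S not being closed: minimising a distance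
    requires a closed set. *)
Section Tubular.
Context {R : realType} {M : topologicalType} {N d : nat}.
Local Notation C := (CC R).
Variables (vec : M -> 'rV[C]_N) (unvec : 'rV[C]_N -> M).
Hypotheses (vecK : cancel vec unvec) (unvecK : cancel unvec vec)
  (vec_cont : continuous vec) (unvec_cont : continuous unvec).
Variables (S T : set M) (Pi : M -> 'M[C]_N).

Definition normal A (B : 'rV[C]_N) := B *m Pi A = B.

Hypotheses
  (PiP : forall A, S A -> oproj (Pi A) /\ \rank (Pi A) = d)
  (Pi_cont : continuous (fun s : S => Pi (val s)))
  (T_closed : closed T) (ST : S `<=` T)
  (S_open : forall A, S A -> \forall A' \near A, T A' -> S A')
  (tangency : forall s0 : S, exists K : R, \forall p \near (s0, s0),
     forall B, normal (val p.1) B ->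
     `|rdot (vec (val p.2) - vec (val p.1)) B| <=
       K * nrm (vec (val p.2) - vec (val p.1)) ^+ 2 * nrm B)
  (critical : forall A (D : 'rV[C]_N), S A ->
     (forall A', S A' -> enorm (D - vec A) <= enorm (D - vec A')) ->
     normal A (D - vec A)).

Lemma nbhs_vec (A0 : M) (W : set M) : nbhs A0 W ->
  exists2 r : R, 0 < r & forall A, enorm (vec A - vec A0) < r -> W A.
Proof.
move=> WA; have : nbhs (vec A0) (unvec @^-1` W).
  by have := unvec_cont (x := vec A0); rewrite /continuous_at vecK; apply.
move=> /nbhs_normP[e /= e0 he].
have [r re] : exists r, e = r%:C%C by apply/complex_realP; exact: gtr0_real.
have k0 : 0 < (N.+1%:R : R) by rewrite ltr0n.
exists (r / N.+1%:R); first by rewrite divr_gt0 //; move: e0; rewrite re ltcR.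
move=> A hA; rewrite -(vecK A); apply: he.
rewrite /= distrC re; apply: le_lt_trans (nrm_mx_norm _) _; rewrite ltcR.
apply: le_lt_trans (nrm_enorm _) _.
move: hA; rewrite ltr_pdivlMr //; apply: le_lt_trans.
by rewrite mulrC ler_wpM2l // ler_nat.
Qed.

Lemma near_vec (A0 : M) (r : R) : 0 < r ->
  \forall A \near A0, enorm (vec A - vec A0) < r.
Proof.
move=> r0.
have h : enorm (vec A - vec A0) @[A --> A0] --> enorm (vec A0 - vec A0).
  by apply: cvg_enorm; apply: cvgB; [exact: vec_cont|exact: cvg_cst].
rewrite subrr enorm0 in h.
by move/cvgrPdist_lt: h => /(_ r r0); apply: filterS => A; rewrite sub0r normrN ger0_norm.
Qed.

Lemma near_vecS (A : set M) (s0 : A) (r : R) : 0 < r ->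
  \forall s \near s0, enorm (vec (val s) - vec (val s0)) < r.
Proof. by move=> r0; exact: (@val_continuous _ A s0 _ (near_vec (val s0) r0)). Qed.

Lemma nbhs_vecS (s0 : S) (W : set S) : nbhs s0 W ->
  exists2 r : R, 0 < r & forall s : S, enorm (vec (val s) - vec (val s0)) < r -> W s.
Proof.
rewrite {1}nbhsE => -[G [[V oV VO] Gx] GW].
have : nbhs (val s0) V by apply: open_nbhs_nbhs; split=> //; move: Gx; rewrite -VO.
move=> /nbhs_vec[r r0 hr]; exists r => // s hs; apply: GW; rewrite -VO.
exact: hr.
Qed.

(** The third clause says quantitatively that the normal disks of radius r at
    the points of S near A0 do not meet. *)
Definition good_radius (A0 : M) (r : R) :=
  [/\ 0 < r, r <= 1,
   forall A A' B B', S A -> S A' -> normal A B -> normal A' B' ->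
     enorm (vec A - vec A0) < r -> enorm (vec A' - vec A0) < r ->
     enorm B < r -> enorm B' < r ->
     enorm (vec A' - vec A) <= 2 * enorm (vec A' + B' - (vec A + B))
   & forall A, T A -> enorm (vec A - vec A0) < r -> S A].

(** Let e = A' - A and let q be the difference of the end points, so that
    e = q + B - B'. In <e, e> = <e, q> + <e, B> - <e, B'>, the tangency
    hypothesis bounds the last two terms by |e|^2 / 4 each, once B and B' are
    short; then |e|^2 / 2 <= |e| |q|. *)
Lemma good_radius_exists A0 : S A0 -> exists r, good_radius A0 r.
Proof.
move=> SA0; pose s0 : S := SigSub (mem_set SA0).
have [K0] := tangency s0; pose K := Num.max K0 0.
have K0K : K0 <= K by rewrite le_max lexx.
have Kge : 0 <= K by rewrite le_max lexx orbT.
move=> [[W1 W2] /= [/nbhs_vecS[r1 r10 h1] /nbhs_vecS[r2 r20 h2]] hW].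
have [r3 r30 h3] := nbhs_vec (S_open SA0).
(* For r <= 1 / k, the contact constant K N^3 r is at most 1 / 4. *)
pose k := K * N%:R ^+ 3 * 4 + 1.
have k0 : 0 < k by rewrite ltr_wpDl // !mulr_ge0 // ?exprn_ge0.
pose r := Num.min (Num.min r1 r2) (Num.min r3 (Num.min 1 k^-1)).
have [rr1 rr2 rr3 rr4 rr5] : [/\ r <= r1, r <= r2, r <= r3, r <= 1 & r <= k^-1].
  by rewrite /r !ge_min !lexx !orbT.
have r0 : 0 < r by rewrite /r !lt_min r10 r20 r30 ltr01 invr_gt0 k0.
have rk : K * N%:R ^+ 3 * r <= 4^-1.
  have : r * k <= 1 by rewrite -ler_pdivlMr // mul1r.
  by rewrite /k; move: (K * _) => z; nra.
have bound A A' B : S A -> S A' -> normal A B ->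
     enorm (vec A - vec A0) < r -> enorm (vec A' - vec A0) < r ->
     enorm B < r ->
     `|rdot (vec A' - vec A) B| <= 4^-1 * enorm (vec A' - vec A) ^+ 2.
  move=> SA SA' nB hA hA' hB.
  pose s : S := SigSub (mem_set SA); pose s' : S := SigSub (mem_set SA').
  have := hW (s, s') (conj (h1 s (lt_le_trans hA rr1)) (h2 s' (lt_le_trans hA' rr2))) B nB.
  rewrite /=; set e := vec A' - vec A.
  have ne := nrm_enorm e; have nB' := nrm_enorm B.
  move=> h; apply: le_trans h _.
  apply: le_trans (cubic_bound (nrm_ge0 e) (nrm_ge0 B) Kge ne nB' (ltW hB) rk).
  by apply: ler_wpM2r; [exact: nrm_ge0|apply: ler_wpM2r; [exact: sqr_ge0|exact: K0K]].
exists r; split=> //; last by move=> A TA hA; apply: (h3 A) => //; exact: lt_le_trans hA rr3.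
move=> A A' B B' SA SA' nB nB' hA hA' hB hB'.
set e := vec A' - vec A; set q := vec A' + B' - (vec A + B).
have e1 : `|rdot e B| <= 4^-1 * enorm e ^+ 2 := bound _ _ _ SA SA' nB hA hA' hB.
have e2 : `|rdot e B'| <= 4^-1 * enorm e ^+ 2.
  have := bound _ _ _ SA' SA nB' hA' hA hB'.
  by rewrite -opprB -/e rdotNl normrN enormN.
have e3 : enorm e ^+ 2 = rdot e q + rdot e B - rdot e B'.
  rewrite enorm_sqr -rdotDr -rdotNr -rdotDr; congr rdot.
  by rewrite /q /e opprD addrA subrK addrAC addrK.
have e4 := cauchy_schwarz e q.
have [e0|e0] := leP (enorm e) 0; first by apply: le_trans e0 _; rewrite mulr_ge0.
move: e1 e2; rewrite !ler_norml => /andP[_ e1] /andP[e2 _].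
rewrite -(ler_pM2l e0); rewrite expr2 in e1 e2 e3.
exact: absorb_quarters e3 e4 e1 e2.
Qed.

Lemma good_radius_shift A0 A1 r r' : good_radius A0 r -> 0 < r' ->
  r' + enorm (vec A1 - vec A0) <= r -> good_radius A1 r'.
Proof.
move=> [r0 r1 h1 h2] r'0 hr.
have sub A : enorm (vec A - vec A1) < r' -> enorm (vec A - vec A0) < r.
  move=> h; apply: le_lt_trans (enorm_trans _ (vec A1) _) _.
  by apply: lt_le_trans hr; rewrite ltrD2r.
have r'r : r' <= r by apply: le_trans hr; rewrite lerDl.
split=> //; first exact: le_trans r1.
  move=> A A' B B' SA SA' nB nB' /sub hA /sub hA' hB hB'.
  exact: (h1 A A' B B' SA SA' nB nB' hA hA' (lt_le_trans hB r'r) (lt_le_trans hB' r'r)).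
by move=> A TA /sub; exact: h2.
Qed.

(** A good radius at A, decreased by a distance, is good at the point moved by
    this distance. Hence this supremum is 1-Lipschitz, which gives a disk radius
    varying continuously along S. *)
Definition reach (A : M) : R := sup [set r | good_radius A r].

Lemma reach_ub A r : good_radius A r -> r <= reach A.
Proof.
move=> g; apply: ub_le_sup => //.
by exists 1 => q [].
Qed.

Lemma reach_gt0 A : S A -> 0 < reach A.
Proof. by move=> /good_radius_exists[r g]; apply: lt_le_trans (reach_ub g); case: g. Qed.

Lemma reach_good A r : S A -> 0 < r -> r < reach A -> good_radius A r.
Proof.
move=> SA r0; rewrite /reach => /sup_gt[|q gq qr]; first exact: good_radius_exists.
by apply: good_radius_shift gq r0 _; rewrite subrr enorm0 addr0 ltW.
Qed.

Lemma reach_lipschitz A0 A1 : S A0 -> S A1 ->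
  reach A0 <= reach A1 + enorm (vec A1 - vec A0).
Proof.
move=> S0 S1; apply: ge_sup; first exact: good_radius_exists.
move=> r gr; have [h|h] := leP r (enorm (vec A1 - vec A0)).
  by apply: le_trans h _; rewrite lerDr ltW // reach_gt0.
by rewrite -lerBlDr; apply: reach_ub; apply: good_radius_shift gr _ _; rewrite ?subr_gt0 // subrK.
Qed.

(** A quarter of the reach leaves room for comparing two feet of the same point
    with the good radius of the one with the larger reach. *)
Definition tube A (D : 'rV[C]_N) := [/\ S A, normal A (D - vec A) & enorm (D - vec A) < reach A / 4].

Lemma tube_foot_unique A A' (D : 'rV[C]_N) : tube A D -> tube A' D -> A = A'.
Proof.
wlog le : A A' / reach A' <= reach A => [W|].
  have [h|h] := leP (reach A') (reach A); first exact: (W _ _ h).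
  by move=> t t'; exact/esym/(W _ _ (ltW h) t' t).
move=> [SA nA hA] [SA' nA' hA']; have [r0 r1 r2] := quarters (reach_gt0 SA).
have [_ _ g _] := reach_good SA r0 r1.
have hA'' : enorm (D - vec A') < reach A / 4.
  by apply: lt_le_trans hA' _; rewrite ler_pM2r // invr_gt0.
have h : enorm (vec A' - vec A) < reach A / 2.
  apply: le_lt_trans (enorm_trans _ D _) _; rewrite enormC.
  exact: quarters_lt_half hA hA''.
have := g A A' (D - vec A) (D - vec A') SA SA' nA nA' _ h (lt_trans hA r2) (lt_trans hA'' r2).
rewrite !subrr enorm0 ![_ + (D - _)]addrC !subrK subrr enorm0 mulr0 => /(_ r0).
move=> /enorm_eq0/eqP; rewrite subr_eq0 => /eqP h'; exact/esym/(can_inj vecK).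
Qed.

(** Minimise the distance to D over the points of T within 2e of A0, a compact
    set. The minimiser lies in the ball where T agrees with S. It is nearest
    among all of S, since A0 is closer to D than the points further away than
    2e. *)
Lemma nearest A0 r (D : 'rV[C]_N) : S A0 -> good_radius A0 r -> enorm (D - vec A0) < r / 2 ->
  exists2 A, S A & normal A (D - vec A) /\ enorm (D - vec A) <= enorm (D - vec A0).
Proof.
move=> S0 [r0 r1 _ gT] hD; set e := enorm (D - vec A0) in hD *.
pose K : set 'rV[C]_N := [set w | T (unvec (w + vec A0))] `&` [set w : 'rV[C]_N | enorm w <= 2 * e].
have cK : closed K.
  apply: closedI.
    apply: closed_comp T_closed => w _; apply: continuous_comp; last exact: unvec_cont.
    by rewrite /continuous_at; apply: (cvgD (F := nbhs w)); [exact: cvg_id|exact: cvg_cst].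
  apply: (@closed_comp _ _ enorm [set x | x <= 2 * e]); last exact: closed_le.
  by move=> w _; rewrite /continuous_at; apply: (cvg_enorm (F := nbhs w)); exact: cvg_id.
have coK : compact K.
  apply: compact_mx_ball cK _ => w [_ hw] i j; rewrite ord1.
  apply: le_trans (enorm_entry _ _) (le_trans hw _).
  exact: double_le1 hD r1.
have K0 : K 0.
  split; first by rewrite /= add0r vecK; exact: ST.
  by rewrite /= enorm0 mulr_ge0 // enorm_ge0.
have [|w /set_mem[Tw hw] hmin] := @compact_EVT_min _ R (fun w : 'rV[C]_N => enorm (D - vec A0 - w)) K (ex_intro _ _ K0) coK.
  apply: continuous_subspaceT => w; rewrite /continuous_at; apply: (cvg_enorm (F := nbhs w)).
  by apply: (cvgB (F := nbhs w)); [exact: cvg_cst|exact: cvg_id].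
have m0 : enorm (D - vec A0 - w) <= e.
  by have := hmin 0 (mem_set K0); rewrite subr0.
have E : D - vec (unvec (w + vec A0)) = D - vec A0 - w.
  by rewrite unvecK opprD addrA addrAC.
have SA : S (unvec (w + vec A0)).
  apply: gT Tw _; rewrite unvecK addrK; apply: le_lt_trans hw _.
  exact: double_lt hD.
exists (unvec (w + vec A0)); first exact: SA.
rewrite E; split; last exact: m0.
rewrite -E; apply: (critical SA) => A' SA'; rewrite E.
have [h|h] := leP (enorm (vec A' - vec A0)) (2 * e).
  have := hmin (vec A' - vec A0); rewrite opprB addrA subrK; apply.
  apply/mem_set; split; last exact: h.
  by rewrite /= subrK vecK; exact: ST.
apply: le_trans m0 _; have := enorm_trans (vec A') D (vec A0).
by rewrite -/e (enormC _ D); exact: triangle_gap h.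
Qed.

(** Openness of the tube and continuity of the foot at once: near D0, a point
    has a foot, at a distance from the foot of D0 controlled by the good
    radius. *)
Lemma tube_near A0 (D0 D : 'rV[C]_N) : tube A0 D0 ->
  enorm (D - D0) < (reach A0 / 4 - enorm (D0 - vec A0)) / 3 ->
  exists2 A, tube A D & enorm (vec A - vec A0) <= 2 * enorm (D - D0).
Proof.
move=> [S0 n0 h0] hD; have [r0 r1] := three_quarters (reach_gt0 S0).
(* Any radius below the reach is good; three quarters is enough below. *)
have gd := reach_good S0 r0 r1.
have t1 := enorm_trans D D0 (vec A0).
have h1 : enorm (D - vec A0) < reach A0 / 4.
  exact: lt_quarter_perturb t1 hD h0 (enorm_ge0 _) (enorm_ge0 _).
have [|A SA [nA hA]] := nearest (D := D) S0 gd.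
  exact: lt_le_trans h1 (quarter_le_half_three_quarters r0).
have t2 := enorm_trans (vec A) D (vec A0); rewrite (enormC (vec A) D) in t2.
have [q1 q2] : enorm (vec A - vec A0) < reach A0 * (3 / 4) /\ reach A0 / 4 < reach A0 * (3 / 4).
  exact: lt_three_quarters t2 hA h1 r0.
case: gd => _ _ g _; have q0 : enorm (vec A0 - vec A0) < reach A0 * (3 / 4).
  by rewrite subrr enorm0.
have k := g A0 A _ _ S0 SA n0 nA q0 q1 (lt_trans h0 q2) (le_lt_trans hA (lt_trans h1 q2)).
rewrite ![_ + (_ - vec _)]addrC !subrK in k.
exists A; last exact: k.
by split; [exact: SA|exact: nA|exact: lt_quarter_lipschitz k t1 hA hD (reach_lipschitz S0 SA) (enorm_ge0 _)].
Qed.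

Lemma tube_self A : S A -> tube A (vec A).
Proof.
by move=> SA; split; rewrite ?subrr ?enorm0 ?divr_gt0 ?reach_gt0 // /normal mul0mx.
Qed.

Lemma tube_slack A D : tube A D -> 0 < (reach A / 4 - enorm (D - vec A)) / 3.
Proof. by move=> [_ _ h]; rewrite divr_gt0 // subr_gt0. Qed.

Definition tube_set : set M := [set D | exists A, tube A (vec D)].

Lemma tube_set_open : open tube_set.
Proof.
rewrite openE => D0 [A0 t0]; apply: filterS (near_vec D0 (tube_slack t0)) => D hD.
by have [A tA _] := tube_near t0 hD; exists A.
Qed.

Lemma foot_exists (D : tube_set) : exists A, tube A (vec (val D)).
Proof. exact: set_mem (valP D). Qed.

Definition foot_point (D : tube_set) := projT1 (cid (foot_exists D)).

Lemma foot_tube D : tube (foot_point D) (vec (val D)).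
Proof. exact: projT2 (cid (foot_exists D)). Qed.

Lemma foot_in D : S (foot_point D).
Proof. by case: (foot_tube D). Qed.

Definition foot (D : tube_set) : S := SigSub (mem_set (foot_in D)).

Lemma foot_cont : continuous foot.
Proof.
move=> D0; apply: (cvg_set_type (F := nbhs D0)) => W /nbhs_vec[r r0 hr].
have t0 := foot_tube D0; have s0 := tube_slack t0.
pose e := Num.min ((reach (foot_point D0) / 4 - enorm (vec (val D0) - vec (foot_point D0))) / 3) (r / 2).
have e0 : 0 < e by rewrite lt_min s0 divr_gt0.
apply: filterS (near_vecS D0 e0) => D hD; apply: hr => /=.
have [|A tA hA] := tube_near t0 (D := vec (val D)).
  by apply: lt_le_trans hD _; rewrite ge_min lexx.
rewrite (tube_foot_unique (foot_tube D) tA); apply: le_lt_trans hA _.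
by rewrite mulrC -ltr_pdivlMr //; apply: lt_le_trans hD _; rewrite ge_min lexx orbT.
Qed.

Lemma reach_cont : continuous (fun s : S => reach (val s)).
Proof.
move=> s0; apply/(@cvgrPdist_lt _ R^o _ (nbhs s0)) => e e0.
apply: filterS (near_vecS s0 e0) => s /=; apply: le_lt_trans.
have [h h'] : S (val s0) /\ S (val s) by split; apply: set_mem; exact: valP.
apply: abs_sub_le; first exact: reach_lipschitz.
by rewrite enormC; exact: reach_lipschitz.
Qed.

Lemma frame_exists (s : S) : exists F : 'M[C]_(d, N) * 'M[C]_(N, d),
  F.1 *m F.2 = 1%:M /\ (F.1 :=: Pi (val s))%MS.
Proof.
have [_ <-] := PiP (set_mem (valP s)).
have /row_freeP[Z fZ] := row_base_free (Pi (val s)).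
by exists (row_base (Pi (val s)), Z); split=> //; exact: eq_row_base.
Qed.

(** A basis of the normal space at s, chosen without continuity; the topology of
    the total space does not depend on it. *)
Definition frame s := (projT1 (cid (frame_exists s))).1.
Definition coframe s := (projT1 (cid (frame_exists s))).2.

Lemma frame_coframe s : frame s *m coframe s = 1%:M.
Proof. by have [] := projT2 (cid (frame_exists s)). Qed.

Lemma frame_eqmx s : (frame s :=: Pi (val s))%MS.
Proof. by have [] := projT2 (cid (frame_exists s)). Qed.

Lemma frame_free s : row_free (frame s).
Proof. by apply/row_freeP; exists (coframe s); exact: frame_coframe. Qed.

Lemma normal_frame s (u : 'rV[C]_d) : normal (val s) (u *m frame s).
Proof.
have [oP _] := PiP (set_mem (valP s)).
by rewrite /normal -mulmxA (oproj_sub oP) // frame_eqmx.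
Qed.

Lemma coframe_frame s m (B : 'M[C]_(m, N)) : B *m Pi (val s) = B -> B *m coframe s *m frame s = B.
Proof.
move=> nB; have /submxP[Z ->] : (B <= frame s)%MS by rewrite frame_eqmx -nB submxMl.
by rewrite -mulmxA -mulmxA [frame s *m (_ *m _)]mulmxA frame_coframe mul1mx.
Qed.

(** The total space is taken inside M x C^N, which provides its topology. *)
Definition normal_total : set (M * 'rV[C]_N) := [set p | S p.1 /\ normal p.1 p.2].

Definition mk_total (s : S) (B : 'rV[C]_N) (nB : normal (val s) B) : normal_total :=
  SigSub (mem_set (conj (set_mem (valP s)) nB : normal_total (val s, B))).

Definition base_point (e : normal_total) : S :=
  SigSub (mem_set (proj1 (set_mem (valP e)))).

Lemma total_normal (e : normal_total) : normal (val (base_point e)) (val e).2.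
Proof. exact: proj2 (set_mem (valP e)). Qed.

Definition normal_fibre (s : S) : lmodType C := 'rV[C]_d.

Definition to_tot (x : {s : S & normal_fibre s}) : normal_total :=
  mk_total (normal_frame (tag x) (tagged x)).

Definition of_tot (e : normal_total) : {s : S & normal_fibre s} :=
  existT _ (base_point e) ((val e).2 *m coframe (base_point e)).

Lemma to_totK : cancel to_tot of_tot.
Proof.
move=> [s u]; rewrite /of_tot /to_tot /=.
have -> : base_point (mk_total (normal_frame s u)) = s by apply: val_inj.
by rewrite -mulmxA frame_coframe mulmx1.
Qed.

Lemma of_totK : cancel of_tot to_tot.
Proof.
move=> e; apply: val_inj; rewrite /= coframe_frame; last exact: total_normal.
by case: (val e).
Qed.

Lemma base_point_cont : continuous base_point.
Proof.
apply: continuous_set_type => e.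
by apply: (cvg_cont (F := nbhs e)) (@val_continuous _ _ e) => p; exact: cvg_fst.
Qed.

Lemma normal_coord_cont : continuous (fun e : normal_total => (val e).2).
Proof.
by move=> e; apply: (cvg_cont (F := nbhs e)) (@val_continuous _ _ e) => p; exact: cvg_snd.
Qed.

(** Over the points y near x, the normal space at y projects isomorphically to
    the one at x: a normal vector B has the coordinates B (coframe x). The
    inverse multiplies by G(y)^-1 (frame x) Pi_y, where
    G(y) = (frame x) Pi_y (coframe x) is continuous and equals 1 at x. *)
Lemma normal_locally_trivial (x : S) :
  exists (V : set S) (phi : forall y, {linear normal_fibre y -> 'rV[C]_d})
         (psi : S * 'rV[C]_d -> normal_total),
    [/\ open V /\ V x,
        forall y, V y -> bijective (phi y),
        forall y, V y -> forall u : normal_fibre y,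
          psi (y, phi y u) = to_tot (existT _ y u),
        {within [set e | V (tag (of_tot e))],
          continuous (fun e => phi _ (tagged (of_tot e)))}
      & {within V `*` setT, continuous psi}].
Proof.
pose G (y : S) := frame x *m Pi (val y) *m coframe x.
have Gcont y : G z @[z --> y] --> G y.
  apply: (cvg_mulmx (F := nbhs y)); last by move=> W; exact: cvg_cst.
  by apply: (cvg_mulmx (F := nbhs y)); [move=> W; exact: cvg_cst | exact: Pi_cont].
pose phi y : {linear normal_fibre y -> 'rV[C]_d} := mulmxr (frame y *m coframe x).
pose B (p : S * 'rV[C]_d) := p.2 *m (invmx (G p.1) *m frame x *m Pi (val p.1)).
have nB p : normal (val p.1) (B p).
  have [[PP _] _] := PiP (set_mem (valP p.1)).
  by rewrite /normal /B -!mulmxA PP.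
pose H y := invmx (G y) *m frame x *m Pi (val y) *m coframe y.
have Hfr y : H y *m frame y = invmx (G y) *m frame x *m Pi (val y).
  have [[PP _] _] := PiP (set_mem (valP y)).
  by rewrite /H coframe_frame // -[_ *m Pi _ *m Pi _]mulmxA PP.
have HK y : G y \in unitmx -> H y *m (frame y *m coframe x) = 1%:M.
  by move=> Gu; rewrite mulmxA Hfr -!mulmxA (mulmxA (frame x)) mulVmx.
have KH y : G y \in unitmx -> (frame y *m coframe x) *m H y = 1%:M.
  by move=> /HK/mulmx1C.
exists [set y | G y \in unitmx], phi, (fun p => mk_total (nB p)); split.
- split; first by rewrite openE => y /= Gy; exact: near_unitmx (Gcont y) Gy.
  have [oP _] := PiP (set_mem (valP x)).
  by rewrite /= /G (oproj_sub oP) ?frame_eqmx // frame_coframe unitmx1.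
- move=> y /= Gy; exists (mulmxr (H y)) => u; rewrite /= -mulmxA.
    by rewrite KH // mulmx1.
  by rewrite HK // mulmx1.
- move=> y /= Gy u; apply: val_inj; rewrite /= /B /= -Hfr mulmxA.
  by rewrite -[u *m _ *m _]mulmxA KH // mulmx1.
- apply: continuous_subspaceT => e.
  have -> : (fun e => phi _ (tagged (of_tot e))) = (fun e => (val e).2 *m coframe x).
    by apply/funext => e'; rewrite /= mulmxA coframe_frame //; exact: total_normal.
  apply: (cvg_mulmx (F := nbhs e)); last by move=> W; exact: cvg_cst.
  exact: normal_coord_cont.
- apply: continuous_in_subspaceT => -[y w] /set_mem[/= Gy _].
  apply: (cvg_set_type (F := nbhs (y, w))).
  apply: (@cvg_pair_pt _ (nbhs (y, w))).
    by apply: (@cvg_cont _ (nbhs (y, w)) _ _ _ fst (fun s : S => val s)); [exact: val_continuous|exact: cvg_fst].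
  have fstc : p.1 @[p --> (y, w)] --> y by exact: cvg_fst.
  apply: (cvg_mulmx (F := nbhs (y, w))); first exact: cvg_snd.
  apply: (cvg_mulmx (F := nbhs (y, w))); last first.
    exact: (@cvg_cont _ (nbhs (y, w)) _ _ _ fst (fun s : S => Pi (val s)) _ Pi_cont fstc).
  apply: (cvg_mulmx (F := nbhs (y, w))); last by move=> W; exact: cvg_cst.
  exact: (cvg_invmx (F := nbhs (y, w)) (@cvg_cont _ (nbhs (y, w)) _ _ _ fst G _ Gcont fstc) Gy).
Qed.

Definition normal_bundle : vector_bundle R S d :=
  VectorBundle to_totK of_totK base_point_cont normal_locally_trivial.

Lemma width_gt0 (s : S) : 0 < (reach (val s) / 4) ^+ 2.
Proof. by rewrite exprn_gt0 // divr_gt0 // reach_gt0 //; apply: set_mem; exact: valP. Qed.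

(** With this normalisation the unit disk consists of the normal vectors shorter
    than a quarter of the reach. *)
Definition normal_dot (s : S) : {dot (fibre normal_bundle s) for (@Num.conj C)} :=
  frame_metric (frame_free s) (width_gt0 s).

Lemma normal_sqnorm (e : normal_total) :
  normal_dot _ (tagged (of_tot e)) (tagged (of_tot e)) =
  ((enorm (val e).2 / (reach (val (base_point e)) / 4)) ^+ 2)%:C%C.
Proof.
rewrite [LHS]frame_dot_self coframe_frame; last exact: total_normal.
by rewrite -enorm_sqr [in RHS]expr_div_n.
Qed.

Lemma normal_sqnorm_cont : continuous (fun e : Defs.total normal_bundle =>
  normal_dot _ (tagged (of_total e)) (tagged (of_total e))).
Proof.
have -> : (fun e : Defs.total normal_bundle =>
    normal_dot _ (tagged (of_total e)) (tagged (of_total e))) =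
  (fun e : normal_total =>
    ((enorm (val e).2 / (reach (val (base_point e)) / 4)) ^+ 2)%:C%C).
  by apply/funext => e'; exact: normal_sqnorm.
move=> e; rewrite /continuous_at.
apply: (cvg_real (F := nbhs (e : normal_total))).
have h : enorm (val t).2 / (reach (val (base_point t)) / 4) @[t --> (e : normal_total)]
    --> enorm (val e).2 / (reach (val (base_point e)) / 4).
  apply: (cvgM (F := nbhs (e : normal_total))).
    by apply: (cvg_enorm (F := nbhs (e : normal_total))); exact: normal_coord_cont.
  apply: (cvgV (F := nbhs (e : normal_total))).
    by rewrite gt_eqF // divr_gt0 // reach_gt0 //; apply: set_mem; exact: valP.
  apply: (cvgM (F := nbhs (e : normal_total))); last by move=> W; exact: cvg_cst.
  exact: (@cvg_cont _ (nbhs (e : normal_total)) _ _ _ base_point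
    (fun s : S => reach (val s)) _ (@reach_cont) (@base_point_cont e)).
exact: (cvgM (F := nbhs (e : normal_total)) h h).
Qed.

Definition normal_metric : hermitian_metric normal_bundle :=
  HermitianMetric normal_sqnorm_cont.

Lemma disk_normalE (e : normal_total) : disk_bundle normal_metric e <->
  enorm (val e).2 < reach (val (base_point e)) / 4.
Proof.
have r0 : 0 < reach (val (base_point e)) / 4.
  by rewrite divr_gt0 // reach_gt0 //; apply: set_mem; exact: valP.
rewrite /disk_bundle /= /sqnorm /= normal_sqnorm ltcR.
rewrite -[X in _ < X](expr1n _ 2) ltr_pXn2r ?nnegrE ?(divr_ge0 (enorm_ge0 _) (ltW r0)) //.
by rewrite ltr_pdivrMr // mul1r.
Qed.

Lemma foot_normal (D : tube_set) :
  normal (val (foot D)) (vec (val D) - vec (val (foot D))).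
Proof. by case: (foot_tube D). Qed.

Lemma foot_disk (D : tube_set) :
  disk_bundle normal_metric (mk_total (foot_normal D)).
Proof. by apply/disk_normalE; case: (foot_tube D). Qed.

Definition tube_map (D : tube_set) : disk_bundle normal_metric :=
  SigSub (mem_set (foot_disk D)).

Lemma exp_tube (e : disk_bundle normal_metric) :
  tube (val (val e : normal_total)).1
    (vec (unvec (vec (val (val e : normal_total)).1 + (val (val e : normal_total)).2))).
Proof.
have /disk_normalE he := set_mem (valP e).
have [SA nA] := set_mem (valP (val e : normal_total)).
have e2 (a b : 'rV[C]_N) : a + b - a = b by rewrite addrC addKr.
by rewrite unvecK; split; [exact: SA|rewrite e2; exact: nA|rewrite e2; exact: he].
Qed.

Lemma exp_in (e : disk_bundle normal_metric) :
  tube_set (unvec (vec (val (val e : normal_total)).1 + (val (val e : normal_total)).2)).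
Proof. by exists (val (val e : normal_total)).1; exact: exp_tube. Qed.

(** The inverse of [tube_map]: the end point of a normal vector. *)
Definition exp_map (e : disk_bundle normal_metric) : tube_set :=
  SigSub (mem_set (exp_in e)).

Theorem tubular_neighbourhood :
  exists U : set M, [/\ open U, S `<=` U &
    exists (X : vector_bundle R S d) (h : hermitian_metric X)
           (f : U -> disk_bundle h),
      homeomorphism f /\
      forall (x : S) (y : U), val x = val y -> val (f y) = zero_section X x].
Proof.
exists tube_set; split; first exact: tube_set_open.
  by move=> A SA; exists A; exact: tube_self.
exists normal_bundle, normal_metric, tube_map; split; [split|].
- apply: continuous_set_type => D; apply: (cvg_set_type (F := nbhs D)).
  have c1 : foot_point t @[t --> D] --> foot_point D.
    exact: (@cvg_cont _ (nbhs D) _ _ _ foot (fun s : S => val s) _ (@val_continuous _ S) (@foot_cont D)).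
  apply: (@cvg_pair_pt _ (nbhs D)); first exact: c1.
  apply: (cvgB (F := nbhs D)).
    exact: (@cvg_cont _ (nbhs D) _ _ _ (fun D : tube_set => val D) vec _ vec_cont (@val_continuous _ tube_set D)).
  exact: (@cvg_cont _ (nbhs D) _ _ _ foot_point vec _ vec_cont c1).
- exists exp_map; split.
  + by move=> D; apply: val_inj; rewrite /= addrC subrK vecK.
  + move=> e; apply: val_inj; apply: val_inj => /=.
    have E : foot_point (exp_map e) = (val (val e : normal_total)).1.
      by apply: tube_foot_unique (foot_tube _) _; exact: exp_tube.
    by rewrite E /= unvecK addrAC subrr add0r; case: (val _).
  + apply: continuous_set_type => e.
    pose p (t : disk_bundle normal_metric) := val (val t : normal_total).
    have c1 : p t @[t --> e] --> p e.
      apply: (@cvg_cont _ (nbhs e) _ _ _ (fun t => val t : normal_total) (fun t => val t)).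
        exact: val_continuous.
      exact: (@val_continuous _ (disk_bundle normal_metric)).
    have c2 : vec (p t).1 @[t --> e] --> vec (p e).1.
      apply: (@cvg_cont _ (nbhs e) _ _ _ (fun t => (p t).1) vec _ vec_cont).
      by apply: (@cvg_cont _ (nbhs e) _ _ _ p fst _ _ c1) => q; exact: cvg_fst.
    have c3 : (p t).2 @[t --> e] --> (p e).2.
      by apply: (@cvg_cont _ (nbhs e) _ _ _ p snd _ _ c1) => q; exact: cvg_snd.
    exact: (@cvg_cont _ (nbhs e) _ _ _ (fun t => vec (p t).1 + (p t).2) unvec _
      unvec_cont (cvgD c2 c3)).
move=> x y xy; apply: val_inj => /=.
have E : foot_point y = val x.
  apply: tube_foot_unique (foot_tube _) _; rewrite -xy; apply: tube_self.
  by apply: set_mem; exact: valP.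
by rewrite E -xy subrr; congr pair; exact/esym/mul0mx.
Qed.
End Tubular.

(** * Families of matrices as row vectors *)

Lemma cvg_product (T : Type) (F : set_system T) (FF : Filter F) (I : Type)
    (K : I -> topologicalType) (f : T -> prod_topology K) (l : prod_topology K) :
  (forall i, f t i @[t --> F] --> l i) -> f t @[t --> F] --> l.
Proof.
move=> h; apply/cvg_sup => i W.
have /= -> := @nbhsE (initial_topology (fun g : prod_topology K => g i)) l.
move=> -[G [[V oV VO] Gl] GW].
have : nbhs (l i) V by apply: open_nbhs_nbhs; split=> //; move: Gl; rewrite -VO.
move=> /(h i) hV; have {}hV : \forall t \near F, V (f t i) by exact: hV.
by apply: filterS hV => t Vt; apply: GW; rewrite -VO.
Qed.

Lemma coord_product (I : eqType) (K : I -> topologicalType) (i : I) :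
  continuous (fun f : prod_topology K => f i).
Proof. exact: proj_continuous. Qed.

Lemma lin1_mxE (K : fieldType) m n (f : 'rV[K]_m -> 'rV[K]_n) :
  linear f -> forall u, u *m lin1_mx f = f u.
Proof.
move=> lf u; pose h := GRing.isLinear.Build K _ _ _ f lf.
pose g : {linear 'rV[K]_m -> 'rV[K]_n} := HB.pack f h.
by rewrite -[f]/(g : _ -> _) mul_rV_lin1.
Qed.

(** The entries of a family of matrices are listed in one row vector, so that
    linear maps between families become matrices, with ranks, limits and
    inverses. *)
Section Families.
Context {R : realType} {I : finType} {m n : I -> nat}.
Local Notation C := (CC R).

Definition fam := forall i, 'M[C]_(m i, n i).
Definition entry := {i : I & ('I_(m i) * 'I_(n i))%type}.
HB.instance Definition _ := Finite.on entry.
Definition fdim : nat := #|{: entry}|.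

Definition vecf (A : fam) : 'rV[C]_fdim :=
  \row_k A (tag (enum_val k)) (tagged (enum_val k)).1 (tagged (enum_val k)).2.

Definition unvecf (u : 'rV[C]_fdim) : fam :=
  fun i => \matrix_(p, q) u 0 (enum_rank (Tagged _ (p, q) : entry)).

Lemma vecfK : cancel vecf unvecf.
Proof.
move=> A; apply: functional_extensionality_dep => i; apply/matrixP => p q.
by rewrite !mxE enum_rankK.
Qed.

Lemma unvecfK : cancel unvecf vecf.
Proof.
move=> u; apply/rowP => k; rewrite !mxE; congr (u 0 _).
by rewrite -[RHS]enum_valK; congr enum_rank; case: (enum_val k) => i [p q].
Qed.

Lemma vecf_cont : continuous (vecf : prod_topology (fun i => 'M[C]_(m i, n i)) -> _).
Proof.
move=> A; apply: (cvg_mx (F := nbhs A)) => p k; rewrite mxE.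
under eq_cvg do rewrite mxE.
by apply: (cvg_entry (F := nbhs A)); exact: (@coord_product _ (fun i => 'M[C]_(m i, n i))).
Qed.

Lemma unvecf_cont : continuous (unvecf : _ -> prod_topology (fun i => 'M[C]_(m i, n i))).
Proof.
move=> u; apply: (cvg_product (F := nbhs u)) => i.
apply: (cvg_mx (F := nbhs u)) => p q; rewrite mxE; under eq_cvg do rewrite mxE.
by apply: (cvg_entry (F := nbhs u)); exact: cvg_id.
Qed.

Lemma vecfD (A B : fam) : vecf (fun i => A i + B i) = vecf A + vecf B.
Proof. by apply/rowP => k; rewrite !mxE. Qed.

Lemma vecfB (A B : fam) : vecf (fun i => A i - B i) = vecf A - vecf B.
Proof. by apply/rowP => k; rewrite !mxE. Qed.

Lemma vecfZ a (A : fam) : vecf (fun i => a *: A i) = a *: vecf A.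
Proof. by apply/rowP => k; rewrite !mxE. Qed.

Lemma vecf0 : vecf (fun=> 0) = 0.
Proof. by apply/rowP => k; rewrite !mxE. Qed.

Lemma sum_entries (V : nmodType) (g : entry -> V) :
  \sum_(k < fdim) g (enum_val k) = \sum_(i : I) \sum_(p < m i) \sum_(q < n i) g (Tagged _ (p, q)).
Proof.
rewrite (reindex (@enum_rank entry)) /=; last first.
  by exists enum_val => k _; [exact: enum_rankK | exact: enum_valK].
under eq_bigr do rewrite enum_rankK.
under [RHS]eq_bigr do rewrite pair_big /=.
pose J i : finType := ('I_(m i) * 'I_(n i))%type.
have := @sig_big_dep V 0 +%R I J predT (fun _ => predT) (fun i pq => g (existT _ i pq)).
rewrite /= => h; transitivity (\sum_(i : I) \sum_(pq : J i) g (existT _ i pq)).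
  by rewrite h; apply: eq_bigr => -[i pq].
by apply: eq_bigr => i _; apply: eq_big => [[p q]|[p q] _].
Qed.

Lemma nrm_vecf (A : fam) : nrm (vecf A) = \sum_i nrm (A i).
Proof.
rewrite nrm_rV; under eq_bigr do rewrite mxE.
exact: (sum_entries (fun k => normc (A (tag k) (tagged k).1 (tagged k).2))).
Qed.

Lemma dot_vecf (A B : fam) :
  (vecf A *m hadj (vecf B)) 0 0 = \sum_i \tr (A i *m hadj (B i)).
Proof.
rewrite mxE; under eq_bigr do rewrite hadjE !mxE.
rewrite (sum_entries (fun k => A (tag k) (tagged k).1 (tagged k).2 *
  (B (tag k) (tagged k).1 (tagged k).2)^*)).
apply: eq_bigr => i _; apply: eq_bigr => p _ /=; rewrite mxE.
by apply: eq_bigr => q _; rewrite hadjE.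
Qed.

End Families.
Arguments fam R {I} m n.

Section FamilyMaps.
Context {R : realType} {I J : finType} {m n : I -> nat} {m' n' : J -> nat}.
Local Notation C := (CC R).

(** A predicate instead of a linear structure, since the type of families is a
    plain dependent product. *)
Definition fam_linear (f : fam R m n -> fam R m' n') := forall a (X Y : fam R m n),
  f (fun i => a *: X i + Y i) = (fun j => a *: f X j + f Y j).

Definition fmx (f : fam R m n -> fam R m' n') : 'M[C]_(@fdim I m n, @fdim J m' n') :=
  lin1_mx (vecf \o f \o unvecf).

Lemma fmxE f X : fam_linear f -> vecf X *m fmx f = vecf (f X).
Proof.
move=> lf; rewrite /fmx lin1_mxE /= ?vecfK // => a u w /=.
rewrite -vecfZ -vecfD -lf; congr (vecf (f _)).
by apply: functional_extensionality_dep => i; apply/matrixP => p q; rewrite !mxE.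
Qed.

Lemma cvg_fmx (T : Type) (F : set_system T) (FF : Filter F)
    (f : T -> fam R m n -> fam R m' n') (l : fam R m n -> fam R m' n') :
  (forall X j, f t X j @[t --> F] --> l X j) -> fmx (f t) @[t --> F] --> fmx l.
Proof.
move=> h; apply: cvg_mx => p q; rewrite !mxE; under eq_cvg do rewrite !mxE.
exact: cvg_entry.
Qed.

End FamilyMaps.

Section Sandwich.
Context {R : realType} {I : finType} {m n : I -> nat} (L : nat).
Local Notation C := (CC R).
Variables (Q : forall (j : nat) (i : I), 'M[C]_(m i)) (S : forall (j : nat) (i : I), 'M[C]_(n i)).

(** For orthogonal projectors this map is self-adjoint and its trace is a product
    of traces: this yields the dimension of its image. *)
Definition sandwich (Y : fam R m n) : fam R m n :=
  fun i => \sum_(j < L) Q j i *m Y i *m S j i.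

Lemma sandwich_linear : fam_linear sandwich.
Proof.
move=> a X Y; apply: functional_extensionality_dep => i; rewrite /sandwich.
rewrite scaler_sumr -big_split; apply: eq_bigr => j _ /=.
by rewrite mulmxDr mulmxDl -scalemxAr -scalemxAl.
Qed.

Lemma sandwich_hadj : (forall j i, hadj (Q j i) = Q j i) ->
  (forall j i, hadj (S j i) = S j i) -> hadj (fmx sandwich) = fmx sandwich.
Proof.
move=> hQ hS; set M := fmx sandwich.
have h (u w : 'rV[C]_(@fdim I m n)) : (u *m M *m hadj w) 0 0 = (u *m hadj M *m hadj w) 0 0.
  rewrite -[u]unvecfK -[w]unvecfK; move: (unvecf u) (unvecf w) => X Y {u w}.
  have -> : vecf X *m hadj M *m hadj (vecf Y) = vecf X *m hadj (vecf Y *m M).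
    by rewrite hadjM mulmxA.
  rewrite !fmxE; try exact: sandwich_linear.
  rewrite !dot_vecf; apply: eq_bigr => i _; rewrite /sandwich.
  rewrite hadj_sum mulmx_suml mulmx_sumr !raddf_sum; apply: eq_bigr => j _ /=.
  by rewrite !hadjM hQ hS -!mulmxA mxtrace_mulC -!mulmxA.
apply/matrixP => p q; have := h 'e_p 'e_q.
rewrite -!rowE.
have E (A : 'rV[C]_(@fdim I m n)) : (A *m hadj ('e_q : 'rV[C]_(@fdim I m n))) 0 0 = A 0 q.
  rewrite mxE (bigD1 q) //= big1 => [|k kq]; rewrite hadjE !mxE eqxx /=.
    by rewrite eqxx conjC1 mulr1 addr0.
  by rewrite (negPf kq) conjC0 mulr0.
by rewrite !E ![row _ _ _ _]mxE.
Qed.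

Lemma sandwich_tr : \tr (fmx sandwich) = \sum_i \sum_(j < L) \tr (Q j i) * \tr (S j i).
Proof.
rewrite /mxtrace.
have E (k : 'I_(@fdim I m n)) : fmx sandwich k k =
  (fun e : @entry I m n => \sum_(j < L) Q j (tag e) (tagged e).1 (tagged e).1 *
    S j (tag e) (tagged e).2 (tagged e).2) (enum_val k).
  rewrite !mxE /= summxE; apply: eq_bigr => j _; rewrite mxE.
  case Ek : (enum_val k) => [i [p q]] /=.
  have Er : enum_rank (Tagged _ (p, q) : @entry I m n) = k by rewrite -[RHS]enum_valK Ek.
  rewrite (bigD1 q) //= big1 ?addr0.
    rewrite mxE (bigD1 p) //= big1 ?addr0.
      by rewrite !mxE Er !eqxx mulr1.
    move=> p' pp; rewrite !mxE eqxx /= -Er (inj_eq enum_rank_inj) -tag_eqE.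
    by rewrite /tag_eq eqxx /= tagged_asE xpair_eqE (negPf pp) mulr0.
  move=> q' qq; rewrite mxE big1 ?mul0r // => p' _.
  rewrite !mxE eqxx /= -Er (inj_eq enum_rank_inj) -tag_eqE.
  by rewrite /tag_eq eqxx /= tagged_asE xpair_eqE (negPf qq) andbF mulr0.
rewrite (eq_bigr _ (fun k _ => E k)).
rewrite (sum_entries (fun e : @entry I m n => \sum_(j < L)
  Q j (tag e) (tagged e).1 (tagged e).1 * S j (tag e) (tagged e).2 (tagged e).2)) /=.
apply: eq_bigr => i _.
under eq_bigr do rewrite exchange_big /=.
rewrite exchange_big /=; apply: eq_bigr => j _; rewrite mulr_suml.
apply: eq_bigr => p _; by rewrite mulr_sumr.
Qed.
End Sandwich.

(** * Flags and block triangular families *)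

Lemma fmx_inj (R : realType) (p q : nat) (M M' : 'M[CC R]_(p, q)) :
  (forall u : 'rV_p, u *m M = u *m M') -> M = M'.
Proof. by move=> h; apply/row_matrixP => i; rewrite !rowE. Qed.

(** A flag in the spaces C^(v l) is a sequence of projectors, indexed by all
    natural numbers and constant from L on. [c j l] is the dimension of the
    step j at l. *)
Section Flags.
Context {R : realType} {Q : finType} (v : Q -> nat) (L : nat) (c : nat -> Q -> nat).
Local Notation C := (CC R).
Hypotheses (c0 : forall l, c 0 l = 0%N) (cL : forall l, c L l = v l).

Definition flagspace : topologicalType :=
  prod_topology (fun jl : nat * Q => 'M[C]_(v jl.2)).

Definition graded : set flagspace :=
  [set P | forall jl, oproj (P jl) /\ \rank (P jl) = c jl.1 jl.2].

Lemma graded_compact : compact graded.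
Proof.
apply: (@tychonoff _ (fun jl : nat * Q => 'M[C]_(v jl.2))
  (fun jl => [set P | oproj P /\ \rank P = c jl.1 jl.2])).
by move=> jl; exact: compact_oproj.
Qed.

Definition step (P : flagspace) (j : nat) (l : Q) : 'M[C]_(v l) := P (j, l).

Definition nested (P : flagspace) := forall j l, step P j l *m step P j.+1 l = step P j l.

Definition gr (P : flagspace) j l : 'M[C]_(v l) := step P j.+1 l - step P j l.
(** Matrices act on row vectors, so the composite Y *m above P j keeps the
    components of the values of Y outside of the step j.+1. *)
Definition above (P : flagspace) j l : 'M[C]_(v l) := 1%:M - step P j.+1 l.

Section OneFlag.
Variable P : flagspace.
Hypotheses (Pg : graded P) (Pn : nested P).

Lemma flag_oproj j l : oproj (step P j l).
Proof. by have [] := Pg (j, l). Qed.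

Lemma flag_rank j l : \rank (step P j l) = c j l.
Proof. by have [] := Pg (j, l). Qed.

Lemma flag_idem j l : step P j l *m step P j l = step P j l.
Proof. by have [] := flag_oproj j l. Qed.

Lemma flag_hadj j l : hadj (step P j l) = step P j l.
Proof. by have [] := flag_oproj j l. Qed.

Lemma flag_le j k l : (j <= k)%N -> step P j l *m step P k l = step P j l.
Proof.
move=> /subnK <-; elim: (k - j)%N => [|i IH]; first exact: flag_idem.
by rewrite addSn -[X in X *m _]IH -mulmxA Pn IH.
Qed.

Lemma flag_ge j k l : (j <= k)%N -> step P k l *m step P j l = step P j l.
Proof. by move=> jk; rewrite -[LHS]hadjK hadjM !flag_hadj flag_le // flag_hadj. Qed.

Lemma flag_sub j k l : (j <= k)%N -> (step P j l <= step P k l)%MS.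
Proof. by move=> jk; rewrite -(flag_le l jk) submxMl. Qed.

Lemma flag_bot l : step P (0%N) l = 0.
Proof. by apply/eqP; rewrite -mxrank_eq0 flag_rank c0. Qed.

Lemma flag_top l : step P L l = 1%:M.
Proof.
have u : step P L l \in unitmx by rewrite -row_free_unit /row_free flag_rank cL.
by rewrite -[LHS](mulKmx u) flag_idem mulVmx.
Qed.

Lemma flag_gr i j l : step P i l *m gr P j l = if (j < i)%N then gr P j l else 0.
Proof.
rewrite /gr mulmxBr; case: ltnP => h; first by rewrite !flag_ge // ltnW.
by rewrite !flag_le ?subrr // leqW.
Qed.

Lemma gr_flag j l : gr P j l *m step P j.+1 l = gr P j l.
Proof. by rewrite /gr mulmxBl flag_idem Pn. Qed.

Lemma sum_gr k l : \sum_(j < k) gr P j l = step P k l.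
Proof.
elim: k => [|k IH]; first by rewrite big_ord0 flag_bot.
by rewrite big_ord_recr /= IH /gr addrC subrK.
Qed.

Lemma gr_hadj j l : hadj (gr P j l) = gr P j l.
Proof. by rewrite /gr hadjB !flag_hadj. Qed.

Lemma above_hadj j l : hadj (above P j l) = above P j l.
Proof. by rewrite /above hadjB hadj1 flag_hadj. Qed.

Lemma gr_tr j l : \tr (gr P j l) = (c j.+1 l)%:R - (c j l)%:R.
Proof. by rewrite /gr linearB /= !tr_idem ?flag_idem // !flag_rank. Qed.

Lemma above_tr j l : \tr (above P j l) = (v l)%:R - (c j.+1 l)%:R.
Proof. by rewrite /above linearB /= mxtrace1 tr_idem ?flag_idem // flag_rank. Qed.

Section Hom.
Context {I : finType} (s t : I -> Q).
Local Notation hom := (fam R (fun i => v (s i)) (fun i => v (t i))).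

(** The part of a family that maps the graded piece j into the pieces k > j, for
    all j: the strictly lower triangular part for the orthogonal splitting. *)
Definition lower : hom -> hom :=
  sandwich L (fun j i => gr P j (s i)) (fun j i => above P j (t i)).

Definition preserves (Y : hom) :=
  forall i j, step P j (s i) *m Y i *m step P j (t i) = step P j (s i) *m Y i.

Lemma lower_linear : fam_linear lower.
Proof. exact: sandwich_linear. Qed.

Lemma lower_preserves Y : preserves Y -> forall i, lower Y i = 0.
Proof.
move=> pY i; rewrite /lower /sandwich big1 // => j _.
have -> : gr P j (s i) *m Y i = gr P j (s i) *m (step P j.+1 (s i) *m Y i).
  by rewrite mulmxA gr_flag.
by rewrite -pY -!mulmxA /above mulmxBr mulmx1 flag_idem subrr !mulmx0.
Qed.

Lemma upper_preserves Y : preserves (fun i => Y i - lower Y i).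
Proof.
move=> i k; have -> : Y i - lower Y i = \sum_(j < L) gr P j (s i) *m Y i *m step P j.+1 (t i).
  rewrite -{1}[Y i]mul1mx -flag_top -sum_gr mulmx_suml /lower /sandwich -sumrB.
  by apply: eq_bigr => j _; rewrite /above mulmxBr mulmx1 subKr.
rewrite mulmx_sumr mulmx_suml; apply: eq_bigr => j _.
rewrite !mulmxA flag_gr; case: ltnP => jk; last by rewrite !mul0mx.
by rewrite -mulmxA flag_le.
Qed.

Lemma lower_eq0 Y : (forall i, lower Y i = 0) -> preserves Y.
Proof. by move=> h i j; have := upper_preserves Y i j; rewrite h subr0. Qed.

Lemma lower_add X Y i : lower (fun i => X i + Y i) i = lower X i + lower Y i.
Proof.
by have := congr1 (fun f : hom => f i) (lower_linear 1 X Y); rewrite /= scale1r => <-;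
  congr (lower _ i); apply: functional_extensionality_dep => k; rewrite scale1r.
Qed.

Lemma lower_sub X Y i : lower (fun i => X i - Y i) i = lower X i - lower Y i.
Proof.
apply/eqP; rewrite eq_sym subr_eq -lower_add; apply/eqP; congr (lower _ i).
by apply: functional_extensionality_dep => k; rewrite subrK.
Qed.

Lemma lower_idem Y i : lower (lower Y) i = lower Y i.
Proof.
have := lower_preserves (upper_preserves Y) i; rewrite lower_sub => /eqP.
by rewrite subr_eq0 => /eqP.
Qed.

Lemma lowermx_idem : fmx lower *m fmx lower = fmx lower.
Proof.
apply: fmx_inj => u; rewrite -[u]unvecfK; move: (unvecf u) => Y.
rewrite mulmxA !fmxE; try exact: lower_linear.
by congr vecf; apply: functional_extensionality_dep => i; rewrite lower_idem.
Qed.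

Lemma lowermx_oproj : oproj (fmx lower).
Proof.
split; first exact: lowermx_idem.
by apply: sandwich_hadj => j i; [exact: gr_hadj | exact: above_hadj].
Qed.

Lemma lowermx_eq0 Y : vecf Y *m fmx lower = 0 <-> preserves Y.
Proof.
rewrite fmxE; last exact: lower_linear.
split=> [h|/lower_preserves h].
  by apply: lower_eq0 => i; rewrite -[lower Y]vecfK h; apply/matrixP => p q; rewrite !mxE.
by rewrite -vecf0; congr vecf; apply: functional_extensionality_dep => i; exact: h.
Qed.

(** The rank of an idempotent is its trace, and [sandwich_tr] computes it. *)
Lemma lowermx_rank : (forall j l, c j l <= c j.+1 l)%N -> (forall j l, c j l <= v l)%N ->
  \rank (fmx lower) =
  (\sum_i \sum_(j < L) (c j.+1 (s i) - c j (s i)) * (v (t i) - c j.+1 (t i)))%N.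
Proof.
move=> cS cv; apply/eqP; rewrite -(eqr_nat C) -tr_idem ?lowermx_idem // sandwich_tr.
rewrite natr_sum; apply/eqP; apply: eq_bigr => i _; rewrite natr_sum.
apply: eq_bigr => j _; rewrite gr_tr above_tr natrM.
by rewrite !natrB.
Qed.
End Hom.
End OneFlag.

Lemma cvg_lower (T : Type) (F : set_system T) (FF : Filter F)
    (I : finType) (s t : I -> Q) (P : T -> flagspace) (P0 : flagspace)
    (Y : T -> fam R (fun i => v (s i)) (fun i => v (t i)))
    (Y0 : fam R (fun i => v (s i)) (fun i => v (t i))) :
  (forall jl, P z jl @[z --> F] --> P0 jl) ->
  (forall i, Y z i @[z --> F] --> Y0 i) ->
  forall i, lower (P z) (Y z) i @[z --> F] --> lower P0 Y0 i.
Proof.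
move=> hP hY i; apply: cvg_sum_mx => j _.
apply: cvg_mulmx; first apply: cvg_mulmx => //.
  by apply: cvgB; exact: (hP (_, _)).
apply: cvgB; last exact: (hP (_, _)).
by move=> W; exact: cvg_cst.
Qed.

End Flags.

(** * Subrepresentations of a quotient *)

Section FactMod.
Context {K : fieldType}.

Lemma in_factmodS m1 m2 n (U : 'M[K]_n) (W1 : 'M[K]_(m1, n)) (W2 : 'M[K]_(m2, n)) :
  (U <= W2)%MS -> (in_factmod U W1 <= in_factmod U W2)%MS = (W1 <= W2)%MS.
Proof.
move=> UW2; apply/idP/idP => [h|h]; last exact: submxMr.
rewrite -(in_factmodsK UW2); apply: submx_trans (addsmxSr U W1) _.
rewrite -(in_factmodsK (addsmxSl U W1)) addsmxS // val_factmodS.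
by rewrite in_factmod_addsK.
Qed.

(** The map that A induces between quotients by U and V, which is how
    [quot_rep] is built, commutes with the projections. *)
Lemma in_factmodM m n p (U : 'M[K]_n) (V : 'M[K]_p) (A : 'M[K]_(n, p)) (W : 'M[K]_(m, n)) :
  (U *m A <= V)%MS ->
  in_factmod U W *m in_factmod V (val_factmod (U := U) 1%:M *m A) = in_factmod V (W *m A).
Proof.
move=> UA; have E q (X : 'M[K]_(q, p)) := in_factmodE V X.
have key := val_factmodE (in_factmod U W).
transitivity (val_factmod (in_factmod U W) *m A *m in_factmod V 1%:M).
  by rewrite E key !mulmxA.
rewrite (E _ (W *m A)); apply/eqP.
rewrite -subr_eq0 -mulmxBl -mulmxBl -E in_factmod_eq0.
apply: submx_trans UA; apply: submxMr.
by rewrite -in_factmod_eq0 linearB /= val_factmodK subrr.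
Qed.

Lemma rank_in_factmod m n (U : 'M[K]_n) (W : 'M[K]_(m, n)) :
  (U <= W)%MS -> \rank (in_factmod U W) = (\rank W - \rank U)%N.
Proof. by move=> UW; rewrite -(addsmx_idPr UW) -mxrank_in_factmod addnK. Qed.

End FactMod.

Section Quotients.
Context {R : realType} {Q : quiver} (v : dim_vector Q) (alpha : Q -> CC R).
Local Notation C := (CC R).
Variables (A : Rep R v) (U : subspaces R v).
Hypothesis sU : subrep A U.

Lemma dimv_quot_sub W l : (U l <= W l)%MS ->
  dimv (quot_sub U W) l = (dimv W l - dimv U l)%N.
Proof. by move=> UW; rewrite /dimv /quot_sub mxrank_gen rank_in_factmod. Qed.

Lemma subrep_quot_sub W : (forall l, U l <= W l)%MS ->
  subrep (quot_rep A U) (quot_sub U W) <-> subrep A W.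
Proof.
move=> UW; split=> h a; have := h a; rewrite /quot_sub /quot_rep !genmxE.
  by rewrite (eqmxMr _ (genmxE _)) in_factmodM ?sU // in_factmodS.
by rewrite (eqmxMr _ (genmxE _)) in_factmodM ?sU // in_factmodS.
Qed.

Lemma quot_sub_lift (W' : subspaces R (quot_dim U)) :
  exists W, (forall l, U l <= W l)%MS /\ forall l, (quot_sub U W l :=: W' l)%MS.
Proof.
exists (fun l => U l + val_factmod (W' l))%MS; split=> l; first exact: addsmxSl.
apply: eqmx_trans (genmxE _) _; apply: eqmx_trans (in_factmod_addsK _ _) _.
by rewrite val_factmodK.
Qed.

Lemma subrep_eqmx (w : dim_vector Q) (B : Rep R w) (W W' : subspaces R w) :
  (forall l, W l :=: W' l)%MS -> subrep B W -> subrep B W'.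
Proof. by move=> e h a; rewrite -(eqmxMr _ (e (out a))) -(e (inn a)). Qed.

Lemma quot_neq0 W : (forall l, U l <= W l)%MS ->
  (exists l, quot_sub U W l != 0) <-> (exists l, dimv W l != dimv U l).
Proof.
move=> UW; split=> -[l hl]; exists l; move: hl;
  rewrite -mxrank_eq0 -/(dimv (quot_sub U W) l) dimv_quot_sub // subn_eq0 -ltnNge.
  by move=> h; rewrite gtn_eqF.
by rewrite ltn_neqAle eq_sym => -> /=; rewrite mxrankS.
Qed.

(** The condition for a subspace containing U, of dimension vector dim U + d, to
    induce the maximal destabilising subrepresentation of A / U. It is stated
    on the subrepresentations containing U, avoiding quotients. *)
Definition optimal_quot (d : dim_vector Q) := forall W, subrep A W -> (forall l, U l <= W l)%MS ->
  (exists l, dimv W l != dimv U l) ->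
  let w := fun l => (dimv W l - dimv U l)%N in
  slope alpha w <= slope alpha d /\ (slope alpha w = slope alpha d -> (rank_of w <= rank_of d)%N).

(** Subrepresentations of A / U correspond to those of A containing U. *)
Lemma max_destabilizing_quotP W : (forall l, U l <= W l)%MS -> subrep A W ->
  (exists l, dimv W l != dimv U l) ->
  max_destabilizing alpha (quot_rep A U) (quot_sub U W) <-> optimal_quot (dimv (quot_sub U W)).
Proof.
move=> UW sW nW; split.
  move=> [_ h1 h2] W1 sW1 UW1 nW1 /=.
  have n1 : nonzero_subrep (quot_rep A U) (quot_sub U W1).
    by split; [apply/subrep_quot_sub|apply/quot_neq0].
  have e : (fun l => (dimv W1 l - dimv U l)%N) = dimv (quot_sub U W1).
    by apply/funext => l; rewrite dimv_quot_sub.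
  by rewrite e; split; [exact: h1 | exact: h2].
move=> h.
have main W' : nonzero_subrep (quot_rep A U) W' ->
  slope alpha (dimv W') <= slope alpha (dimv (quot_sub U W)) /\
  (slope alpha (dimv W') = slope alpha (dimv (quot_sub U W)) ->
    (rank_of (dimv W') <= rank_of (dimv (quot_sub U W)))%N).
  move=> [sW' nW']; have [W1 [UW1 e1]] := quot_sub_lift W'.
  have -> : dimv W' = (fun l => (dimv W1 l - dimv U l)%N).
    by apply/funext => l; rewrite -dimv_quot_sub // /dimv e1.
  apply: h => //.
    by apply/(subrep_quot_sub UW1)/(subrep_eqmx _ sW') => l; apply: eqmx_sym.
  apply/(quot_neq0 UW1); case: nW' => l hl; exists l; apply: contra hl.
  by rewrite -!mxrank_eq0 e1.
split=> [|W' /main[]//|W' /main[]//].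
by split; [apply/subrep_quot_sub|apply/quot_neq0].
Qed.
End Quotients.

(** * The Harder-Narasimhan flag *)

(** In the application, W contains the step k of the flag, and N the step j:
    w, n, k, j stand for degrees, and the primed letters for ranks; m1 and m2
    are the slopes of the pieces following j and k, and r is the rank of the
    piece following j. If W were larger than the step k, then its excess would
    have slope at most m2, and N would be deficient by a degree of slope less
    than m1, against optimality. *)
Lemma slope_squeeze (R : realFieldType) (w n k j w' n' k' j' r m1 m2 : R) :
  w + n = k + (j + m1 * r) -> w' + n' = k' + (j' + r) ->
  n - j <= m1 * (n' - j') -> w - k <= m2 * (w' - k') -> m2 < m1 -> w' <= k'.
Proof.
move=> e e' h1 h2 m; rewrite leNgt; apply/negP => lt.
have p : 0 < (m1 - m2) * (w' - k') by rewrite mulr_gt0 ?subr_gt0.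
have e1 : n' = k' + (j' + r) - w' by rewrite -e' [_ + n']addrC addrK.
have e2 : n = k + (j + m1 * r) - w by rewrite -e [_ + n]addrC addrK.
by move: h1 h2 p; rewrite e1 e2; nra.
Qed.

Section HN.
Context {R : realType} {Q : quiver} (v : dim_vector Q) (alpha : Q -> CC R).
Local Notation C := (CC R).
Variables (L : nat) (vs : 'I_L -> dim_vector Q).
Hypothesis alpha_im : forall l, 'Re (alpha l) = 0.

(** Dimension of the step j of a flag of type [vs]. *)
Definition cum (j : nat) (l : Q) : nat := (\sum_(i < L | (i < j)%N) vs i l)%N.

Lemma cum0 l : cum 0 l = 0%N.
Proof. by rewrite /cum big_pred0. Qed.

Lemma cumS (j : 'I_L) l : cum j.+1 l = (cum j l + vs j l)%N.
Proof.
rewrite /cum (bigD1 j) //= addnC; congr addn; apply: eq_bigl => i.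
by rewrite ltnS (ltn_neqAle i j) andbC.
Qed.

Lemma cum_le j l : (cum j l <= cum j.+1 l)%N.
Proof.
rewrite /cum [leqRHS](bigID (fun i : 'I_L => (i < j)%N)) /=.
rewrite -[leqLHS]addn0 leq_add //; apply: eq_leq; apply: eq_bigl => i.
by rewrite andbC; case: ltnP => //= h; rewrite leqW.
Qed.

Lemma cum_ge j l : (L <= j)%N -> cum j l = cum L l.
Proof.
by move=> Lj; apply: eq_bigl => i; rewrite ltn_ord (leq_trans (ltn_ord i)).
Qed.

Definition proper_type := (forall l, cum L l = v l) /\ (forall j, exists l, vs j l != 0%N).

(** The Harder-Narasimhan filtration, normalised to orthogonal projectors and
    freed of quotient representations. *)
Definition hnflag (A : Rep R v) (P : flagspace (R := R) v) :=
  [/\ graded cum P, nested P, preserves P (s := @out Q) (t := @inn Q) A &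
    forall j : 'I_L, optimal_quot alpha A (fun l => step P j l) (vs j)].

Lemma optimal_quot_eqmx (A : Rep R v) (U U' : subspaces R v) (d : dim_vector Q) :
  (forall l, U l :=: U' l)%MS -> optimal_quot alpha A U d -> optimal_quot alpha A U' d.
Proof.
move=> e h W sW UW; have e' : dimv U = dimv U' by apply/funext => l; rewrite /dimv e.
by rewrite -e'; apply: h => // l; rewrite e.
Qed.

Lemma preserves_subrep (A : Rep R v) (P : flagspace (R := R) v) j :
  preserves P (s := @out Q) (t := @inn Q) A -> subrep A (fun l => step P j l).
Proof. by move=> pA a; rewrite -pA submxMl. Qed.

Lemma HN_stratum_flag A : HN_stratum alpha vs A ->
  proper_type /\ exists P, hnflag A P.
Proof.
move=> [F [F0 FL Fs Fle Fmax] Fdim].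
have rF j l : (j <= L)%N -> \rank (F j l) = cum j l.
  elim: j => [|j IH] jL; first by rewrite F0 mxrank0 cum0.
  have [le _] := Fle j jL.
  have := Fdim (Ordinal jL) l; rewrite dimv_quot_sub //= => h.
  rewrite (cumS (Ordinal jL)) /= -IH ?(ltnW jL) // -h /dimv.
  by rewrite subnKC // mxrankS.
split; [split=> [l|j]|].
- by rewrite -rF //; have := FL l; rewrite /row_full => /eqP.
- have [le [l lt]] := Fle j (ltn_ord j); exists l.
  by rewrite -Fdim dimv_quot_sub // subn_eq0 -ltnNge ltn_neqAle mxrankS //=;
     move: lt; rewrite ltmxErank => /andP[_ ?]; rewrite ltn_eqF.
(* F is meaningful up to L only; the flag is constant from there on. *)
pose P : flagspace (R := R) v := fun jl => projT1 (cid (oproj_exists (F (minn jl.1 L) jl.2))).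
have Po j l : oproj (step P j l) by have [] := projT2 (cid (oproj_exists (F (minn j L) l))).
have PF j l : (step P j l :=: F (minn j L) l)%MS.
  by have [] := projT2 (cid (oproj_exists (F (minn j L) l))).
have cm j l : cum (minn j L) l = cum j l.
  by rewrite minnE; case: (leqP j L) => h; [rewrite (eqP h) subn0|rewrite subKn ?(ltnW h) // cum_ge // ltnW].
have pA : preserves P (s := @out Q) (t := @inn Q) A.
  move=> a j; apply: (oproj_sub (Po _ _)).
  by rewrite (eqmxMr _ (PF _ _)) PF; apply: Fs; rewrite geq_minr.
exists P; split => //.
- by move=> [j l]; split; [exact: Po | rewrite /= -cm -rF ?geq_minr // -PF].
- move=> j l; apply: (oproj_sub (Po _ _)); rewrite !PF.
  have [h|h] := leqP j.+1 L.
    have m1 : minn j L = j by apply/minn_idPl; exact: ltnW.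
    by have [le _] := Fle j h; rewrite m1.
  have m1 : minn j L = L by apply/minn_idPr.
  by rewrite m1.
- move=> j; have [le [l lt]] := Fle j (ltn_ord j).
  have e l' : (F j l' :=: step P j l')%MS.
    by apply: eqmx_sym; have := PF j l'; rewrite (minn_idPl (ltnW (ltn_ord j))).
  apply: (optimal_quot_eqmx e).
  have -> : vs j = dimv (quot_sub (F j) (F j.+1)).
    by apply/funext => l'; rewrite -Fdim.
  apply/max_destabilizing_quotP => //; try exact: Fs.
  - by apply: Fs; rewrite ltnW.
  - by exists l; move: lt; rewrite ltmxErank /dimv => /andP[_ h]; rewrite gtn_eqF.
  - exact: Fmax.
Qed.

Hypothesis type_ok : proper_type.
Let cL : forall l, cum L l = v l. Proof. by case: type_ok. Qed.

Lemma cum_mono j k l : (j <= k)%N -> (cum j l <= cum k l)%N.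
Proof.
by move=> /subnK <-; elim: (k - j)%N => // i IH; rewrite addSn (leq_trans IH) // cum_le.
Qed.

Lemma cum_max j l : (cum j l <= v l)%N.
Proof.
rewrite -cL; case: (leqP j L) => h; first exact: cum_mono.
by rewrite cum_ge // ltnW.
Qed.

Lemma flag_HN_stratum A P : hnflag A P -> HN_stratum alpha vs A.
Proof.
move=> [Pg Pn pA opt]; have r := flag_rank Pg.
have sub j l : (step P j l <= step P j.+1 l)%MS by exact: flag_sub.
have dq (j : 'I_L) l :
  dimv (quot_sub (fun l => step P j l) (fun l => step P j.+1 l)) l = vs j l.
  by rewrite dimv_quot_sub // /dimv !r cumS addKn.
exists (fun j l => step P j l) => //; split=> [l|l|j jL|j jL|j jL].
- exact: (flag_bot cum0 Pg).
- by rewrite /row_full r cL.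
- exact: preserves_subrep.
- split; first exact: sub.
  have [l hl] := (proj2 type_ok) (Ordinal jL); exists l.
  by rewrite ltmxErank sub !r (cumS (Ordinal jL)) -addn1 leq_add2l lt0n.
- apply/max_destabilizing_quotP; try exact: preserves_subrep; first exact: sub.
    have [l hl] := (proj2 type_ok) (Ordinal jL); exists l.
    by rewrite /dimv !r (cumS (Ordinal jL)) -[X in _ != X]addn0 eqn_add2l.
  rewrite (_ : dimv _ = vs (Ordinal jL)); first exact: (opt (Ordinal jL)).
  by apply/funext => l; rewrite (dq (Ordinal jL)).
Qed.

(** As alpha is imaginary, i alpha is real: slopes become real numbers. *)
Definition theta (l : Q) : R := complex.Re ('i * alpha l).
Definition deg (w : Q -> nat) : R := \sum_l theta l * (w l)%:R.

Lemma thetaE l : 'i * alpha l = (theta l)%:C%C.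
Proof.
apply/esym/RRe_real; rewrite (Crect (alpha l)) alpha_im add0r mulrA -expr2 sqrCi.
by rewrite mulN1r rpredN Creal_Im.
Qed.

Lemma slopeE w : slope alpha w = (deg w / (rank_of w)%:R)%:C%C.
Proof.
rewrite /slope rmorphM fmorphV rmorph_nat; congr (_ / _).
by rewrite rmorph_sum; apply: eq_bigr => l _; rewrite rmorphM rmorph_nat thetaE.
Qed.

Definition rk (w : Q -> nat) : R := \sum_l (w l)%:R.

Lemma rk_rank w : (rank_of w)%:R = rk w.
Proof. by rewrite natr_sum. Qed.

Lemma deg_sub w w' : (forall l, (w' l <= w l)%N) ->
  deg (fun l => w l - w' l)%N = deg w - deg w'.
Proof. by move=> h; rewrite -sumrB; apply: eq_bigr => l _; rewrite natrB // mulrBr. Qed.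

Lemma rk_sub w w' : (forall l, (w' l <= w l)%N) ->
  rk (fun l => w l - w' l)%N = rk w - rk w'.
Proof. by move=> h; rewrite -sumrB; apply: eq_bigr => l _; rewrite natrB. Qed.

Lemma rk_le w w' : (forall l, (w' l <= w l)%N) -> rk w' <= rk w.
Proof. by move=> h; apply: ler_sum => l _; rewrite ler_nat. Qed.

Lemma rk_lt w w' : (forall l, (w' l <= w l)%N) -> (exists l, w l != w' l) -> rk w' < rk w.
Proof.
move=> h [l hl]; rewrite /rk (bigD1 l) //= [ltRHS](bigD1 l) //=.
by apply: ltr_leD; [rewrite ltr_nat ltn_neqAle eq_sym hl h | apply: ler_sum => k _; rewrite ler_nat].
Qed.

Lemma rk_eq w w' : (forall l, (w' l <= w l)%N) -> rk w <= rk w' -> w =1 w'.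
Proof.
move=> h r l; apply/eqP; apply: contraT => hl.
by have := rk_lt h (ex_intro _ l hl); rewrite ltNge r.
Qed.

Lemma rk_vs_gt0 (j : 'I_L) : 0 < rk (vs j).
Proof.
have [l hl] := proj2 type_ok j; rewrite /rk (bigD1 l) //= ltr_wpDr ?sumr_ge0 //.
by rewrite ltr0n lt0n.
Qed.

Definition mu (j : 'I_L) : R := deg (vs j) / rk (vs j).

Lemma deg_cumS (j : 'I_L) : deg (cum j.+1) = deg (cum j) + mu j * rk (vs j).
Proof.
rewrite /mu divfK ?gt_eqF ?rk_vs_gt0 // -big_split; apply: eq_bigr => l _.
by rewrite cumS natrD mulrDr.
Qed.

Lemma rk_cumS (j : 'I_L) : rk (cum j.+1) = rk (cum j) + rk (vs j).
Proof. by rewrite -big_split; apply: eq_bigr => l _; rewrite cumS natrD. Qed.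

Section HNflag.
Variables (A : Rep R v) (P : flagspace (R := R) v).
Hypothesis hA : hnflag A P.

Let Pg : graded cum P. Proof. by case: hA. Qed.
Let Pn : nested P. Proof. by case: hA. Qed.
Let pA : preserves P (s := @out Q) (t := @inn Q) A. Proof. by case: hA. Qed.
Let dimP j : dimv (fun l => step P j l) = cum j.
Proof. by apply/funext => l; exact: flag_rank. Qed.

(** The optimality of the piece j extends to a subrepresentation W equal to the
    step j, and the inequality between slopes is cleared of its denominators. *)
Lemma HN_slope (j : 'I_L) (W : subspaces R v) : subrep A W ->
  (forall l, step P j l <= W l)%MS ->
  deg (dimv W) - deg (cum j) <= mu j * (rk (dimv W) - rk (cum j)) /\
  (deg (dimv W) - deg (cum j) = mu j * (rk (dimv W) - rk (cum j)) ->
    rk (dimv W) <= rk (cum j.+1)).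
Proof.
move=> sW UW; have le l : (cum j l <= dimv W l)%N.
  by rewrite -(flag_rank Pg) mxrankS.
have [h|h] := pselect (exists l, dimv W l != cum j l); last first.
  have -> : dimv W = cum j.
    by apply/funext => l; apply/eqP; apply: contra_notT h => hl; exists l.
  by rewrite !subrr mulr0; split=> // _; apply: rk_le => l; exact: cum_le.
have [_ _ _ /(_ j W sW UW)] := hA; rewrite -/(dimv _) dimP => /(_ h) /=.
have r0 : 0 < rk (dimv W) - rk (cum j) by rewrite subr_gt0; exact: rk_lt.
rewrite !slopeE !rk_rank lecR deg_sub // rk_sub // -/(mu j) => -[h1 h2].
split; first by rewrite -ler_pdivrMr.
move=> e; have : (rk (dimv W) - rk (cum j)) <= rk (vs j).
  rewrite -rk_sub // -!rk_rank ler_nat; apply: h2.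
  by rewrite e mulfK // gt_eqF.
by rewrite rk_cumS lerBlDl.
Qed.

Lemma mu_step (j k : 'I_L) : k = j.+1 :> nat -> mu k < mu j.
Proof.
move=> kj; have r0 := rk_vs_gt0 k; have r1 := rk_vs_gt0 j.
have [||h1 h2] := @HN_slope j (fun l => step P k.+1 l).
- exact: preserves_subrep.
- by move=> l; apply: flag_sub => //; rewrite kj leqW // leqW.
move: h1 h2; rewrite dimP deg_cumS rk_cumS kj deg_cumS rk_cumS.
have -> : deg (cum j) + mu j * rk (vs j) + mu k * rk (vs k) - deg (cum j) =
  mu j * rk (vs j) + mu k * rk (vs k) by ring.
have -> : rk (cum j) + rk (vs j) + rk (vs k) - rk (cum j) =
  rk (vs j) + rk (vs k) by ring.
rewrite mulrDr lerD2l ler_pM2r // le_eqVlt => /orP[/eqP <-|//] /(_ erefl).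
by rewrite gerDl leNgt r0.
Qed.

Lemma mu_decreasing (j k : 'I_L) : (j < k)%N -> mu k < mu j.
Proof.
case: k => k kL /=; elim: k kL => // k IH kL; rewrite ltnS leq_eqVlt => /orP[/eqP jk|jk].
  by apply: mu_step; rewrite /= jk.
apply: lt_trans (IH (ltnW kL) jk); exact: mu_step.
Qed.

(** By induction on j, the step j + 1 of both flags, U and U', contain the same
    step j. Let W = U + U' and I be their intersection. Degrees and ranks satisfy
    dim W + dim I = 2 dim U. As I / step j has slope at most mu_j, W / step j
    has slope at least mu_j, so exactly mu_j, and by maximality of the rank
    W = U. *)
Lemma HN_flag_unique (P' : flagspace (R := R) v) : graded cum P' -> nested P' ->
  preserves P' (s := @out Q) (t := @inn Q) A -> P' = P.
Proof.
move=> Pg' Pn' pA'; apply: functional_extensionality_dep => -[j l].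
rewrite -[LHS]/(step P' j l) -[RHS]/(step P j l).
elim: j l => [|j IH] l; first by rewrite !(flag_bot cum0).
have [Lj|jL] := leqP L j.
  have top (P1 : flagspace (R := R) v) : graded cum P1 -> nested P1 -> step P1 j.+1 l = 1%:M.
    move=> g1 n1; have := flag_le g1 n1 l (leqW Lj).
    by rewrite (flag_top cL g1) mul1mx.
  by rewrite !top.
pose J := Ordinal jL; pose U l := step P j.+1 l; pose U' l := step P' j.+1 l.
pose W : subspaces R v := fun l => (U l + U' l)%MS.
pose I : subspaces R v := fun l => (U l :&: U' l)%MS.
have sU := preserves_subrep j.+1 pA; have sU' := preserves_subrep j.+1 pA'.
have sW : subrep A W.
  by move=> a; rewrite addsmxMr; apply: addsmxS; [exact: sU|exact: sU'].
have sI : subrep A I.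
  move=> a; rewrite sub_capmx; apply/andP; split.
    by apply: submx_trans (submxMr _ (capmxSl _ _)) (sU a).
  by apply: submx_trans (submxMr _ (capmxSr _ _)) (sU' a).
have UI k : (step P j k <= I k)%MS.
  by rewrite sub_capmx /U /U' (flag_sub Pg Pn) //= -IH (flag_sub Pg' Pn').
have UW k : (step P j k <= W k)%MS.
  exact: submx_trans (flag_sub Pg Pn k (leqnSn j)) (addsmxSl _ _).
have dimWI k : (dimv W k + dimv I k = cum j.+1 k + cum j.+1 k)%N.
  by rewrite /dimv mxrank_sum_cap /U /U' (flag_rank Pg) (flag_rank Pg').
have degWI : deg (dimv W) + deg (dimv I) = deg (cum j.+1) + deg (cum j.+1).
  by rewrite -!big_split; apply: eq_bigr => k _; rewrite /= -!mulrDr -!natrD dimWI.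
have rkWI : rk (dimv W) + rk (dimv I) = rk (cum j.+1) + rk (cum j.+1).
  by rewrite -!big_split; apply: eq_bigr => k _; rewrite /= -!natrD dimWI.
have [hI _] := @HN_slope J I sI UI; have [hW hW'] := @HN_slope J W sW UW.
have rW : rk (dimv W) <= rk (cum j.+1).
  apply: hW'; apply/le_anti; rewrite hW /=.
  move: degWI rkWI hI; rewrite (deg_cumS J) (rk_cumS J) /=.
  move: (deg (dimv W)) (deg (dimv I)) (deg (cum j)) (rk (dimv W)) (rk (dimv I)) (rk (cum j)) => a b e f g h.
  by move: (mu J) (rk (vs J)) => m r; nra.
have leW k : (cum j.+1 k <= dimv W k)%N.
  by rewrite -(flag_rank Pg) mxrankS // addsmxSl.
have eW := rk_eq leW rW l.
have U'U : (U' l <= U l)%MS.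
  have /eqmxP eU : (U l == W l)%MS.
    by rewrite -mxrank_leqif_eq ?addsmxSl // /U (flag_rank Pg) -eW.
  by rewrite eU addsmxSr.
apply: oproj_rank_inj U'U _; [exact: (flag_oproj Pg')|exact: (flag_oproj Pg)|].
by rewrite /U /U' (flag_rank Pg) (flag_rank Pg').
Qed.

(** The commutator condition makes X a morphism of representations from the step
    j + 1 to the quotient of A by any larger step. By induction, X sends the
    step j into itself. Suppose that X sends the step j + 1 into the step
    k + 1 with k > j; then it also sends it into the step k. For otherwise its
    image generates with the step k a subrepresentation W, and its kernel N,
    the part sent into the step k, satisfies dim W + dim N = dim of step k +
    dim of step (j + 1). The slope of W / step k is at most mu_k, and that of
    N / step j at most mu_j, which contradicts mu_k < mu_j ([slope_squeeze]). *)
Lemma HN_hom_preserves (X : fam R (fun l : Q => v l) (fun l : Q => v l)) :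
  preserves P (s := @out Q) (t := @inn Q)
    (fun a => A a *m X (inn a) - X (out a) *m A a) ->
  preserves P (s := id) (t := id) X.
Proof.
move=> pX.
have rho j a : (step P j (out a) *m (A a *m X (inn a) - X (out a) *m A a) <= step P j (inn a))%MS.
  by rewrite -pX submxMl.
have sA j a : (step P j (out a) *m A a <= step P j (inn a))%MS := preserves_subrep j pA a.
suff main j : (j <= L)%N -> forall l, (step P j l *m X l <= step P j l)%MS.
  move=> l j; apply: (oproj_sub (flag_oproj Pg _ _)).
  have [jL|jL] := leqP j L; first exact: main.
  have := flag_le Pg Pn l (ltnW jL); rewrite (flag_top cL Pg) mul1mx => ->.
  exact: submx1.
elim: j => [|j IH] jL l; first by rewrite (flag_bot cum0 Pg) mul0mx sub0mx.
suff desc d k : (k + d = L)%N -> (j < k)%N -> forall l, (step P j.+1 l *m X l <= step P k l)%MS.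
  by apply: (desc (L - j.+1)%N j.+1) => //; rewrite subnKC.
elim: d k => [|d IHd] k.
  by rewrite addn0 => -> _ l'; rewrite (flag_top cL Pg) submx1.
rewrite addnS -addSn => kd jk.
have {IHd} top := IHd k.+1 kd (leqW jk).
have kL : (k < L)%N by rewrite -kd leq_addr.
pose J := Ordinal jL; pose K := Ordinal kL.
pose W : subspaces R v := fun l => (step P k l + step P j.+1 l *m X l)%MS.
pose N : subspaces R v := fun l => (step P j.+1 l :&: kermx (in_factmod (step P k l) (X l)))%MS.
have Nin l' : (N l' *m X l' <= step P k l')%MS.
  rewrite -in_factmod_eq0; apply/eqP.
  have /sub_kermxP <- : (N l' <= kermx (in_factmod (step P k l') (X l')))%MS by exact: capmxSr.
  by rewrite /= mulmxA.
have jk' l' : (step P j.+1 l' <= step P k l')%MS by exact: flag_sub.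
have sW : subrep A W.
  move=> a; rewrite addsmxMr addsmx_sub; apply/andP; split.
    exact: submx_trans (sA k a) (addsmxSl _ _).
  have -> : step P j.+1 (out a) *m X (out a) *m A a = step P j.+1 (out a) *m A a *m X (inn a)
     - step P j.+1 (out a) *m (A a *m X (inn a) - X (out a) *m A a).
    by rewrite mulmxBr !mulmxA subKr.
  rewrite addmx_sub //; first exact: submx_trans (submxMr _ (sA _ a)) (addsmxSr _ _).
  rewrite eqmx_opp; apply: submx_trans (rho _ a) _.
  exact: submx_trans (jk' _) (addsmxSl _ _).
have sN : subrep A N.
  move=> a; rewrite sub_capmx; apply/andP; split.
    exact: submx_trans (submxMr _ (capmxSl _ _)) (sA _ a).
  apply/sub_kermxP; apply/eqP.
  have -> : N (out a) *m A a *m in_factmod (step P k (inn a)) (X (inn a)) =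
    in_factmod (step P k (inn a)) (N (out a) *m A a *m X (inn a)) by rewrite /= mulmxA.
  rewrite in_factmod_eq0.
  have -> : N (out a) *m A a *m X (inn a) = N (out a) *m X (out a) *m A a
     + N (out a) *m (A a *m X (inn a) - X (out a) *m A a).
    by rewrite mulmxBr !mulmxA addrC subrK.
  rewrite addmx_sub //; first exact: submx_trans (submxMr _ (Nin _)) (sA _ a).
  apply: submx_trans (submxMr _ (capmxSl _ _)) _.
  exact: submx_trans (rho _ a) (jk' _).
have UW l' : (step P k l' <= W l')%MS by exact: addsmxSl.
have UN l' : (step P j l' <= N l')%MS.
  rewrite sub_capmx (flag_sub Pg Pn) //=; apply/sub_kermxP; apply/eqP.
  have -> : step P j l' *m in_factmod (step P k l') (X l') =
    in_factmod (step P k l') (step P j l' *m X l') by rewrite /= mulmxA.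
  rewrite in_factmod_eq0; apply: submx_trans (IH (ltnW jL) l') _.
  by apply: flag_sub => //; exact: ltnW.
have dimWN l' : (dimv W l' + dimv N l' = cum k l' + cum j.+1 l')%N.
  have h1 := mxrank_in_factmod (step P k l') (step P j.+1 l' *m X l').
  have h2 := mxrank_mul_ker (step P j.+1 l') (in_factmod (step P k l') (X l')).
  rewrite -[in RHS](flag_rank Pg j.+1) -h2 addnA; congr addn.
  have e : step P j.+1 l' *m in_factmod (step P k l') (X l') =
    in_factmod (step P k l') (step P j.+1 l' *m X l') by exact: mulmxA.
  by rewrite e -(flag_rank Pg k l') addnC h1.
have degWN : deg (dimv W) + deg (dimv N) = deg (cum k) + deg (cum j.+1).
  by rewrite -!big_split; apply: eq_bigr => l' _; rewrite /= -!mulrDr -!natrD dimWN.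
have rkWN : rk (dimv W) + rk (dimv N) = rk (cum k) + rk (cum j.+1).
  by rewrite -!big_split; apply: eq_bigr => l' _; rewrite /= -!natrD dimWN.
have [hN _] := @HN_slope J N sN UN; have [hW _] := @HN_slope K W sW UW.
have m := @mu_decreasing J K jk.
have leW l' : (cum k l' <= dimv W l')%N by rewrite -(flag_rank Pg) mxrankS.
have rW : rk (dimv W) <= rk (cum k).
  move: degWN rkWN; rewrite (deg_cumS J) (rk_cumS J) => degWN rkWN.
  exact: slope_squeeze degWN rkWN hN hW m.
move=> l'; have eW := rk_eq leW rW l'.
have /eqmxP eU : (step P k l' == W l')%MS.
  by rewrite -mxrank_leqif_eq // (flag_rank Pg) -eW.
by rewrite eU addsmxSr.
Qed.
End HNflag.
End HN.

(** * Topology of the stratum *)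

(** The tube lemma: projection along a compact space is a closed map. *)
Lemma closed_cover (X Y : topologicalType) (K : set X) (Z : set (X * Y)) (y0 : Y) :
  compact K -> closed Z -> (forall x, K x -> ~ Z (x, y0)) ->
  \forall y \near y0, forall x, K x -> ~ Z (x, y).
Proof.
move=> /compact_near_coveringP cK cZ h.
apply: (cK Y (nbhs y0) (fun y x => ~ Z (x, y))) => x Kx.
have : nbhs (x, y0) (~` Z) by apply: open_nbhs_nbhs; split; [rewrite openC | exact: h].
by case=> -[U V] [/= Ux Vy] UV; exists (U, V) => // -[x' y'] /UV.
Qed.

(** A map into a compact set is continuous at y0 when a closed relation contains
    its graph and determines its value at y0. *)
Lemma continuous_closed_graph (X Y : topologicalType) (K : set X) (Z : set (X * Y))
    (f : Y -> X) (y0 : Y) :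
  compact K -> closed Z -> (forall y, K (f y)) -> (forall y, Z (f y, y)) ->
  (forall x, K x -> Z (x, y0) -> x = f y0) -> f y @[y --> y0] --> f y0.
Proof.
move=> cK cZ Kf Zf u W; rewrite {1}nbhsE => -[G [oG Gf] GW].
have cK' : compact (K `&` ~` G) by apply: compact_closedI => //; rewrite closedC.
have : \forall y \near y0, forall x, (K `&` ~` G) x -> ~ Z (x, y).
  apply: closed_cover => // x [Kx nG] /(u x Kx) e; apply: nG; rewrite e; exact: Gf.
move=> h; suff hG : \forall y \near y0, G (f y) by apply: filterS hG => y; exact: GW.
by apply: filterS h => y hy; apply: contrapT => nG; apply: (hy (f y)).
Qed.

Lemma closed_forall (X : topologicalType) (I : Type) (Z : I -> set X) :
  (forall i, closed (Z i)) -> closed [set x | forall i, Z i x].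
Proof.
move=> h; have -> : [set x | forall i, Z i x] = \bigcap_i Z i.
  by apply/seteqP; split=> x /= hx i; [move=> _|]; exact: hx.
by apply: closed_bigI => i _.
Qed.

Section StratumTopology.
Context {R : realType} {Q : quiver} (v : dim_vector Q) (alpha : Q -> CC R).
Local Notation C := (CC R).
Variables (L : nat) (vs : 'I_L -> dim_vector Q).
Hypothesis alpha_im : forall l, 'Re (alpha l) = 0.
Hypothesis type_ok : proper_type v vs.
Local Notation flags := (flagspace (R := R) v).
Local Notation S := (HN_stratum alpha (v := v) vs).

Definition invariant_flag (P : flags) (A : Rep R v) :=
  nested P /\ preserves P (s := @out Q) (t := @inn Q) A.

Definition flagged : set (Rep R v) := [set A | exists2 P, graded (cum vs) P & invariant_flag P A].

Lemma step_cont j l : continuous (fun P : flags => step P j l).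
Proof. exact: (@coord_product _ (fun jl : nat * Q => 'M[C]_(v jl.2)) (j, l)). Qed.

Lemma rep_cont (a : edge Q) : continuous (fun A : Rep R v => A a).
Proof. exact: (@coord_product _ (fun a => 'M[C]_(v (out a), v (inn a)))). Qed.

Lemma closed_invariant (X : topologicalType) (P : X -> flags) (A : X -> Rep R v) :
  continuous P -> continuous A -> closed [set x | invariant_flag (P x) (A x)].
Proof.
move=> cP cA.
have cs j l : continuous (fun x => step (P x) j l).
  by move=> x; exact: (@cvg_comp _ _ _ P (fun P => step P j l) _ _ _ (cP x) (@step_cont j l (P x))).
have ca a : continuous (fun x => A x a).
  by move=> x; exact: (@cvg_comp _ _ _ A (fun A => A a) _ _ _ (cA x) (@rep_cont a (A x))).
apply: closedI; apply: closed_forall => i; apply: closed_forall => j.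
  apply: closed_eq_mx => [x|]; last exact: cs.
  by apply: (cvg_mulmx (F := nbhs x)); exact: cs.
apply: closed_eq_mx => x; last by apply: (cvg_mulmx (F := nbhs x)); [exact: cs|exact: ca].
apply: (cvg_mulmx (F := nbhs x)); last exact: cs.
by apply: (cvg_mulmx (F := nbhs x)); [exact: cs|exact: ca].
Qed.

Lemma fst_cont (X Y : topologicalType) : continuous (@fst X Y).
Proof. by move=> p; exact: cvg_fst. Qed.

Lemma snd_cont (X Y : topologicalType) : continuous (@snd X Y).
Proof. by move=> p; exact: cvg_snd. Qed.

Lemma flagged_closed : closed flagged.
Proof.
rewrite -openC openE => A0 hA0.
have cZ : closed [set p : flags * Rep R v | invariant_flag p.1 p.2].
  by apply: closed_invariant; [exact: fst_cont|exact: snd_cont].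
have h := closed_cover (@graded_compact R _ v (cum vs)) cZ (y0 := A0).
have {}h := h (fun P gP iP => hA0 (ex_intro2 _ _ P gP iP)).
by apply: filterS h => A h [P gP iP]; exact: (h P gP iP).
Qed.

Lemma HN_stratum_flagged : S `<=` flagged.
Proof.
by move=> A /(HN_stratum_flag (v := v))[_ [P [gP nP pP _]]]; exists P.
Qed.

Lemma HN_flag_exists A : S A -> exists P, hnflag alpha vs A P.
Proof. by move=> /(HN_stratum_flag (v := v))[_]. Qed.

(** The value 0 outside of the stratum is a placeholder. *)
Definition flag_of (A : Rep R v) : flags :=
  match pselect (exists P, hnflag alpha vs A P) with
  | left h => projT1 (cid h) | right _ => fun=> 0 end.

Lemma flag_ofP A : S A -> hnflag alpha vs A (flag_of A).
Proof.
move=> /HN_flag_exists h; rewrite /flag_of; case: pselect => // h'.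
exact: projT2 (cid h').
Qed.

Lemma flag_of_unique A P : S A -> graded (cum vs) P -> invariant_flag P A -> P = flag_of A.
Proof. by move=> /flag_ofP h gP [nP pP]; exact: (HN_flag_unique alpha_im type_ok h). Qed.

(** The pairs (P, A) with P preserved by A form a closed set, which over the
    stratum is the graph. *)
Lemma flag_of_cont : continuous (fun s : S => flag_of (val s)).
Proof.
move=> s0; apply: (continuous_closed_graph (K := graded (cum vs))
  (Z := [set p : flags * S | invariant_flag p.1 (val p.2)])).
- exact: graded_compact.
- apply: closed_invariant; first exact: fst_cont.
  move=> p; apply: (@cvg_comp _ _ _ snd (fun s : S => val s)); first exact: cvg_snd.
  exact: initial_continuous.
- by move=> s; have [] := flag_ofP (set_mem (valP s)).
- by move=> s; have [_ n p _] := flag_ofP (set_mem (valP s)); split.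
- by move=> P gP iP; apply: flag_of_unique => //; exact: set_mem (valP s0).
Qed.

Definition subspace_space : topologicalType := prod_topology (fun l : Q => 'M[C]_(v l)).

(** A subspace of dimension vector w containing the step j would contradict the
    optimality of the piece j: a purely numerical condition. *)
Definition destabilizing (j : 'I_L) (w : dim_vector Q) :=
  (exists l, w l != cum vs j l) /\
  let d := fun l => (w l - cum vs j l)%N in
  ~ (slope alpha d <= slope alpha (vs j) /\
     (slope alpha d = slope alpha (vs j) -> (rank_of d <= rank_of (vs j))%N)).

Definition unwitnessed (j : 'I_L) (w : dim_vector Q) (A : Rep R v) : Prop :=
  forall (P : flags) (W : subspace_space), graded (cum vs) P ->
    (forall l, oproj (W l) /\ \rank (W l) = w l) -> invariant_flag P A ->
    (forall a, W (out a) *m A a *m W (inn a) = W (out a) *m A a) ->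
    (forall l, step P j l *m W l = step P j l) -> False.

(** Flags and subspaces W of given dimensions form a compact space, and all
    conditions on (P, W, A) are closed. At A0 the flag P is the
    Harder-Narasimhan one, and W is excluded by its optimality. *)
Lemma near_no_destabilizing A0 (j : 'I_L) (w : dim_vector Q) : S A0 -> destabilizing j w ->
  \forall A \near A0, unwitnessed j w A.
Proof.
move=> SA0 [nw bw].
pose K2 : set subspace_space := [set W | forall l, oproj (W l) /\ \rank (W l) = w l].
have cK2 : compact K2.
  apply: (@tychonoff _ (fun l : Q => 'M[C]_(v l)) (fun l => [set P | oproj P /\ \rank P = w l])).
  by move=> l; exact: compact_oproj.
pose FWA : topologicalType := ((flags * subspace_space) * Rep R v)%type.
pose Z : set FWA := [set p : FWA | invariant_flag p.1.1 p.2] `&`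
  ([set p : FWA | forall a, p.1.2 (out a) *m p.2 a *m p.1.2 (inn a) = p.1.2 (out a) *m p.2 a] `&`
   [set p : FWA | forall l, step p.1.1 j l *m p.1.2 l = step p.1.1 j l]).
have c1 (p : FWA) : x.1.1 @[x --> p] --> p.1.1.
  exact: (cvg_comp _ _ cvg_fst cvg_fst).
have c2 l (p : FWA) : x.1.2 l @[x --> p] --> p.1.2 l.
  apply: (@cvg_comp _ _ _ (fun x => x.1.2) (fun W : subspace_space => W l)).
    exact: (cvg_comp _ _ cvg_fst cvg_snd).
  exact: (@coord_product _ (fun l : Q => 'M[C]_(v l))).
have c3 a (p : FWA) : x.2 a @[x --> p] --> p.2 a.
  by apply: (@cvg_comp _ _ _ snd (fun A : Rep R v => A a)); [exact: cvg_snd|exact: rep_cont].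
have c4 l (p : FWA) : step x.1.1 j l @[x --> p] --> step p.1.1 j l.
  by apply: (@cvg_comp _ _ _ (fun x => x.1.1) (fun P => step P j l)); [exact: c1|exact: step_cont].
have cZ : closed Z.
  apply: closedI; first by apply: closed_invariant; [exact: c1|exact: snd_cont].
  apply: closedI; apply: closed_forall => a; apply: closed_eq_mx => p.
  - apply: (cvg_mulmx (F := nbhs p)); last exact: c2.
    by apply: (cvg_mulmx (F := nbhs p)); [exact: c2|exact: c3].
  - by apply: (cvg_mulmx (F := nbhs p)); [exact: c2|exact: c3].
  - by apply: (cvg_mulmx (F := nbhs p)); [exact: c4|exact: c2].
  - exact: c4.
have h := closed_cover (compact_setX (@graded_compact _ _ v (cum vs)) cK2) cZ (y0 := A0).
have {}h : \forall y \near A0, forall x, (graded (cum vs) `*` K2) x -> ~ Z (x, y).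
  apply: h => -[P W] [/= gP kW] [/= iP [sW PW]].
  have eP := flag_of_unique SA0 gP iP; have [_ _ _ opt] := flag_ofP SA0.
  have sub l : (step (flag_of A0) j l <= W l)%MS by rewrite -eP -(PW l) submxMl.
  have dP : dimv (fun l => step (flag_of A0) j l) = cum vs j.
    by apply/funext => l; rewrite -eP; exact: (flag_rank gP).
  have dW : dimv W = w by apply/funext => l; exact: (proj2 (kW l)).
  apply: bw; have := opt j W; rewrite dP dW; apply => //.
  by move=> a; rewrite -(sW a) submxMl.
by apply: filterS h => A h P W gP kW iP sW PW; exact: (h (P, W) (conj gP kW) (conj iP (conj sW PW))).
Qed.

(** There are finitely many dimension vectors w, so [near_no_destabilizing]
    applies to all of them in a common neighbourhood. *)
Lemma near_flagged_stratum A0 : S A0 -> \forall A \near A0, flagged A -> S A.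
Proof.
move=> SA0; pose B := (\sum_l v l)%N.
have hn : \forall A \near A0, forall (j : 'I_L) (w : {ffun Q -> 'I_B.+1}),
    destabilizing j (fun l => w l) -> unwitnessed j (fun l => w l) A.
  apply: (@filter_forall _ _ (fun j A => forall w : {ffun Q -> 'I_B.+1},
    destabilizing j (fun l => w l) -> unwitnessed j (fun l => w l) A) _ (nbhs_filter A0)) => j.
  apply: (@filter_forall _ _ (fun (w : {ffun Q -> 'I_B.+1}) A =>
    destabilizing j (fun l => w l) -> unwitnessed j (fun l => w l) A) _ (nbhs_filter A0)) => w.
  have [d|nd] := pselect (destabilizing j (fun l => w l)).
    by apply: filterS (near_no_destabilizing SA0 d).
  by apply: nearW.
apply: filterS hn => A h [P gP iP]; apply: (flag_HN_stratum type_ok (P := P)).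
case: (iP) => nP pP; split=> // j W sW UW nW /=.
pose W' : subspace_space := fun l => projT1 (cid (oproj_exists (W l))).
have oW l : oproj (W' l) by have [] := projT2 (cid (oproj_exists (W l))).
have eW l : (W' l :=: W l)%MS by have [] := projT2 (cid (oproj_exists (W l))).
have wB l : (\rank (W l) < B.+1)%N.
  by rewrite ltnS (leq_trans (rank_leq_row _)) // /B (bigD1 l) //= leq_addr.
pose w : {ffun Q -> 'I_B.+1} := [ffun l => Ordinal (wB l)].
have ew : (fun l => w l : nat) = dimv W by apply/funext => l; rewrite ffunE.
have dP : dimv (fun l => step P j l) = cum vs j by apply/funext => l; exact: (flag_rank gP).
apply: contrapT; rewrite dP => nb; apply: (h j w _ P W' gP) => //.
- by rewrite ew; split=> //; rewrite -dP.
- by move=> l; split; [exact: oW | rewrite ffunE /= eW].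
- by move=> a; apply: (oproj_sub (oW _)); rewrite (eqmxMr _ (eW _)) eW; exact: sW.
- by move=> l; apply: (oproj_sub (oW _)); rewrite eW.
Qed.

End StratumTopology.

(** * The normal space of the stratum *)

Lemma rank_hadj (R : realType) m n (M : 'M[CC R]_(m, n)) : \rank (hadj M) = \rank M.
Proof. by rewrite /hadj mxrank_tr mxrank_map. Qed.

Lemma eq_ker_rank (K : fieldType) m n p (M : 'M[K]_(m, n)) (M' : 'M[K]_(m, p)) :
  (forall u : 'rV_m, u *m M = 0 <-> u *m M' = 0) -> \rank M = \rank M'.
Proof.
move=> h; have e : (kermx M :=: kermx M')%MS.
  by apply/eqmxP/andP; split; apply/rV_subP => u /sub_kermxP /h /sub_kermxP.
have := mxrank_ker M; rewrite e mxrank_ker => /eqP.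
by rewrite eqn_sub2lE ?rank_leq_row // => /eqP.
Qed.

Lemma idem_compl_rank (R : realType) n (E : 'M[CC R]_n) : E *m E = E ->
  (\rank (1%:M - E)%R + \rank E = n)%N.
Proof.
move=> EE; apply/eqP; rewrite -(eqr_nat (CC R)) natrD -!tr_idem //.
  by rewrite linearB /= mxtrace1 subrK.
by rewrite mulmxBr mulmx1 mulmxBl mul1mx EE subrr subr0.
Qed.

(** Z is the partial inverse of M composed with M'. *)
Lemma ker_factor (K : fieldType) m n p (M : 'M[K]_(m, n)) (M' : 'M[K]_(m, p)) :
  (forall u : 'rV_m, u *m M = 0 -> u *m M' = 0) -> exists Z, M' = M *m Z.
Proof.
move=> h; exists (pinvmx M *m M'); rewrite mulmxA.
have e : (1%:M - M *m pinvmx M) *m M = 0.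
  by rewrite mulmxBl mul1mx mulmxKpV // subrr.
have : (1%:M - M *m pinvmx M) *m M' = 0.
  by apply/row_matrixP => i; rewrite row_mul row0 h // -row_mul e row0.
by rewrite mulmxBl mul1mx => /eqP; rewrite subr_eq0 => /eqP.
Qed.

Section FirstVariation.
Context {R : realType} {N : nat}.
Local Notation C := (CC R).

Lemma rdot_le (u w : 'rV[C]_N) : `|rdot u w| <= enorm u * enorm w.
Proof.
rewrite ler_norml cauchy_schwarz andbT lerNl -rdotNl -(enormN u).
exact: cauchy_schwarz.
Qed.

Lemma cvg_rdot (T : Type) (F : set_system T) (FF : Filter F) (u V0 : 'rV[C]_N)
    (V : T -> 'rV[C]_N) :
  V t @[t --> F] --> V0 -> rdot u (V t) @[t --> F] --> rdot u V0.
Proof.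
move=> hV; apply/cvgrPdist_lt => e e0.
have k0 : 0 < enorm u + 1 by rewrite ltr_wpDl // enorm_ge0.
have : enorm (V0 - V t) @[t --> F] --> enorm (V0 - V0).
  by apply: cvg_enorm; apply: cvgB => //; move=> W; exact: cvg_cst.
rewrite subrr enorm0 => /cvgrPdist_lt /(_ (e / (enorm u + 1))).
rewrite divr_gt0 // => /(_ isT); apply: filterS => t.
rewrite sub0r normrN ger0_norm ?enorm_ge0 // ltr_pdivlMr // => ht.
rewrite -rdotNr -rdotDr; apply: le_lt_trans (rdot_le _ _) _.
apply: le_lt_trans ht; rewrite mulrC ler_wpM2l ?enorm_ge0 //.
by rewrite lerDl.
Qed.

(** |u|^2 <= |u - t V|^2 expands to 2 <u, V> <= t |V|^2; let t tend to 0. *)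
Lemma first_variation (u V0 : 'rV[C]_N) (V : R -> 'rV[C]_N) :
  V t @[t --> 0^'+] --> V0 ->
  (\forall t \near 0^'+, enorm u <= enorm (u - t%:C%C *: V t)) -> rdot u V0 <= 0.
Proof.
move=> hV hu.
have h1 : rdot u (V t) @[t --> 0^'+] --> rdot u V0 by exact: cvg_rdot.
have h2 : t / 2 * (enorm (V t) * enorm (V t)) @[t --> 0^'+] --> (0 : R) / 2 * (enorm V0 * enorm V0).
  apply: cvgM; last by apply: cvgM; exact: cvg_enorm.
  apply: cvgM; last by move=> W; exact: cvg_cst.
  exact: cvg_within.
rewrite !mul0r in h2; apply: (ler_cvg_to h1 h2).
have pos : \forall t \near (0 : R)^'+, 0 < t by exact: nbhs_right_gt.
near=> t.
have t0 : 0 < t by near: t.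
have : enorm u <= enorm (u - t%:C%C *: V t) by near: t.
rewrite -(@ler_pXn2r _ 2) ?nnegrE ?enorm_ge0 // !enorm_sqr.
rewrite rdotDl !rdotDr !rdotNl !rdotNr !rdotZl !rdotZr (rdotC (V t) u) -expr2 enorm_sqr.
set a := rdot u u; set b := rdot u (V t); set d := rdot (V t) (V t) => h.
move: a b d h => a b d h; clear - h t0.
have : 0 <= t * (t * d - 2 * b) by lra.
by rewrite pmulr_rge0 //; lra.
Unshelve. all: by end_near. Qed.

End FirstVariation.

Section NormalSpace.
Context {R : realType} {Q : quiver} (v : dim_vector Q) (alpha : Q -> CC R).
Local Notation C := (CC R).
Variables (L : nat) (vs : 'I_L -> dim_vector Q).
Hypothesis alpha_im : forall l, 'Re (alpha l) = 0.
Hypothesis type_ok : proper_type v vs.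
Local Notation flags := (flagspace (R := R) v).
Local Notation S := (HN_stratum alpha (v := v) vs).
Local Notation gauge := (fam R (fun l : Q => v l) (fun l : Q => v l)).
Local Notation gdim := (@fdim Q (fun l : Q => v l) (fun l : Q => v l)).
Local Notation rdim := (@fdim (edge Q) (fun a => v (out a)) (fun a => v (inn a))).
Let cL : forall l, cum vs L l = v l. Proof. by case: type_ok. Qed.
Let c0 := cum0 vs.

Definition vrep (A : Rep R v) : 'rV[C]_rdim := vecf A.

(** The velocity at A of the action of the gauge group. *)
Definition infinitesimal (A : Rep R v) (X : gauge) : Rep R v :=
  fun a => A a *m X (inn a) - X (out a) *m A a.

Lemma infinitesimal_linear A : fam_linear (infinitesimal A).
Proof.
move=> a X Y; apply: functional_extensionality_dep => e; rewrite /infinitesimal.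
by rewrite mulmxDr mulmxDl -scalemxAr -scalemxAl opprD addrACA scalerBr.
Qed.

Definition actmx A : 'M[C]_(gdim, rdim) := fmx (infinitesimal A).

Definition lowR (P : flags) : 'M[C]_rdim :=
  fmx (lower L P (s := @out Q) (t := @inn Q)).
Definition lowG (P : flags) : 'M[C]_gdim := fmx (lower L P (s := id) (t := id)).

Definition normal_eqs (A : Rep R v) (P : flags) := row_mx (1%:M - lowR P) (hadj (actmx A)).
(** The projector onto the lower triangular families orthogonal to the orbit,
    where lower triangular means fixed by the projector [lowR]. *)
Definition normal_proj (A : Rep R v) : 'M[C]_rdim :=
  projT1 (cid (oproj_exists (kermx (normal_eqs A (flag_of alpha vs A))))).

Lemma normal_proj_oproj A : oproj (normal_proj A).
Proof. by have [] := projT2 (cid (oproj_exists (kermx (normal_eqs A (flag_of alpha vs A))))). Qed.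

Lemma normal_projP A m (B : 'M[C]_(m, rdim)) : B *m normal_proj A = B <->
  B *m lowR (flag_of alpha vs A) = B /\ B *m hadj (actmx A) = 0.
Proof.
have e : (normal_proj A :=: kermx (normal_eqs A (flag_of alpha vs A)))%MS.
  by have [] := projT2 (cid (oproj_exists (kermx (normal_eqs A (flag_of alpha vs A))))).
rewrite (oproj_subP _ (normal_proj_oproj A)) e.
have h : (B <= kermx (normal_eqs A (flag_of alpha vs A)))%MS <->
   B *m normal_eqs A (flag_of alpha vs A) = 0 by split=> /sub_kermxP.
rewrite h /normal_eqs mul_mx_row; split.
  move=> /eqP; rewrite row_mx_eq0 mulmxBr mulmx1 subr_eq0 => /andP[/eqP h1 /eqP h2].
  by rewrite -h1.
by move=> [h1 h2]; apply/eqP; rewrite row_mx_eq0 mulmxBr mulmx1 h1 subrr h2 !eqxx.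
Qed.

Section AtPoint.
Variables (A : Rep R v) (SA : S A).
Local Notation P := (flag_of alpha vs A).
Let Pg : graded (cum vs) P. Proof. by case: (flag_ofP SA). Qed.
Let Pn : nested P. Proof. by case: (flag_ofP SA). Qed.
Let pA : preserves P (s := @out Q) (t := @inn Q) A. Proof. by case: (flag_ofP SA). Qed.

Lemma infinitesimal_preserves (X : gauge) : preserves P (s := id) (t := id) X ->
  preserves P (s := @out Q) (t := @inn Q) (infinitesimal A X).
Proof.
move=> pX a j; rewrite /infinitesimal mulmxBr mulmxBl; congr (_ - _).
  rewrite !mulmxA -(pA a j) -!mulmxA; congr (_ *m (_ *m _)).
  by rewrite mulmxA (pX (inn a) j).
rewrite !mulmxA -(pX (out a) j) -!mulmxA; congr (_ *m (_ *m _)).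
by rewrite mulmxA (pA a j).
Qed.

(** Modulo the representations preserving P, the infinitesimal action kills
    exactly the gauge elements preserving P. *)
Lemma kernel_act (u : 'rV[C]_gdim) : u *m (actmx A *m lowR P) = 0 <-> u *m lowG P = 0.
Proof.
rewrite -[u]unvecfK; move: (unvecf u) => X {u}.
rewrite mulmxA fmxE; last exact: infinitesimal_linear.
rewrite (lowermx_eq0 c0 cL Pg Pn) (lowermx_eq0 c0 cL Pg Pn).
split; last exact: infinitesimal_preserves.
exact: (HN_hom_preserves alpha_im type_ok (flag_ofP SA)).
Qed.

Lemma lowR_oproj : oproj (lowR P).
Proof. exact: (lowermx_oproj c0 cL Pg Pn). Qed.

(** The normal space is the orthogonal complement of the sum of the kernel of
    [lowR] and of the orbit. Modulo this kernel the orbit may be replaced by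
    its lower triangular part; the sum is then direct, and the orbit
    contributes the rank of [lowG] by [kernel_act]. *)
Lemma normal_rank : (\rank (normal_proj A) + \rank (lowG P) = \rank (lowR P))%N.
Proof.
have [EE hE] := lowR_oproj.
have e : (normal_proj A :=: kermx (normal_eqs A P))%MS.
  by have [] := projT2 (cid (oproj_exists (kermx (normal_eqs A P)))).
have r1 : \rank (normal_eqs A P) = \rank (1%:M - lowR P + actmx A)%MS.
  rewrite addsmxE -[LHS]rank_hadj; congr mxrank.
  by rewrite /hadj /normal_eqs map_row_mx tr_row_mx -!/(hadj _) hadjK hadjB hadj1 hE.
have r2 : (1%:M - lowR P + actmx A :=: 1%:M - lowR P + actmx A *m lowR P)%MS.
  apply/eqmxP/andP; split; rewrite addsmx_sub addsmxSl /=.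
    rewrite -{1}[actmx A](subrK (actmx A *m lowR P)) addmx_sub ?addsmxSr //.
    by rewrite -{1}[actmx A]mulmx1 -mulmxBr (submx_trans (submxMl _ _)) // addsmxSl.
  rewrite -[actmx A *m _](subrK (actmx A)) addmx_sub ?addsmxSr //.
  have -> : actmx A *m lowR P - actmx A = - (actmx A *m (1%:M - lowR P)).
    by rewrite mulmxBr mulmx1 opprB.
  by rewrite eqmx_opp (submx_trans (submxMl _ _)) // addsmxSl.
have disj : ((1%:M - lowR P) :&: (actmx A *m lowR P) = 0)%MS.
  apply/eqP; rewrite -submx0; apply/rV_subP => u; rewrite sub_capmx.
  move=> /andP[/submxP[x ux] /submxP[y uy]].
  have u1 : u *m lowR P = 0 by rewrite ux -mulmxA mulmxBl mul1mx EE subrr mulmx0.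
  have u2 : u *m lowR P = u by rewrite uy -!mulmxA EE.
  by rewrite -u2 u1 sub0mx.
have r3 := mxrank_disjoint_sum disj.
have r4 : \rank (actmx A *m lowR P) = \rank (lowG P) by apply: eq_ker_rank; exact: kernel_act.
have r5 := idem_compl_rank EE.
rewrite e mxrank_ker r1 r2 r3 r4.
have le : (\rank (lowG P) <= \rank (lowR P))%N by rewrite -r4 mxrankM_maxr.
have arith a b x n : (a + x = n -> b <= x -> n - (a + b) + b = x)%N.
  by move=> <- bx; rewrite subnDl subnK.
exact: arith r5 le.
Qed.

End AtPoint.

(** The dimension of the strictly lower triangular families: the piece j is
    mapped to the complement of the step j + 1. *)
Definition hom_dim (I : finType) (s t : I -> Q) : nat :=
  (\sum_(i : I) \sum_(j < L) (cum vs j.+1 (s i) - cum vs j (s i)) *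
     (v (t i) - cum vs j.+1 (t i)))%N.

Definition normal_dim : nat :=
  (hom_dim (@out Q) (@inn Q) - hom_dim (fun l : Q => l) (fun l : Q => l))%N.

Lemma low_rank A : S A ->
  \rank (lowR (flag_of alpha vs A)) = hom_dim (@out Q) (@inn Q) /\
  \rank (lowG (flag_of alpha vs A)) = hom_dim (fun l : Q => l) (fun l : Q => l).
Proof.
move=> SA; have [Pg Pn _ _] := flag_ofP SA.
have m := @cum_max _ v _ vs type_ok; have n := cum_le vs.
by split; [exact: (lowermx_rank c0 cL Pg Pn)|exact: (lowermx_rank (I := Q) c0 cL Pg Pn)].
Qed.

Lemma normal_projrank A : S A -> \rank (normal_proj A) = normal_dim.
Proof.
move=> SA; have [h1 h2] := low_rank SA; have := normal_rank SA.
by rewrite h1 h2 /normal_dim => <-; rewrite addnK.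
Qed.

Lemma normal_dimE A : S A ->
  (normal_dim + hom_dim (fun l : Q => l) (fun l : Q => l) = hom_dim (@out Q) (@inn Q))%N.
Proof.
move=> SA; have [h1 h2] := low_rank SA.
by rewrite -(normal_projrank SA) -h1 -h2; exact: normal_rank.
Qed.

Section Limits.
Context {T : Type} {F : set_system T} {FF : Filter F}.
Variables (P : T -> flags) (P0 : flags) (A : T -> Rep R v) (A0 : Rep R v).
Hypotheses (hP : forall jl, P z jl @[z --> F] --> P0 jl)
  (hA : forall a, A z a @[z --> F] --> A0 a).

Lemma cvg_lowR : lowR (P z) @[z --> F] --> lowR P0.
Proof.
apply: cvg_fmx => X a.
have cX b : (fun=> X b) z @[z --> F] --> X b by move=> W; exact: cvg_cst.
exact: (cvg_lower FF hP cX).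
Qed.

Lemma cvg_infinitesimal (X : T -> gauge) (X0 : gauge) :
  (forall l, X z l @[z --> F] --> X0 l) ->
  forall a, infinitesimal (A z) (X z) a @[z --> F] --> infinitesimal A0 X0 a.
Proof. by move=> hX a; apply: cvgB; apply: cvg_mulmx; [exact: hA|exact: hX|exact: hX|exact: hA]. Qed.

Lemma cvg_actmx : actmx (A z) @[z --> F] --> actmx A0.
Proof.
apply: cvg_fmx => X a; apply: cvg_infinitesimal => l W; exact: cvg_cst.
Qed.

Lemma cvg_vrep : vrep (A z) @[z --> F] --> vrep A0.
Proof.
apply: cvg_mx => i k; rewrite mxE; under eq_cvg do rewrite mxE; by apply: cvg_entry; exact: hA.
Qed.
End Limits.

Lemma val_rep_cvg (s0 : S) a : val s a @[s --> s0] --> val s0 a.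
Proof.
apply: (@cvg_comp _ _ _ (fun s : S => val s) (fun A : Rep R v => A a) _ _ _ _ (@rep_cont _ _ v a (val s0))).
exact: (@initial_continuous _ _ _ s0).
Qed.

Lemma flag_cvg (s0 : S) jl : flag_of alpha vs (val s) jl @[s --> s0] -->
  flag_of alpha vs (val s0) jl.
Proof.
apply: (@cvg_comp _ _ _ (fun s : S => flag_of alpha vs (val s)) (fun P : flags => P jl)).
  exact: (flag_of_cont alpha_im type_ok).
exact: (@coord_product _ (fun jl : nat * Q => 'M[C]_(v jl.2)) jl).
Qed.

(** Closed graph again: the rank is constant, so a limit of normal projectors
    that satisfies the equations of the normal space is the normal
    projector. *)
Lemma normal_proj_cont : continuous (fun s : S => normal_proj (val s)).
Proof.
move=> s0.
pose Z : set ('M[C]_rdim * S) :=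
  [set p : 'M[C]_rdim * S | p.1 *m lowR (flag_of alpha vs (val p.2)) = p.1] `&`
  [set p : 'M[C]_rdim * S | p.1 *m hadj (actmx (val p.2)) = 0].
have c1 (p : 'M[C]_rdim * S) : x.1 @[x --> p] --> p.1 by exact: cvg_fst.
have c2 (p : 'M[C]_rdim * S) : x.2 @[x --> p] --> p.2 by exact: cvg_snd.
apply: (continuous_closed_graph (Z := Z) (compact_oproj (n := rdim) (r := normal_dim))).
- apply: closedI; apply: closed_eq_mx => p.
  + apply: (cvg_mulmx (F := nbhs p)); first exact: c1.
    apply: (cvg_lowR (F := nbhs p)) => jl.
    have h := @cvg_comp _ _ _ snd (fun s : S => flag_of alpha vs (val s) jl) _ _ _ (c2 p) (@flag_cvg p.2 jl).
    exact: h.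
  + by rewrite /continuous_at; exact: c1.
  + apply: (cvg_mulmx (F := nbhs p)); first exact: c1.
    apply: (cvg_hadj (F := nbhs p)); apply: (cvg_actmx (F := nbhs p)) => a.
    have h := @cvg_comp _ _ _ snd (fun s : S => val s a) _ _ _ (c2 p) (@val_rep_cvg p.2 a).
    exact: h.
  + by move=> W; exact: cvg_cst.
- move=> s; split; first exact: normal_proj_oproj.
  exact: normal_projrank (set_mem (valP s)).
- move=> s; apply/normal_projP.
  by have [] := normal_proj_oproj (val s).
- move=> B [oB rB] /normal_projP nB; rewrite /= in nB.
  apply: oproj_rank_inj => //; first exact: normal_proj_oproj.
    by rewrite -nB submxMl.
  by rewrite (normal_projrank (set_mem (valP s0))).
Qed.

(** Conjugation by g carries the flag P to the projectors onto the images of its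
    steps by g. *)
Lemma flagged_conj (A A' : Rep R v) (P : flags) (g : gauge) :
  graded (cum vs) P -> invariant_flag P A -> (forall l, g l \in unitmx) ->
  (forall a, A a *m g (inn a) = g (out a) *m A' a) -> flagged vs A'.
Proof.
move=> Pg [Pn pA] gu e.
pose P' : flags := fun jl => projT1 (cid (oproj_exists (step P jl.1 jl.2 *m g jl.2))).
have oP j l : oproj (step P' j l) by have [] := projT2 (cid (oproj_exists (step P j l *m g l))).
have eP j l : (step P' j l :=: step P j l *m g l)%MS.
  by have [] := projT2 (cid (oproj_exists (step P j l *m g l))).
exists P'; last split.
- move=> [j l]; split; first exact: oP.
  rewrite -[P' _]/(step P' j l) eP mxrankMfree ?row_free_unit ?gu //.
  exact: flag_rank.
- move=> j l; apply: (oproj_sub (oP _ _)); rewrite !eP submxMr //.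
  by rewrite -(Pn j l) submxMl.
- move=> a j; apply: (oproj_sub (oP _ _)).
  rewrite (eqmxMr _ (eP _ _)) eP -mulmxA -e mulmxA submxMr //.
  by rewrite -(pA a j) submxMl.
Qed.

End NormalSpace.

(** * Nearest points of the stratum *)

Lemma cvg_perturb (R : realType) m n (M N0 : 'M[CC R]_(m, n)) (f : R -> 'M[CC R]_(m, n)) :
  f t @[t --> 0^'+] --> N0 -> (M + t%:C%C *: f t) @[t --> 0^'+] --> M.
Proof.
move=> h; have : (M + t%:C%C *: f t) @[t --> 0^'+] --> M + (0 : R)%:C%C *: N0.
  apply: cvgD; first by move=> W; exact: cvg_cst.
  apply: cvgZ; last exact: h.
  by apply: cvg_real; exact: cvg_within.
by rewrite rmorph0 scale0r addr0.
Qed.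

Lemma orbit_identity (K : fieldType) m n (A : 'M[K]_(m, n)) X Y t :
  1%:M - t *: Y \in unitmx ->
  (1%:M - t *: X) *m A =
  (A + t *: ((A *m Y - X *m A) *m invmx (1%:M - t *: Y))) *m (1%:M - t *: Y).
Proof.
move=> u; rewrite [RHS]mulmxDl -scalemxAl mulmxKV //.
rewrite mulmxBl mul1mx mulmxBr mulmx1 -scalemxAl -scalemxAr scalerBr.
by rewrite addrA subrK.
Qed.

Lemma conj_identity (K : fieldType) m n (A B : 'M[K]_(m, n)) g h :
  g \in unitmx -> h \in unitmx -> g *m A = B *m h -> A *m invmx h = invmx g *m B.
Proof. by move=> gu hu e; rewrite -[B](mulmxK hu) -e !mulmxA mulVmx // mul1mx. Qed.

Section Variations.
Context {R : realType} {Q : quiver} (v : dim_vector Q) (alpha : Q -> CC R).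
Local Notation C := (CC R).
Variables (L : nat) (vs : 'I_L -> dim_vector Q).
Hypothesis alpha_im : forall l, 'Re (alpha l) = 0.
Hypothesis type_ok : proper_type v vs.
Local Notation flags := (flagspace (R := R) v).
Local Notation S := (HN_stratum alpha (v := v) vs).
Local Notation gauge := (fam R (fun l : Q => v l) (fun l : Q => v l)).
Local Notation gdim := (@fdim Q (fun l : Q => v l) (fun l : Q => v l)).
Local Notation rdim := (@fdim (edge Q) (fun a => v (out a)) (fun a => v (inn a))).
Let cL : forall l, cum vs L l = v l. Proof. by case: type_ok. Qed.
Let c0 := cum0 vs.

Section Critical.
Variables (A : Rep R v) (D : 'rV[C]_rdim) (SA : S A).
Hypothesis minA : forall A' : Rep R v, S A' -> enorm (D - vrep A) <= enorm (D - vrep A').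
Local Notation P := (flag_of alpha vs A).
Local Notation u := (D - vrep A).
Let Pg : graded (cum vs) P. Proof. by case: (flag_ofP SA). Qed.
Let Pn : nested P. Proof. by case: (flag_ofP SA). Qed.
Let pA : preserves P (s := @out Q) (t := @inn Q) A. Proof. by case: (flag_ofP SA). Qed.

(** A curve A + t V(t) in T stays in S for small t, as S is relatively open. *)
Lemma curve_variation (V : R -> Rep R v) (V0 : Rep R v) :
  (forall a, V t a @[t --> 0^'+] --> V0 a) ->
  (\forall t \near 0^'+, flagged vs (fun a => A a + t%:C%C *: V t a)) ->
  rdot u (vrep V0) <= 0.
Proof.
move=> hV hf; pose At (t : R) : Rep R v := fun a => A a + t%:C%C *: V t a.
have At_cvg : At t @[t --> 0^'+] --> A.
  by apply: cvg_product => a; exact: cvg_perturb (hV a).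
have St : \forall t \near 0^'+, S (At t).
  have := At_cvg _ (near_flagged_stratum alpha_im type_ok SA).
  by apply: filterS2 hf => t h1 h2; exact: h2.
apply: (first_variation (V := fun t => vrep (V t))); first exact: cvg_vrep.
apply: filterS St => t /minA; rewrite /vrep.
rewrite (vecfD A (fun a => t%:C%C *: V t a)) vecfZ opprD addrA; exact.
Qed.

Lemma tangent_flag (Y : Rep R v) : preserves P (s := @out Q) (t := @inn Q) Y ->
  rdot u (vrep Y) <= 0.
Proof.
move=> pY; apply: (curve_variation (V := fun=> Y)).
  by move=> a W; exact: cvg_cst.
apply: nearW => t; exists P => //; split => // a j.
rewrite mulmxDr mulmxDl pA; congr (_ + _).
by rewrite -scalemxAr -scalemxAl pY.
Qed.

(** Conjugating A by 1 - t X gives the curve A + t V(t) with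
    V(t) = (A X - X A)(1 - t X)^-1. *)
Lemma tangent_orbit (X : gauge) : rdot u (vrep (infinitesimal A X)) <= 0.
Proof.
pose g (t : R) : gauge := fun l => 1%:M - t%:C%C *: X l.
have gcvg l : g t l @[t --> 0^'+] --> (1%:M : 'M[C]_(v l)).
  have := @cvg_perturb R _ _ 1%:M (- X l) (fun=> - X l).
  have e : (fun t : R => 1%:M + t%:C%C *: - X l) = g^~ l.
    by apply/funext => t; rewrite /g scalerN.
  by rewrite e; apply; move=> W; exact: cvg_cst.
have gu : \forall t \near (0 : R)^'+, forall l, g t l \in unitmx.
  by apply: filter_forall => l; apply: near_unitmx (gcvg l) _; exact: unitmx1.
apply: (curve_variation (V := fun t a => infinitesimal A X a *m invmx (g t (inn a)))).
  move=> a; rewrite -[X in _ --> X]mulmx1; apply: cvg_mulmx.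
    by move=> W; exact: cvg_cst.
  rewrite -[X in _ --> X]invmx1; apply: cvg_invmx; [exact: gcvg|exact: unitmx1].
apply: filterS gu => t gu.
apply: (flagged_conj Pg (conj Pn pA) (g := fun l => invmx (g t l))).
  by move=> l; rewrite unitmx_inv.
move=> a; set B := _ + _.
have E : g t (out a) *m A a = B *m g t (inn a).
  exact: orbit_identity (gu (inn a)).
exact: conj_identity (gu _) (gu _) E.
Qed.

(** u = D - A has nonpositive product with every flag-preserving Y. The family
    w = u - lowR u is one of them and <u, w> = |w|^2, so w = 0. The same
    argument in the orbit direction given by the adjoint of u shows that u is
    orthogonal to the orbit. *)
Lemma critical_normal : u *m normal_proj alpha vs A = u.
Proof.
have [EE hE] := lowR_oproj type_ok SA.
apply/normal_projP; split.
  apply/eqP; rewrite eq_sym -subr_eq0; apply/eqP/rdot_eq0/le_anti.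
  rewrite rdot_ge0 andbT; set w := _ - _.
  have wE : w *m lowR L P = 0 by rewrite /w mulmxBl -mulmxA EE subrr.
  have -> : rdot w w = rdot u w.
    have -> : rdot u w = rdot w w + rdot (u *m lowR L P) w by rewrite -rdotDl /w subrK.
    rewrite [X in _ + X](_ : _ = 0) ?addr0 //.
    by rewrite rdotC rdot_adj hE wE rdot_row0 // mul0mx.
  rewrite -[w]unvecfK; apply: tangent_flag; apply/(lowermx_eq0 c0 cL Pg Pn).
  by rewrite unvecfK.
apply: rdot_eq0; apply/le_anti; rewrite rdot_ge0 andbT.
set w := u *m hadj _.
have -> : rdot w w = rdot u (w *m actmx A) by rewrite rdot_adj.
rewrite -[w]unvecfK fmxE; last exact: infinitesimal_linear.
exact: tangent_orbit.
Qed.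
End Critical.

(** * Carrying one flag to another *)

(** The overlap sum_j gr_j gr'_j carries each step of P into the step of P'. It
    is divided by its upper triangular part b, which preserves P: the result,
    [carrier], still carries P to P', and in addition its difference h - 1 to
    the identity satisfies that b (h - 1) is strictly lower triangular. This
    normalisation makes h - 1 controllable, since the representations only
    detect gauge elements modulo those preserving P. *)
Section Transport.
Variables (P P' : flags) (A A' : Rep R v).
Hypotheses (Pg : graded (cum vs) P) (Pn : nested P)
  (pA : preserves P (s := @out Q) (t := @inn Q) A)
  (Pg' : graded (cum vs) P') (Pn' : nested P')
  (pA' : preserves P' (s := @out Q) (t := @inn Q) A').

Definition overlap (P P' : flags) : gauge := fun l => \sum_(j < L) gr P j l *m gr P' j l.
Definition overlap_up (P P' : flags) : gauge :=
  fun l => overlap P P' l - lower L P (s := id) (t := id) (overlap P P') l.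
Definition carrier (P P' : flags) : gauge :=
  fun l => invmx (overlap_up P P' l) *m overlap P P' l.
Definition displacement (P P' : flags) : gauge := fun l => carrier P P' l - 1%:M.
(** A' transported by the carrier, to a representation preserving P. *)
Definition pullback (P P' : flags) (A' : Rep R v) : Rep R v :=
  fun a => carrier P P' (out a) *m A' a *m invmx (carrier P P' (inn a)).

Hypotheses (bu : forall l, overlap_up P P' l \in unitmx)
  (hu : forall l, carrier P P' l \in unitmx).

Lemma overlap_sub j l : (step P j l *m overlap P P' l <= step P' j l)%MS.
Proof.
rewrite /overlap mulmx_sumr summx_sub // => i _; rewrite mulmxA (flag_gr Pg Pn).
case: ltnP => ij; last by rewrite mul0mx sub0mx.
rewrite -(gr_flag Pg' Pn') mulmxA; apply: submx_trans (submxMl _ _) _.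
exact: (flag_sub Pg' Pn').
Qed.

Lemma stable_invmx n (p b : 'M[C]_n) : b \in unitmx -> (p *m b <= p)%MS ->
  (p *m invmx b <= p)%MS.
Proof.
move=> ub pb; have /eqmxP e : (p *m b == p)%MS.
  by rewrite -mxrank_leqif_eq // mxrankMfree ?row_free_unit.
have : (p <= p *m b)%MS by rewrite e.
by move=> /(submxMr (invmx b)); rewrite -mulmxA mulmxV // mulmx1.
Qed.

Lemma carrier_sub j l : (step P j l *m carrier P P' l <= step P' j l)%MS.
Proof.
rewrite /carrier mulmxA; apply: submx_trans (overlap_sub j l); apply: submxMr.
apply: stable_invmx => //.
rewrite -(upper_preserves c0 cL Pg Pn (s := id) (t := id) (overlap P P') l j).
exact: submxMl.
Qed.

Lemma carrier_inv_sub j l : (step P' j l *m invmx (carrier P P' l) <= step P j l)%MS.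
Proof.
have r : \rank (step P j l *m carrier P P' l) = \rank (step P' j l).
  by rewrite mxrankMfree ?row_free_unit ?hu // (flag_rank Pg) (flag_rank Pg').
have /eqmxP e : (step P j l *m carrier P P' l == step P' j l)%MS.
  by rewrite -mxrank_leqif_eq ?carrier_sub // r.
move: e (hu l); move: (carrier P P' l) => h e uh.
by rewrite -(eqmxMr _ e) -mulmxA mulmxV // mulmx1.
Qed.

Lemma pullback_preserves : preserves P (s := @out Q) (t := @inn Q) (pullback P P' A').
Proof.
move=> a j; apply: (oproj_sub (flag_oproj Pg _ _)); rewrite /pullback.
move: carrier_sub carrier_inv_sub; move: (carrier P P') => h h1 h2; rewrite !mulmxA.
apply: submx_trans (h2 j (inn a)); apply: submxMr.
apply: submx_trans (submxMr _ (h1 j (out a))) _.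
by rewrite -(pA' a j) submxMl.
Qed.

Lemma pullbackE a : A' a - pullback P P' A' a =
  pullback P P' A' a *m displacement P P' (inn a) - displacement P P' (out a) *m A' a.
Proof.
have e : pullback P P' A' a *m carrier P P' (inn a) = carrier P P' (out a) *m A' a.
  by rewrite /pullback (mulmxKV (hu (inn a))).
rewrite /displacement mulmxBr mulmxBl mulmx1 mul1mx e.
by rewrite opprB [RHS]addrC addrA subrK.
Qed.

Lemma displacement_lower l :
  overlap_up P P' l *m displacement P P' l = lower L P (s := id) (t := id) (overlap P P') l.
Proof.
by rewrite /displacement mulmxBr mulmx1 /carrier mulKVmx // /overlap_up subKr.
Qed.
End Transport.

(** The lower triangular part of the infinitesimal action, with the two
    occurrences of the representation decoupled as in [pullbackE]. *)
Definition twisted (P : flags) (B B' : Rep R v) (X : gauge) : Rep R v :=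
  lower L P (s := @out Q) (t := @inn Q) (fun a => B a *m X (inn a) - X (out a) *m B' a).

(** The equation satisfied by the displacement X is [upper_part] b X = 0. *)
Definition upper_part (P : flags) (b : gauge) (X : gauge) : gauge :=
  fun l => b l *m X l - lower L P (s := id) (t := id) (fun l => b l *m X l) l.

Lemma twisted_linear P B B' : fam_linear (twisted P B B').
Proof.
move=> a X Y; rewrite /twisted -(lower_linear L P a); congr (lower L P _).
apply: functional_extensionality_dep => e.
by rewrite mulmxDr mulmxDl -scalemxAr -scalemxAl opprD addrACA scalerBr.
Qed.

Lemma upper_part_linear P b : fam_linear (upper_part P b).
Proof.
move=> a X Y; apply: functional_extensionality_dep => l; rewrite /upper_part.
have e : (fun l => b l *m (a *: X l + Y l)) =
   (fun l => a *: (b l *m X l) + (b l *m Y l)).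
  by apply: functional_extensionality_dep => k; rewrite mulmxDr scalemxAr.
have := congr1 (fun f : gauge => f l) (@lower_linear _ _ v L P Q id id a (fun l => b l *m X l) (fun l => b l *m Y l)).
rewrite /= e => ->; rewrite mulmxDr -scalemxAr scalerBr opprD addrACA.
by [].
Qed.

Lemma near_bounded (T : Type) (F : set_system T) (FF : Filter F) m n
    (f : T -> 'M[C]_(m, n)) (l : 'M[C]_(m, n)) :
  f t @[t --> F] --> l -> \forall t \near F, nrm (f t) <= nrm l + 1.
Proof.
move=> /cvg_nrmP /(_ 1 ltr01); apply: filterS => t /ltW h.
rewrite -[f t](subrK l); apply: le_trans (nrmD _ _) _.
by rewrite addrC lerD2l.
Qed.
End Variations.

(** * Second order contact with the tangent space *)

Lemma transport_identity (K : pzRingType) m n (A A' B : 'M[K]_(m, n)) X Y :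
  A' - B = B *m Y - X *m A' ->
  A' - A = (B - A) + (A *m Y - X *m A) + ((B - A) *m Y - X *m (A' - A)).
Proof.
move=> e; have -> : (B - A) *m Y - X *m (A' - A) = (A' - B) - (A *m Y - X *m A).
  by rewrite e mulmxBl mulmxBr !opprD !opprK addrACA.
by rewrite [RHS]addrACA subrr addr0 [RHS]addrC addrA subrK.
Qed.

Lemma contact_bound (R : realFieldType) (xi e w x y m K : R) :
  xi <= e * K -> y <= m -> x <= m -> w <= e + xi * (x + y) ->
  0 <= xi -> 0 <= e -> 0 <= x -> 0 <= y -> 0 <= K ->
  xi * (w + e) <= (2 + 2 * m * K) * K * e ^+ 2.
Proof.
move=> hxi ym xm hw xi0 e0 x0 y0 K0; have m0 : 0 <= m by exact: le_trans xm.
have h1 : w + e <= (2 + 2 * m * K) * e.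
  have : xi * (x + y) <= (e * K) * (2 * m) by apply: ler_pM => //; lra.
  by move: hw; lra.
have h2 : 0 <= (2 + 2 * m * K) * e by rewrite !(mulr_ge0, addr_ge0).
apply: le_trans (ler_wpM2l xi0 h1) _; apply: le_trans (ler_wpM2r h2 hxi) _.
by rewrite le_eqVlt; apply/orP; left; apply/eqP; ring.
Qed.

Section Tangency.
Context {R : realType} {Q : quiver} (v : dim_vector Q).
Local Notation C := (CC R).
Variables (L : nat) (vs : 'I_L -> dim_vector Q).
Hypothesis type_ok : proper_type v vs.
Local Notation flags := (flagspace (R := R) v).
Local Notation gauge := (fam R (fun l : Q => v l) (fun l : Q => v l)).
Local Notation gdim := (@fdim Q (fun l : Q => v l) (fun l : Q => v l)).
Local Notation rdim := (@fdim (edge Q) (fun a => v (out a)) (fun a => v (inn a))).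
Local Notation overlap := (overlap L).
Local Notation overlap_up := (overlap_up L).
Local Notation carrier := (carrier L).
Local Notation displacement := (displacement L).
Local Notation pullback := (pullback L).
Local Notation lowerG P := (lower (v := v) L P (s := @id Q) (t := @id Q)).
Local Notation lowerR P := (lower (v := v) L P (s := @out Q) (t := @inn Q)).
Let cL : forall l, cum vs L l = v l. Proof. by case: type_ok. Qed.
Let c0 := cum0 vs.

Section Equal.
Variables (P : flags).
Hypotheses (Pg : graded (cum vs) P) (Pn : nested P).

Lemma overlap_diag l : overlap P P l = 1%:M.
Proof.
rewrite -(flag_top cL Pg) -(sum_gr c0 Pg); apply: eq_bigr => j _.
rewrite {1}/gr mulmxBl !(flag_gr Pg Pn) ltnSn ltnn subr0.
by [].
Qed.

Lemma lower_one l : lowerG P (fun k => 1%:M) l = 0.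
Proof.
apply: (lower_preserves L Pg Pn (s := id) (t := id)) => i j.
by rewrite mulmx1 (flag_idem Pg).
Qed.

Lemma twisted_diag A : fmx (twisted L P A A) = actmx A *m lowR L P.
Proof.
apply: fmx_inj => u; rewrite -[u]unvecfK; move: (unvecf u) => X {u}.
rewrite fmxE; last exact: twisted_linear.
rewrite mulmxA fmxE; last exact: infinitesimal_linear.
rewrite fmxE; last exact: lower_linear.
by [].
Qed.

Lemma upper_part_one : fmx (upper_part L P (fun=> 1%:M)) = 1%:M - lowG L P.
Proof.
apply: fmx_inj => u; rewrite -[u]unvecfK; move: (unvecf u) => X {u}.
rewrite fmxE; last exact: upper_part_linear.
rewrite mulmxBr mulmx1 fmxE; last exact: lower_linear.
rewrite -vecfB; congr vecf; apply: functional_extensionality_dep => l.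
rewrite /upper_part mul1mx; congr (_ - lower _ _ _ _).
by apply: functional_extensionality_dep => k; rewrite mul1mx.
Qed.
End Equal.

Section Displacement.
Variables (P P' : flags) (A A' : Rep R v).
Hypotheses (Pg : graded (cum vs) P) (Pn : nested P)
  (pA : preserves P (s := @out Q) (t := @inn Q) A)
  (Pg' : graded (cum vs) P') (Pn' : nested P')
  (pA' : preserves P' (s := @out Q) (t := @inn Q) A').
Hypotheses (bu : forall l, overlap_up P P' l \in unitmx)
  (hu : forall l, carrier P P' l \in unitmx).
Local Notation X := (displacement P P').
Local Notation B := (pullback P P' A').

(** The first summand gives the lower triangular part of A' - A, as both A and
    the pullback of A' preserve P; the second one kills X. For a suitable Z the
    matrix multiplying X is invertible when A' is close to A. *)
Lemma displacement_equation (Z : 'M[C]_(rdim, gdim)) :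
  vecf X *m (fmx (twisted L P B A') *m Z + fmx (upper_part L P (overlap_up P P'))) =
  (vrep A' - vrep A) *m lowR L P *m Z.
Proof.
have pB := pullback_preserves type_ok Pg Pn Pg' Pn' pA' bu hu.
rewrite mulmxDr mulmxA !fmxE; [|exact: upper_part_linear|exact: twisted_linear].
have -> : vecf (upper_part L P (overlap_up P P') X) = 0.
  rewrite -vecf0; congr vecf; apply: functional_extensionality_dep => l.
  rewrite /upper_part.
  have -> : (fun k => overlap_up P P' k *m X k) = lowerG P (overlap P P').
    by apply: functional_extensionality_dep => k; exact: displacement_lower.
  rewrite displacement_lower //.
  by rewrite (lower_idem c0 cL Pg Pn) subrr.
rewrite addr0 /vrep -vecfB fmxE; last exact: lower_linear.
congr (vecf _ *m Z); apply: functional_extensionality_dep => a.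
have -> : twisted L P B A' X = lowerR P (fun a => A' a - B a).
  by congr (lower _ _ _); apply: functional_extensionality_dep => b; rewrite -(pullbackE A' hu).
by rewrite !lower_sub (lower_preserves L Pg Pn pA) (lower_preserves L Pg Pn pB).
Qed.

(** The first term preserves P, the second is tangent to the orbit, and the last
    is a sum of products of small quantities. *)
Lemma displaced_difference a : A' a - A a =
  (B a - A a) + infinitesimal A X a +
  ((B a - A a) *m X (inn a) - X (out a) *m (A' a - A a)).
Proof.
exact: transport_identity (pullbackE A' hu a).
Qed.

Local Notation xi := (nrm (vecf X)).
Local Notation e := (nrm (vrep A' - vrep A)).

Lemma nrm_fam_le (Y : gauge) l : nrm (Y l) <= \sum_k nrm (Y k).
Proof.
rewrite (bigD1 l) //= lerDl sumr_ge0 // => k _; exact: nrm_ge0.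
Qed.

Lemma nrm_pullback_sub : nrm (vrep B - vrep A) <= e + xi * (nrm (vrep B) + nrm (vrep A')).
Proof.
rewrite /vrep -!vecfB !nrm_vecf -!big_split mulr_sumr -big_split /=.
apply: ler_sum => a _.
have -> : B a - A a = (A' a - A a) - (A' a - B a) by rewrite opprB [RHS]addrC addrA subrK.
apply: le_trans (nrmB _ _) _; rewrite lerD2l (pullbackE A' hu).
apply: le_trans (nrmB _ _) _; rewrite mulrDr lerD //.
  apply: le_trans (nrmM _ _) _; rewrite mulrC ler_wpM2r ?nrm_ge0 //.
  exact: (nrm_fam_le X).
apply: le_trans (nrmM _ _) _; rewrite ler_wpM2r ?nrm_ge0 //.
exact: (nrm_fam_le X).
Qed.

Definition remainder : Rep R v :=
  fun a => (B a - A a) *m X (inn a) - X (out a) *m (A' a - A a).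

Lemma nrm_remainder : nrm (vrep remainder) <= xi * (nrm (vrep B - vrep A) + e).
Proof.
rewrite /vrep -!vecfB !nrm_vecf -!big_split mulr_sumr /=.
apply: ler_sum => a _; apply: le_trans (nrmB _ _) _; rewrite mulrDr lerD //.
  apply: le_trans (nrmM _ _) _; rewrite mulrC ler_wpM2r ?nrm_ge0 //.
  exact: (nrm_fam_le X).
apply: le_trans (nrmM _ _) _; rewrite ler_wpM2r ?nrm_ge0 //.
exact: (nrm_fam_le X).
Qed.

Lemma normal_component (N : 'rV[C]_rdim) :
  N *m lowR L P = N -> N *m hadj (actmx A) = 0 ->
  rdot (vrep A' - vrep A) N = rdot (vrep remainder) N.
Proof.
move=> N1 N2.
have pB := pullback_preserves type_ok Pg Pn Pg' Pn' pA' bu hu.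
have [EE hE] : oproj (lowR L P) by exact: (lowermx_oproj c0 cL Pg Pn).
have -> : vrep A' - vrep A = (vrep B - vrep A) + vrep (infinitesimal A X) + vrep remainder.
  rewrite /vrep -!vecfB -!vecfD; congr vecf; apply: functional_extensionality_dep => a.
  exact: displaced_difference.
have e1 : rdot (vrep B - vrep A) N = 0.
  rewrite -N1 rdot_adj hE mulmxBl.
  rewrite ((lowermx_eq0 c0 cL Pg Pn B).2 pB) ((lowermx_eq0 c0 cL Pg Pn A).2 pA).
  by rewrite subrr rdot_row0 // mul0mx.
have e2 : rdot (vrep (infinitesimal A X)) N = 0.
  rewrite rdotC /vrep -(fmxE X (infinitesimal_linear A)) rdot_adj.
  by rewrite -[fmx _]/(actmx A) N2 rdot_row0 // mul0mx.
by rewrite rdotDl rdotDl e1 e2 !add0r.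
Qed.
End Displacement.

(** A family of pairs of representations, with their flags, converging to the
    same representation and flag. *)
Section Limits.
Context {T : Type} {F : set_system T} {FF : Filter F}.
Variables (P P' : T -> flags) (P0 : flags) (A A' : T -> Rep R v) (A0 : Rep R v).
Hypotheses (hP : forall jl, P z jl @[z --> F] --> P0 jl)
  (hP' : forall jl, P' z jl @[z --> F] --> P0 jl)
  (hA : forall a, A z a @[z --> F] --> A0 a)
  (hA' : forall a, A' z a @[z --> F] --> A0 a)
  (Pg : graded (cum vs) P0) (Pn : nested P0).

Lemma cvg_overlap l : overlap (P z) (P' z) l @[z --> F] --> (1%:M : 'M[C]_(v l)).
Proof.
rewrite -(overlap_diag Pg Pn); apply: cvg_sum_mx => j _.
have h1 i : step (P z) i l @[z --> F] --> step P0 i l by exact: (@hP (i, l)).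
have h2 i : step (P' z) i l @[z --> F] --> step P0 i l by exact: (@hP' (i, l)).
by apply: cvg_mulmx; apply: cvgB; solve [exact: h1 | exact: h2].
Qed.

Lemma cvg_overlap_up l : overlap_up (P z) (P' z) l @[z --> F] --> (1%:M : 'M[C]_(v l)).
Proof.
rewrite -[X in _ --> X]subr0 -(lower_one Pg Pn l); apply: cvgB; first exact: cvg_overlap.
exact: (cvg_lower FF hP cvg_overlap).
Qed.

Lemma cvg_carrier l : carrier (P z) (P' z) l @[z --> F] --> (1%:M : 'M[C]_(v l)).
Proof.
rewrite -[X in _ --> X]mulmx1 -{1}invmx1; apply: cvg_mulmx; last exact: cvg_overlap.
by apply: cvg_invmx; [exact: cvg_overlap_up|exact: unitmx1].
Qed.

Lemma cvg_pullback a : pullback (P z) (P' z) (A' z) a @[z --> F] --> A0 a.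
Proof.
have -> : A0 a = 1%:M *m A0 a *m invmx 1%:M by rewrite invmx1 mulmx1 mul1mx.
apply: cvg_mulmx; first by apply: cvg_mulmx; [exact: cvg_carrier|exact: hA'].
by apply: cvg_invmx; [exact: cvg_carrier|exact: unitmx1].
Qed.

Lemma near_units : \forall z \near F,
  (forall l, overlap_up (P z) (P' z) l \in unitmx) /\
  (forall l, carrier (P z) (P' z) l \in unitmx).
Proof.
apply: filterI; apply: filter_forall => l.
  exact: near_unitmx (@cvg_overlap_up l) (unitmx1 _ _).
exact: near_unitmx (@cvg_carrier l) (unitmx1 _ _).
Qed.

Hypothesis kernel : forall u : 'rV[C]_gdim, u *m (actmx A0 *m lowR L P0) = 0 -> u *m lowG L P0 = 0.
Hypotheses (gP : \forall z \near F, [/\ graded (cum vs) (P z), nested (P z) &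
    preserves (P z) (s := @out Q) (t := @inn Q) (A z)])
  (gP' : \forall z \near F, [/\ graded (cum vs) (P' z), nested (P' z) &
    preserves (P' z) (s := @out Q) (t := @inn Q) (A' z)]).

(** At the limit, X |-> (actmx A0) lowR has the same kernel as lowG, so lowG
    factors through it by some Z. With this Z, the matrix of
    [displacement_equation] tends to lowG + (1 - lowG) = 1. *)
Lemma displacement_bound : exists2 K : R, 0 <= K & \forall z \near F,
  nrm (vecf (displacement (P z) (P' z))) <= nrm (vrep (A' z) - vrep (A z)) * K.
Proof.
have [Z hZ] := ker_factor kernel.
pose Th z := fmx (twisted L (P z) (pullback (P z) (P' z) (A' z)) (A' z)) *m Z +
  fmx (upper_part L (P z) (overlap_up (P z) (P' z))).
have cTh : Th z @[z --> F] --> (1%:M : 'M[C]_gdim).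
  have -> : (1%:M : 'M[C]_gdim) = fmx (twisted L P0 A0 A0) *m Z + fmx (upper_part L P0 (fun=> 1%:M)).
    by rewrite twisted_diag upper_part_one -hZ addrC subrK.
  apply: cvgD.
    apply: cvg_mulmx; last by move=> W; exact: cvg_cst.
    apply: cvg_fmx => X; apply: (cvg_lower FF hP) => a.
    apply: cvgB; apply: cvg_mulmx; try (move=> W; exact: cvg_cst).
      exact: cvg_pullback.
    exact: hA'.
  apply: cvg_fmx => X l.
  have h k : overlap_up (P z) (P' z) k *m X k @[z --> F] --> 1%:M *m X k.
    by apply: cvg_mulmx; [exact: cvg_overlap_up|move=> W; exact: cvg_cst].
  apply: cvgB; first exact: h.
  exact: (cvg_lower FF hP h).
have uTh := near_unitmx (FF := FF) cTh (unitmx1 _ _).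
have cM : lowR L (P z) *m Z *m invmx (Th z) @[z --> F] --> lowR L P0 *m Z *m invmx 1%:M.
  apply: cvg_mulmx; last by apply: cvg_invmx => //; exact: unitmx1.
  by apply: cvg_mulmx; [exact: cvg_lowR|move=> W; exact: cvg_cst].
exists (nrm (lowR L P0 *m Z *m invmx 1%:M) + 1).
  by rewrite addr_ge0 ?nrm_ge0.
have h1 := near_bounded FF cM.
have h2 := filterI (filterI uTh h1) (filterI near_units (filterI gP gP')).
apply: (@filterS _ F FF _ _ _ (h2 FF FF FF FF)) => z [[u b] [[bu hu] [[Pgz Pnz pAz] [Pgz' Pnz' pAz']]]].
have := displacement_equation Pgz Pnz pAz Pgz' Pnz' pAz' bu hu Z.
rewrite -/(Th z) => E.
rewrite -[vecf _](mulmxK u) E -!mulmxA; apply: le_trans (nrmM _ _) _.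
apply: ler_wpM2l; first exact: nrm_ge0.
by rewrite !mulmxA.
Qed.

(** On a normal vector, A' - A has the same product as the remainder of
    [displaced_difference], which is of second order by
    [displacement_bound]. *)
Lemma quadratic_contact : exists K : R, \forall z \near F, forall N : 'rV[C]_rdim,
  N *m lowR L (P z) = N -> N *m hadj (actmx (A z)) = 0 ->
  `|rdot (vrep (A' z) - vrep (A z)) N| <= K * nrm (vrep (A' z) - vrep (A z)) ^+ 2 * nrm N.
Proof.
have [K K0 hK] := displacement_bound.
have b1 := near_bounded FF (cvg_vrep (FF := FF) (A := A') (A0 := A0) hA').
have b2 := near_bounded FF (cvg_vrep (FF := FF) (A := fun z => pullback (P z) (P' z) (A' z)) cvg_pullback).
set m := nrm (vrep A0) + 1 in b1 b2.
exists ((2 + 2 * m * K) * K).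
have h2 := filterI (filterI hK (filterI b1 b2)) (filterI near_units (filterI gP gP')).
apply: (@filterS _ F FF _ _ _ (h2 FF FF FF FF FF)) => z [[hKz [b1z b2z]] [[bu hu] [[Pgz Pnz pAz] [Pgz' Pnz' pAz']]]] N N1 N2.
rewrite (normal_component Pgz Pnz pAz Pgz' Pnz' pAz' bu hu N1 N2).
apply: le_trans (rdot_le _ _) _.
apply: ler_pM; rewrite ?enorm_ge0 ?enorm_nrm //.
apply: le_trans (enorm_nrm _) _; apply: le_trans (nrm_remainder _ _ _ _) _.
have hw := nrm_pullback_sub (A z) (A' z) hu.
have := contact_bound hKz b1z b2z hw (nrm_ge0 _) (nrm_ge0 _) (nrm_ge0 _) (nrm_ge0 _) K0. exact.
Qed.
End Limits.
End Tangency.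

(** * Codimension and conclusion *)

Section Codimension.
Context (R : realType) {Q : quiver} (v : dim_vector Q).
Variables (L : nat) (vs : 'I_L -> dim_vector Q).
Hypothesis type_ok : proper_type v vs.

Lemma above_sum (j : 'I_L) l :
  (v l - cum vs j.+1 l)%N = (\sum_(k < L | (j < k)%N) vs k l)%N.
Proof.
have [cL _] := type_ok; rewrite -cL {1}/cum.
under eq_bigl do rewrite ltn_ord.
rewrite (bigID (fun k : 'I_L => (k < j.+1)%N)) /= /cum addKn.
by apply: eq_bigl => k; rewrite -leqNgt.
Qed.

Lemma hom_dim_sum (I : finType) (s t : I -> Q) :
  hom_dim v vs s t = (\sum_(i : I) \sum_(j < L) \sum_(k < L | (j < k)%N)
     \dim {: 'M[CC R]_(vs j (s i), vs k (t i))})%N.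
Proof.
apply: eq_bigr => i _; apply: eq_bigr => j _.
rewrite cumS addKn above_sum big_distrr /=; apply: eq_bigr => k _.
by rewrite dimvf dim_matrix.
Qed.

End Codimension.

Section Main.
Context {R : realType} {Q : quiver} (v : dim_vector Q) (alpha : Q -> CC R).
Variables (L : nat) (vs : 'I_L -> dim_vector Q).
Hypothesis alpha_im : forall l, 'Re (alpha l) = 0.
Hypothesis type_ok : proper_type v vs.
Local Notation S := (HN_stratum alpha (v := v) vs).
Local Notation rdim := (@fdim (edge Q) (fun a => v (out a)) (fun a => v (inn a))).

(** The natural number [normal_dim] is a truncated difference; [normal_dimE]
    makes it the difference of integers, S being nonempty. *)
Lemma normal_dim_codim A : S A -> (normal_dim v vs)%:Z = HN_codim R vs.
Proof.
move=> SA; have := normal_dimE alpha_im type_ok SA.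
rewrite !(hom_dim_sum R type_ok) /HN_codim /dim_Rep_LT /dim_g_LT => <-.
by rewrite PoszD addrK.
Qed.

Lemma stratum_tangency (s0 : S) : exists K : R, \forall p \near (s0, s0),
  forall B, normal (normal_proj alpha vs) (val p.1) B ->
  `|rdot (vrep (val p.2) - vrep (val p.1)) B| <=
    K * nrm (vrep (val p.2) - vrep (val p.1)) ^+ 2 * nrm B.
Proof.
have SA (s : S) : S (val s) by exact: set_mem (valP s).
have c1 (i : S * S -> S) : i p @[p --> (s0, s0)] --> s0 ->
    (forall jl, flag_of alpha vs (val (i p)) jl @[p --> (s0, s0)] -->
       flag_of alpha vs (val s0) jl) /\
    (forall a, val (i p) a @[p --> (s0, s0)] --> val s0 a).
  move=> hi; split=> [jl|a].
    exact: (@cvg_comp _ _ _ i (fun s : S => flag_of alpha vs (val s) jl) _ _ _ hi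
      (@flag_cvg _ _ _ _ _ _ alpha_im type_ok s0 jl)).
  exact: (@cvg_comp _ _ _ i (fun s : S => val s a) _ _ _ hi (@val_rep_cvg _ _ _ _ _ _ s0 a)).
have [h1 _] := c1 fst cvg_fst; have [h3 h4] := c1 snd cvg_snd.
have [Pg Pn _ _] := flag_ofP (SA s0).
have ok (i : S * S -> S) : \forall p \near (s0, s0),
    [/\ graded (cum vs) (flag_of alpha vs (val (i p))),
        nested (flag_of alpha vs (val (i p))) &
        preserves (flag_of alpha vs (val (i p))) (s := @out Q) (t := @inn Q) (val (i p))].
  by apply: (@nearW _ (nbhs (s0, s0))) => p; have [] := flag_ofP (SA (i p)).
have ker u := (kernel_act alpha_im type_ok (SA s0) u).1.
have [K hK] := quadratic_contact type_ok h1 h3 h4 Pg Pn ker (ok fst) (ok snd).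
exists K; apply: (@filterS _ (nbhs (s0, s0)) _ _ _ _ hK) => p hp B /normal_projP [B1 B2].
exact: hp.
Qed.
End Main.

Theorem proposition6p11 (R : realType) (Q : quiver) (v : dim_vector Q)
    (alpha : Q -> CC R) (halpha : central_parameter v alpha)
    (L : nat) (vs : 'I_L -> dim_vector Q) (hvs : HN_type alpha v vs) :
  let S : set (Rep R v) := HN_stratum alpha vs in
  exists U : set (Rep R v),
    [/\ open U, S `<=` U &
      exists (n : nat) (X : vector_bundle R S n) (h : hermitian_metric X)
             (f : U -> disk_bundle h),
        [/\ n%:Z = HN_codim R vs,
            homeomorphism f &
            forall (x : S) (y : U), val x = val y ->
              val (f y) = zero_section X x]].
Proof.
move=> S; have [alpha_im _] := halpha; have [A SA] := hvs.
have [type_ok _] := HN_stratum_flag SA.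
have PiP B : S B -> oproj (normal_proj alpha vs B) /\
    \rank (normal_proj alpha vs B) = normal_dim v vs.
  move=> SB; split; first exact: normal_proj_oproj.
  exact: (normal_projrank alpha_im type_ok SB).
have [U [oU SU [X [h [f [hf h0]]]]]] :=
  @tubular_neighbourhood R (Rep R v) _ (normal_dim v vs) (@vrep R Q v) (@unvecf R _ _ _) (@vecfK _ _ _ _) (@unvecfK _ _ _ _)
    (@vecf_cont _ _ _ _) (@unvecf_cont _ _ _ _) S (flagged vs) (normal_proj alpha vs)
    PiP (normal_proj_cont alpha_im type_ok) (@flagged_closed _ _ v _ vs)
    (@HN_stratum_flagged _ _ v alpha _ vs)
    (near_flagged_stratum alpha_im type_ok) (stratum_tangency alpha_im type_ok)
    (critical_normal alpha_im type_ok).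
exists U; split=> //; exists (normal_dim v vs), X, h, f; split=> //.
exact: (normal_dim_codim alpha_im type_ok SA).
Qed.
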